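(* Let $\mu$ be a Borel probability measure on $[0,1)^2$ that is slice singular in any variable order. Let $\{g_{n_2}^{x_1}\}$, $\{g_{n_1}\}$ be its $x_2$ slice singular auxiliary sequences and $\{h_{n_1}^{x_2}\}$, $\{h_{n_2}\}$ its $x_1$ slice singular auxiliary sequences, and let $\mathcal{V}_\mu^1,\mathcal{V}_\mu^2:L^2(\mu)\to H^2(\mathbb{D}^2)$ be the two corresponding Normalized Cauchy Transforms. The following are equivalent: 1. $\mathcal{V}_\mu^1=\mathcal{V}_\mu^2$. 2. $\mathrm{Im}(\mathcal{V}_\mu^1)=\mathrm{Im}(\mathcal{V}_\mu^2)$. 3. The sequences $\{g_{n_2}^{x_1}g_{n_1}\}$ and $\{h_{n_1}^{x_2}h_{n_2}\}$ are unitarily equivalent, i.e. there is a unitary $U$ on $L^2(\mu)$ with $U(g_{n_2}^{x_1}g_{n_1})=h_{n_1}^{x_2}h_{n_2}$ for all $n_1,n_2\in\mathbb{N}$. 4. $\mu$ is a product measure.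
   Context: $\mathbb{N}=\{0,1,2,\dots\}$; ''singular'' means singular with respect to Lebesgue measure on $[0,1)$; inner products are linear in the first slot. Let $\mu_1,\mu_2$ be the marginals of $\mu$ on the variables $x_1$ and $x_2$. By Rokhlin disintegration there are a.e. unique families of Borel probability measures $\{\gamma^{x_1}\}$ and $\{\rho^{x_2}\}$ on $[0,1)$ with $\int f\,d\mu=\int\int f\,d\gamma^{x_1}(x_2)\,d\mu_1(x_1)=\int\int f\,d\rho^{x_2}(x_1)\,d\mu_2(x_2)$ for $f\in L^1(\mu)$. $\mu$ is slice singular in any variable order if $\mu_1,\mu_2$ are singular, $\gamma^{x_1}$ is singular for $\mu_1$-a.e. $x_1$, and $\rho^{x_2}$ is singular for $\mu_2$-a.e. $x_2$. Auxiliary sequence of a Borel probability measure $\nu$ on $[0,1)$: with $e_n(x)=e^{2\pi inx}$, $g_0=e_0$, $g_n=e_n-\sum_{k=0}^{n-1}\langle e_n,e_k\rangle_{L^2(\nu)}g_k$. Here $\{g_{n_1}\}$ (functions of $x_1$), $\{g_{n_2}^{x_1}\}$ (functions of $x_2$), $\{h_{n_2}\}$ (functions of $x_2$), $\{h_{n_1}^{x_2}\}$ (functions of $x_1$) are the auxiliary sequences of $\mu_1$, $\gamma^{x_1}$, $\mu_2$, $\rho^{x_2}$ respectively. The Normalized Cauchy Transforms are the isometries $\mathcal{V}_\mu^1(f)=\sum_{n_2=0}^\infty\sum_{n_1=0}^\infty\langle f,g_{n_2}^{x_1}g_{n_1}\rangle_{L^2(\mu)}z_1^{n_1}z_2^{n_2}$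 and $\mathcal{V}_\mu^2(f)=\sum_{n_1=0}^\infty\sum_{n_2=0}^\infty\langle f,h_{n_1}^{x_2}h_{n_2}\rangle_{L^2(\mu)}z_2^{n_2}z_1^{n_1}$ from $L^2(\mu)$ into $H^2(\mathbb{D}^2)$. *)

(* Defs.v *)
From HB Require Import structures.
From mathcomp Require Import all_boot all_order all_algebra.
From mathcomp Require Import complex.
From mathcomp Require Import all_classical all_reals all_analysis.

Set Implicit Arguments.
Unset Strict Implicit.
Unset Printing Implicit Defensive.

Import Order.TTheory GRing.Theory Num.Theory.
Import numFieldNormedType.Exports.

Local Open Scope classical_set_scope.
Local Open Scope complex_scope.
Local Open Scope ring_scope.

Section L2.
Context d (T : measurableType d) (R : realType).
Variable mu : {measure set T -> \bar R}.
Implicit Types f g : T -> R[i].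

Definition cintegral f : R[i] :=
  (\int[mu]_x complex.Re (f x)) +i* (\int[mu]_x complex.Im (f x)).

Definition inner f g : R[i] := cintegral (fun x => f x * (g x)^*).

(* Representatives of the classes of the complex Hilbert space L^2(mu);
   equality in L^2(mu) is equality mu-almost everywhere. *)
Definition L2 : set (T -> R[i]) := [set f : T -> R[i] |
  [/\ measurable_fun setT (fun x => complex.Re (f x)),
      measurable_fun setT (fun x => complex.Im (f x)) &
      (\int[mu]_x (complex.Re (f x) ^+ 2 + complex.Im (f x) ^+ 2)%:E < +oo)%E]].

(* A unitary operator on L^2(mu), described on representatives. *)
Definition unitary_L2 (U : (T -> R[i]) -> (T -> R[i])) : Prop :=
  [/\ {homo U : f / L2 f},
      (forall f g, L2 f -> L2 g -> {ae mu, forall x, f x = g x} ->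
        {ae mu, forall x, U f x = U g x}),
      (forall (a : R[i]) f g, L2 f -> L2 g ->
        {ae mu, forall x, U (fun y => a * f y + g y) x = a * U f x + U g x}),
      (forall f g, L2 f -> L2 g -> inner (U f) (U g) = inner f g) &
      (forall g, L2 g -> exists2 f, L2 f & {ae mu, forall x, U f x = g x})].

End L2.

Section auxiliary_sequence.
Context (R : realType).

Definition expi (n : nat) (x : R) : R[i] :=
  cos (2 * pi * n%:R * x) +i* sin (2 * pi * n%:R * x).

Variable nu : {measure set R -> \bar R}.

(* The list [:: g_0; ...; g_(n-1)]. *)
Fixpoint aux_prefix (n : nat) : seq (R -> R[i]) :=
  if n is m.+1 then
    let s := aux_prefix m in
    rcons s (fun x => expi m x -
      \sum_(k < m) inner nu (expi m) (expi k) * nth (fun=> 0) s k x)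
  else [::].

Definition aux_seq (n : nat) : R -> R[i] := nth (fun=> 0) (aux_prefix n.+1) n.

Lemma size_aux_prefix n : size (aux_prefix n) = n.
Proof. by elim: n => //= n IH; rewrite size_rcons IH. Qed.

Lemma nth_aux_prefix n k : (k < n)%N ->
  nth (fun=> 0) (aux_prefix n) k = aux_seq k.
Proof.
elim: n => // n IH; rewrite ltnS leq_eqVlt => /predU1P[->//|kn].
by rewrite /= nth_rcons size_aux_prefix kn IH.
Qed.

Lemma aux_seqE n x : aux_seq n x =
  expi n x - \sum_(k < n) inner nu (expi n) (expi k) * aux_seq k x.
Proof.
rewrite {1}/aux_seq /= nth_rcons size_aux_prefix ltnn eqxx; congr (_ - _).
by apply: eq_bigr => k _; rewrite nth_aux_prefix.
Qed.

Lemma aux_seq0 : aux_seq 0 = expi 0.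
Proof. by apply/funext => x; rewrite aux_seqE big_ord0 subr0. Qed.

End auxiliary_sequence.

HB.instance Definition _ d1 d2 (T1 : measurableType d1)
    (T2 : measurableType d2) :=
  isMeasurableFun.Build _ _ (T1 * T2)%type T1 fst measurable_fst.

HB.instance Definition _ d1 d2 (T1 : measurableType d1)
    (T2 : measurableType d2) :=
  isMeasurableFun.Build _ _ (T1 * T2)%type T2 snd measurable_snd.

(* Measures on [0, 1) and [0, 1)^2 are represented by measures on R and
   R * R that are concentrated on these sets. *)
Section slices.
Context (R : realType).
Local Notation I := (`[0, 1[%classic : set R).

Definition singular (nu : {measure set R -> \bar R}) : Prop :=
  exists N : set R, [/\ measurable N, N `<=` I,
    lebesgue_measure N = 0%E & nu (I `\` N) = 0%E].

Variable mu : probability (R * R)%type R.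

Definition marginal1 : probability R R := distribution mu fst.
Definition marginal2 : probability R R := distribution mu snd.

Definition disintegration1 (gamma : R.-pker R ~> R) : Prop :=
  (forall x1, I x1 -> gamma x1 I = 1%E) /\
  forall f : R * R -> R, mu.-integrable setT (EFin \o f) ->
    (\int[mu]_z (f z)%:E =
     \int[marginal1]_x1 \int[gamma x1]_x2 (f (x1, x2))%:E)%E.

Definition disintegration2 (rho : R.-pker R ~> R) : Prop :=
  (forall x2, I x2 -> rho x2 I = 1%E) /\
  forall f : R * R -> R, mu.-integrable setT (EFin \o f) ->
    (\int[mu]_z (f z)%:E =
     \int[marginal2]_x2 \int[rho x2]_x1 (f (x1, x2))%:E)%E.

Definition slice_singular (gamma rho : R.-pker R ~> R) : Prop :=
  [/\ singular marginal1, singular marginal2,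
      {ae marginal1, forall x1, singular (gamma x1)} &
      {ae marginal2, forall x2, singular (rho x2)}].

Definition slice_aux1 (gamma : R.-pker R ~> R) (n1 n2 : nat) (x : R * R)
    : R[i] :=
  aux_seq (gamma x.1) n2 x.2 * aux_seq marginal1 n1 x.1.

Definition slice_aux2 (rho : R.-pker R ~> R) (n1 n2 : nat) (x : R * R)
    : R[i] :=
  aux_seq (rho x.2) n1 x.1 * aux_seq marginal2 n2 x.2.

Definition product_measure_on_square : Prop :=
  exists nu1 nu2 : probability R R,
    [/\ nu1 I = 1%E, nu2 I = 1%E &
        forall A, measurable A -> mu A = (nu1 \x nu2)%E A].

End slices.

Section cauchy_transform.
Context (R : realType).

Definition bidisc : Type :=
  {z : R[i] * R[i] | (`|z.1| < 1) && (`|z.2| < 1)}.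

Definition cseries (u : nat -> R[i]) : R[i] := limn (series (u : nat -> R[i]^o)).

Variable mu : probability (R * R)%type R.

Definition NCT1 (gamma : R.-pker R ~> R) (f : R * R -> R[i]) (z : bidisc)
    : R[i] :=
  cseries (fun n2 => cseries (fun n1 =>
    inner mu f (slice_aux1 mu gamma n1 n2)
      * (val z).1 ^+ n1 * (val z).2 ^+ n2)).

Definition NCT2 (rho : R.-pker R ~> R) (f : R * R -> R[i]) (z : bidisc)
    : R[i] :=
  cseries (fun n1 => cseries (fun n2 =>
    inner mu f (slice_aux2 mu rho n1 n2)
      * (val z).2 ^+ n2 * (val z).1 ^+ n1)).

End cauchy_transform.

(* Main.v *)
(* For a singular probability nu on [0, 1) the Kaczmarz iteration along
   expi 0, expi 1, ... converges (Kwapien-Mycielski), so f |-> (<f, g_n>)_n is an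
   isometry of L^2(nu) into l^2; slicing gives the isometry on L^2(mu) for both
   orders of the variables. The coefficients are bounded, hence determined by the
   sum of the power series on the bidisc, in either order of summation.

   Equal images give for each f an f' whose second family of coefficients is the
   first one of f; by Parseval f |-> f' is unitary, and it carries the first
   family to the second.

   Given the unitary, the terms with n_2 = 0 show that the Gram matrix of the
   auxiliary sequence of mu_1 is the mu_2-average of those of rho^x. Since
   g_(n+1) = e_1 g_n + a_n, the Gram matrix determines the products
   a_n conj(a_m). At the first p with a_p != 0 for mu_1, a_p is minus the moment
   of order p + 1, whose average over x is that of mu_1; so a_p(rho^x) has
   variance 0 and is constant, and then so are all a_n(rho^x). Hence almost every
   rho^x has the moments of mu_1 and mu is a product. Conversely, for a product
   measure the slices have almost surely the moments of the opposite marginal,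
   which determine the auxiliary sequences, so the two families agree a.e. *)

Require Import Defs.
From HB Require Import structures.
From mathcomp Require Import all_boot all_order all_algebra.
From mathcomp Require Import complex.
From mathcomp Require Import all_classical all_reals all_analysis.
From mathcomp Require Import measurable_realfun.
From mathcomp Require Import ring lra.

Set Implicit Arguments.
Unset Strict Implicit.
Unset Printing Implicit Defensive.

Import Order.TTheory GRing.Theory Num.Theory.
Import numFieldNormedType.Exports.

Local Open Scope classical_set_scope.
Local Open Scope complex_scope.
Local Open Scope ring_scope.

(** * Complex-valued integrals and L^2 *)

(** The longest piece is the convergence of the Kaczmarz iteration for a singular measure.
    Classically one shows that the analytic function B built from the coefficients of e_(-1) is
    inner exactly when the measure is singular, which needs boundary values. Here B is replaced by
    polynomial truncations on a circle of radius r < 1, and singularity enters through a single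
    trigonometric polynomial p that is small in L^2 of Lebesgue measure and close to 1 in L^2(nu).
    The parameters are fixed in the order p, r, N, so every error term has to be explicit and
    uniform in the later ones. Only e_(-1) needs this analysis: conjugation by e_1 carries
    convergence to every e_j, and density with contractivity of the residual map carries it to
    L^2(nu). Density rests on the fact that an arc of the circle is a superlevel set of a shifted
    cosine. Slices are compared through their moments only. This replaces the almost sure uniqueness
    of disintegrations, and density turns equal moments back into equal measures where that is
    required. *)

Section complex_parts.
Context (R : realType).
Implicit Types z w : R[i].

(** Valued in [R], so that integrals and inequalities stay real and square roots are avoided. *)
Definition nsq z : R := complex.Re z ^+ 2 + complex.Im z ^+ 2.

Lemma ReD z w : complex.Re (z + w) = complex.Re z + complex.Re w.
Proof. by case: z w => [a b] [c d]. Qed.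
Lemma ImD z w : complex.Im (z + w) = complex.Im z + complex.Im w.
Proof. by case: z w => [a b] [c d]. Qed.
Lemma ReN z : complex.Re (- z) = - complex.Re z.
Proof. by case: z. Qed.
Lemma ImN z : complex.Im (- z) = - complex.Im z.
Proof. by case: z. Qed.
Lemma ReM z w :
  complex.Re (z * w) = complex.Re z * complex.Re w - complex.Im z * complex.Im w.
Proof. by case: z w => [a b] [c d]. Qed.
Lemma ImM z w :
  complex.Im (z * w) = complex.Re z * complex.Im w + complex.Im z * complex.Re w.
Proof. by case: z w => [a b] [c d]. Qed.
Lemma ReJ z : complex.Re z^* = complex.Re z.
Proof. by case: z. Qed.
Lemma ImJ z : complex.Im z^* = - complex.Im z.
Proof. by case: z. Qed.

Lemma complex_eq z w :
  complex.Re z = complex.Re w -> complex.Im z = complex.Im w -> z = w.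
Proof. by case: z w => [a b] [c d] /= -> ->. Qed.

Lemma nsq_ge0 z : 0 <= nsq z.
Proof. by rewrite addr_ge0 // sqr_ge0. Qed.

Lemma nsq0 : nsq 0 = 0.
Proof. by rewrite /nsq /= expr0n addr0. Qed.

Lemma nsq1 : nsq 1 = 1.
Proof. by rewrite /nsq /= expr1n expr0n addr0. Qed.

Lemma nsq_eq0 z : nsq z = 0 -> z = 0.
Proof.
move=> /eqP; rewrite paddr_eq0 ?sqr_ge0// !sqrf_eq0 => /andP[/eqP a /eqP b].
exact: complex_eq.
Qed.

Lemma nsqN z : nsq (- z) = nsq z.
Proof. by rewrite /nsq ReN ImN !sqrrN. Qed.

Lemma nsqJ z : nsq z^* = nsq z.
Proof. by rewrite /nsq ReJ ImJ !sqrrN. Qed.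

Lemma nsqM z w : nsq (z * w) = nsq z * nsq w.
Proof. by rewrite /nsq ReM ImM; ring. Qed.

Lemma nsq_real (a : R) : nsq a%:C = a ^+ 2.
Proof. by rewrite /nsq /= expr0n addr0. Qed.

Lemma nsqD_le z w : nsq (z + w) <= 2 * nsq z + 2 * nsq w.
Proof.
rewrite /nsq ReD ImD -subr_ge0.
set a := complex.Re z; set b := complex.Im z; set c := complex.Re w.
set d := complex.Im w.
by rewrite (_ : _ - _ = (a - c) ^+ 2 + (b - d) ^+ 2); [rewrite addr_ge0 ?sqr_ge0|ring].
Qed.

Lemma nsqB_le z w : nsq (z - w) <= 2 * nsq z + 2 * nsq w.
Proof. by rewrite (le_trans (nsqD_le _ _))// nsqN. Qed.

Lemma mulcJ z : z * z^* = (nsq z)%:C.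
Proof. by apply: complex_eq; rewrite ?ReM ?ImM ReJ ImJ /= /nsq; ring. Qed.

(** With [Im_mulJ_le], this supplies the dominating function in [L2_inner]; the factor 2 lost
    against the sharp bound is harmless. *)
Lemma Re_mulJ_le z w : `|complex.Re (z * w^*)| <= nsq z + nsq w.
Proof.
rewrite ReM ReJ ImJ /nsq ler_norml.
set a := complex.Re z; set b := complex.Im z; set c := complex.Re w.
set d := complex.Im w.
have := sqr_ge0 (a - c); have := sqr_ge0 (b - d).
have := sqr_ge0 (a + c); have := sqr_ge0 (b + d).
have := sqr_ge0 a; have := sqr_ge0 b; have := sqr_ge0 c; have := sqr_ge0 d.
by move=> *; apply/andP; split; nra.
Qed.

Lemma Im_mulJ_le z w : `|complex.Im (z * w^*)| <= nsq z + nsq w.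
Proof.
rewrite ImM ReJ ImJ /nsq ler_norml.
set a := complex.Re z; set b := complex.Im z; set c := complex.Re w.
set d := complex.Im w.
have := sqr_ge0 (b - c); have := sqr_ge0 (a - d).
have := sqr_ge0 (b + c); have := sqr_ge0 (a + d).
have := sqr_ge0 a; have := sqr_ge0 b; have := sqr_ge0 c; have := sqr_ge0 d.
by move=> *; apply/andP; split; nra.
Qed.

Lemma normr_Re_le z : `|complex.Re z| <= 1 + nsq z.
Proof. by have := Re_mulJ_le z 1; rewrite rmorph1 mulr1 nsq1 addrC. Qed.

Lemma normr_Im_le z : `|complex.Im z| <= 1 + nsq z.
Proof. by have := Im_mulJ_le z 1; rewrite rmorph1 mulr1 nsq1 addrC. Qed.

Lemma Re_sum n (F : 'I_n -> R[i]) :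
  complex.Re (\sum_(i < n) F i) = \sum_(i < n) complex.Re (F i).
Proof. exact: (big_morph _ ReD). Qed.
Lemma Im_sum n (F : 'I_n -> R[i]) :
  complex.Im (\sum_(i < n) F i) = \sum_(i < n) complex.Im (F i).
Proof. exact: (big_morph _ ImD). Qed.

End complex_parts.

Section measurable_complex.
Context d (T : measurableType d) (R : realType).
Implicit Types f g : T -> R[i].

Definition cmeas f := measurable_fun setT (fun x => complex.Re (f x)) /\
  measurable_fun setT (fun x => complex.Im (f x)).

Lemma cmeas_cst c : cmeas (fun=> c).
Proof. by split; exact: measurable_cst. Qed.

Lemma cmeasD f g : cmeas f -> cmeas g -> cmeas (fun x => f x + g x).
Proof.
move=> [f1 f2] [g1 g2]; split.
  by under eq_fun do rewrite ReD; exact: measurable_funD.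
by under eq_fun do rewrite ImD; exact: measurable_funD.
Qed.

Lemma cmeasM f g : cmeas f -> cmeas g -> cmeas (fun x => f x * g x).
Proof.
move=> [f1 f2] [g1 g2]; split.
  under eq_fun do rewrite ReM.
  by apply: measurable_funB; exact: measurable_funM.
under eq_fun do rewrite ImM.
by apply: measurable_funD; exact: measurable_funM.
Qed.

Lemma cmeasJ f : cmeas f -> cmeas (fun x => (f x)^*).
Proof.
move=> [f1 f2]; split; first by under eq_fun do rewrite ReJ.
by under eq_fun do rewrite ImJ; exact: measurableT_comp.
Qed.

Lemma cmeasN f : cmeas f -> cmeas (fun x => - f x).
Proof.
move=> [f1 f2]; split; first by under eq_fun do rewrite ReN; exact: measurableT_comp.
by under eq_fun do rewrite ImN; exact: measurableT_comp.
Qed.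

Lemma cmeasZ a f : cmeas f -> cmeas (fun x => a * f x).
Proof. by apply: cmeasM; exact: cmeas_cst. Qed.

Lemma cmeasB f g : cmeas f -> cmeas g -> cmeas (fun x => f x - g x).
Proof. by move=> mf mg; apply: cmeasD => //; exact: cmeasN. Qed.

Lemma cmeas_sum n (F : 'I_n -> T -> R[i]) :
  (forall i, cmeas (F i)) -> cmeas (fun x => \sum_(i < n) F i x).
Proof.
elim: n F => [|n IH] F mF.
  by under eq_fun do rewrite big_ord0; exact: cmeas_cst.
by under eq_fun do rewrite big_ord_recr /=; apply: cmeasD => //; exact: IH.
Qed.

Lemma cmeas_nsq f : cmeas f -> measurable_fun setT (fun x => nsq (f x)).
Proof. by move=> [f1 f2]; apply: measurable_funD; exact: measurable_funX. Qed.

Lemma cmeas_real (h : T -> R) : measurable_fun setT h -> cmeas (fun x => (h x)%:C).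
Proof. by move=> mh; split=> //=; exact: measurable_cst. Qed.

End measurable_complex.

Lemma cmeas_comp d d' (T : measurableType d) (T' : measurableType d')
    (R : realType) (h : T' -> T) (f : T -> R[i]) :
  measurable_fun setT h -> cmeas f -> cmeas (fun x => f (h x)).
Proof.
move=> mh [f1 f2]; split.
  exact: (measurableT_comp f1 mh).
exact: (measurableT_comp f2 mh).
Qed.

Section complex_integral.
Context d (T : measurableType d) (R : realType).
Variable mu : {measure set T -> \bar R}.
Implicit Types f g : T -> R[i].

Definition cintegrable f :=
  mu.-integrable setT (EFin \o (fun x => complex.Re (f x))) /\
  mu.-integrable setT (EFin \o (fun x => complex.Im (f x))).

Lemma integrableD_real (f g : T -> R) : mu.-integrable setT (EFin \o f) ->
  mu.-integrable setT (EFin \o g) ->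
  mu.-integrable setT (EFin \o (fun x => f x + g x)).
Proof. by move=> If Ig; have := integrableD measurableT If Ig. Qed.

Lemma integrableZ_real c (f : T -> R) : mu.-integrable setT (EFin \o f) ->
  mu.-integrable setT (EFin \o (fun x => c * f x)).
Proof. by move=> If; have := integrableZl measurableT c If. Qed.

Lemma integrableB_real (f g : T -> R) : mu.-integrable setT (EFin \o f) ->
  mu.-integrable setT (EFin \o g) ->
  mu.-integrable setT (EFin \o (fun x => f x - g x)).
Proof. by move=> If Ig; have := integrableB measurableT If Ig. Qed.

Lemma integrable_real_le (f g : T -> R) : measurable_fun setT f ->
  (forall x, `|f x| <= g x) -> mu.-integrable setT (EFin \o g) ->
  mu.-integrable setT (EFin \o f).
Proof.
move=> mf fg; apply: le_integrable => //; first exact/measurable_EFinP.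
by move=> x _ /=; rewrite lee_fin (le_trans (fg x)) // ler_norm.
Qed.

Lemma cintegrableD f g : cintegrable f -> cintegrable g ->
  cintegrable (fun x => f x + g x).
Proof.
move=> [f1 f2] [g1 g2]; split.
  by under eq_fun do rewrite ReD; exact: integrableD_real.
by under eq_fun do rewrite ImD; exact: integrableD_real.
Qed.

Lemma cintegrableZ c f : cintegrable f -> cintegrable (fun x => c * f x).
Proof.
move=> [f1 f2]; split.
  by under eq_fun do rewrite ReM; apply: integrableB_real; exact: integrableZ_real.
by under eq_fun do rewrite ImM; apply: integrableD_real; exact: integrableZ_real.
Qed.

Lemma cintegrable0 : cintegrable (fun=> 0).
Proof. by split; exact: integrable0. Qed.

Lemma cintegrable_sum n (F : 'I_n -> T -> R[i]) :
  (forall i, cintegrable (F i)) -> cintegrable (fun x => \sum_(i < n) F i x).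
Proof.
elim: n F => [|n IH] F mF.
  by under eq_fun do rewrite big_ord0; exact: cintegrable0.
by under eq_fun do rewrite big_ord_recr /=; apply: cintegrableD => //; exact: IH.
Qed.

Lemma cintegralD f g : cintegrable f -> cintegrable g ->
  cintegral mu (fun x => f x + g x) = cintegral mu f + cintegral mu g.
Proof.
move=> [f1 f2] [g1 g2]; apply: complex_eq; rewrite ?ReD ?ImD /=.
  by under eq_Rintegral do rewrite ReD; rewrite RintegralD.
by under eq_Rintegral do rewrite ImD; rewrite RintegralD.
Qed.

Lemma cintegralZ c f : cintegrable f ->
  cintegral mu (fun x => c * f x) = c * cintegral mu f.
Proof.
move=> [f1 f2]; apply: complex_eq; rewrite ?ReM ?ImM /=.
  under eq_Rintegral do rewrite ReM.
  by rewrite RintegralB ?RintegralZl //; exact: integrableZ_real.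
under eq_Rintegral do rewrite ImM.
by rewrite RintegralD ?RintegralZl //; exact: integrableZ_real.
Qed.

Lemma cintegral0 : cintegral mu (fun=> 0) = 0 :> R[i].
Proof. by apply: complex_eq; rewrite /= /Rintegral integral0. Qed.

Lemma cintegralJ f : cintegrable f ->
  cintegral mu (fun x => (f x)^*) = (cintegral mu f)^*.
Proof.
move=> [f1 f2]; apply: complex_eq; rewrite ?ReJ ?ImJ /=.
  by apply: eq_Rintegral => x _; rewrite ReJ.
rewrite -mulN1r -RintegralZl//; apply: eq_Rintegral => x _.
by rewrite ImJ mulN1r.
Qed.

Lemma cintegral_sum n (F : 'I_n -> T -> R[i]) : (forall i, cintegrable (F i)) ->
  cintegral mu (fun x => \sum_(i < n) F i x) = \sum_(i < n) cintegral mu (F i).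
Proof.
elim: n F => [|n IH] F mF.
  by under eq_fun do rewrite big_ord0; rewrite big_ord0 cintegral0.
under eq_fun do rewrite big_ord_recr /=.
by rewrite cintegralD ?big_ord_recr /= ?IH //; exact: cintegrable_sum.
Qed.

Lemma ae_eq_cintegral f g : cmeas f -> cmeas g ->
  {ae mu, forall x, f x = g x} -> cintegral mu f = cintegral mu g.
Proof.
move=> [f1 f2] [g1 g2] fg; rewrite /cintegral /Rintegral; congr Complex.
  congr fine; apply: ae_eq_integral => //.
  - exact/measurable_EFinP.
  - exact/measurable_EFinP.
  - by apply: filterS fg => x /= ->.
congr fine; apply: ae_eq_integral => //.
- exact/measurable_EFinP.
- exact/measurable_EFinP.
- by apply: filterS fg => x /= ->.
Qed.

End complex_integral.

Section L2_theory.
Context d (T : measurableType d) (R : realType).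
Variable mu : {measure set T -> \bar R}.
Implicit Types f g h : T -> R[i].

Definition nrm2 f : R := \int[mu]_x nsq (f x).

Lemma L2_cmeas f : L2 mu f -> cmeas f.
Proof. by case. Qed.

Lemma L2_integrable f : L2 mu f ->
  mu.-integrable setT (EFin \o (fun x => nsq (f x))).
Proof.
move=> [f1 f2 foo]; apply/integrableP; split.
  by apply/measurable_EFinP; exact: cmeas_nsq.
by under eq_integral => x _ do rewrite /= ger0_norm ?nsq_ge0//.
Qed.

Lemma cmeas_L2 f : cmeas f ->
  mu.-integrable setT (EFin \o (fun x => nsq (f x))) -> L2 mu f.
Proof.
move=> [f1 f2] /integrableP[_ foo]; split=> //.
by move: foo; under eq_integral => x _ do rewrite /= ger0_norm ?nsq_ge0//.
Qed.

Lemma L2_le f (h : T -> R) : cmeas f -> (forall x, nsq (f x) <= h x) ->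
  mu.-integrable setT (EFin \o h) -> L2 mu f.
Proof.
move=> mf fh Ih; apply: cmeas_L2 => //; apply: integrable_real_le Ih => //.
  exact: cmeas_nsq.
by move=> x; rewrite ger0_norm ?nsq_ge0.
Qed.

Lemma L2D f g : L2 mu f -> L2 mu g -> L2 mu (fun x => f x + g x).
Proof.
move=> Lf Lg; apply: (@L2_le _ (fun x => 2 * nsq (f x) + 2 * nsq (g x))).
- by apply: cmeasD; exact: L2_cmeas.
- by move=> x; exact: nsqD_le.
- by apply: integrableD_real; apply: integrableZ_real; exact: L2_integrable.
Qed.

Lemma L2M_bounded (h f : T -> R[i]) C : cmeas h -> (forall x, nsq (h x) <= C) ->
  L2 mu f -> L2 mu (fun x => h x * f x).
Proof.
move=> mh hC Lf; apply: (@L2_le _ (fun x => C * nsq (f x))).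
- by apply: cmeasM => //; exact: L2_cmeas.
- by move=> x; rewrite nsqM ler_wpM2r ?nsq_ge0.
- by apply: integrableZ_real; exact: L2_integrable.
Qed.

Lemma L2Z a f : L2 mu f -> L2 mu (fun x => a * f x).
Proof. by apply: (@L2M_bounded (fun=> a) _ (nsq a)) => //; exact: cmeas_cst. Qed.

Lemma L2N f : L2 mu f -> L2 mu (fun x => - f x).
Proof. by move=> /(L2Z (-1)); under eq_fun do rewrite mulN1r. Qed.

Lemma L2B f g : L2 mu f -> L2 mu g -> L2 mu (fun x => f x - g x).
Proof. by move=> Lf Lg; apply: L2D => //; exact: L2N. Qed.

Lemma L2_0 : L2 mu (fun=> 0).
Proof.
apply: (@L2_le _ (fun=> 0)) => [|x|]; [exact: cmeas_cst|by rewrite nsq0|].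
exact: integrable0.
Qed.

Lemma L2_sum n (F : 'I_n -> T -> R[i]) :
  (forall i, L2 mu (F i)) -> L2 mu (fun x => \sum_(i < n) F i x).
Proof.
elim: n F => [|n IH] F LF.
  by under eq_fun do rewrite big_ord0; exact: L2_0.
by under eq_fun do rewrite big_ord_recr /=; apply: L2D => //; exact: IH.
Qed.

Lemma L2_inner f g : L2 mu f -> L2 mu g ->
  cintegrable mu (fun x => f x * (g x)^*).
Proof.
move=> Lf Lg.
have [m1 m2] : cmeas (fun x => f x * (g x)^*).
  by apply: cmeasM; [|apply: cmeasJ]; exact: L2_cmeas.
have I : mu.-integrable setT (EFin \o (fun x => nsq (f x) + nsq (g x))).
  by apply: integrableD_real; exact: L2_integrable.
split; apply: integrable_real_le I => // x; first exact: Re_mulJ_le.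
exact: Im_mulJ_le.
Qed.

Lemma innerDl f g h : L2 mu f -> L2 mu g -> L2 mu h ->
  inner mu (fun x => f x + g x) h = inner mu f h + inner mu g h.
Proof.
move=> Lf Lg Lh; rewrite /inner -cintegralD; [|exact: L2_inner..].
by congr cintegral; apply/funext => x; rewrite mulrDl.
Qed.

Lemma innerZl a f h : L2 mu f -> L2 mu h ->
  inner mu (fun x => a * f x) h = a * inner mu f h.
Proof.
move=> Lf Lh; rewrite /inner -cintegralZ; [|exact: L2_inner].
by congr cintegral; apply/funext => x; rewrite mulrA.
Qed.

Lemma innerC f g : L2 mu f -> L2 mu g -> inner mu g f = (inner mu f g)^*.
Proof.
move=> Lf Lg; rewrite /inner -cintegralJ; [|exact: L2_inner].
by congr cintegral; apply/funext => x; rewrite rmorphM /= conjCK mulrC.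
Qed.

Lemma innerDr f g h : L2 mu f -> L2 mu g -> L2 mu h ->
  inner mu h (fun x => f x + g x) = inner mu h f + inner mu h g.
Proof.
move=> Lf Lg Lh; rewrite innerC //; last exact: L2D.
by rewrite innerDl // rmorphD /= -!innerC.
Qed.

Lemma innerZr a f h : L2 mu f -> L2 mu h ->
  inner mu h (fun x => a * f x) = a^* * inner mu h f.
Proof.
move=> Lf Lh; rewrite innerC //; last exact: L2Z.
by rewrite innerZl // rmorphM /= -innerC.
Qed.

Lemma innerNl f h : L2 mu f -> L2 mu h ->
  inner mu (fun x => - f x) h = - inner mu f h.
Proof.
move=> Lf Lh; under eq_fun do rewrite -mulN1r.
by rewrite innerZl // mulN1r.
Qed.

Lemma innerNr f h : L2 mu f -> L2 mu h ->
  inner mu h (fun x => - f x) = - inner mu h f.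
Proof.
move=> Lf Lh; rewrite innerC //; last exact: L2N.
by rewrite innerNl // rmorphN /= -innerC.
Qed.

Lemma innerBl f g h : L2 mu f -> L2 mu g -> L2 mu h ->
  inner mu (fun x => f x - g x) h = inner mu f h - inner mu g h.
Proof. by move=> Lf Lg Lh; rewrite innerDl ?innerNl //; exact: L2N. Qed.

Lemma innerBr f g h : L2 mu f -> L2 mu g -> L2 mu h ->
  inner mu h (fun x => f x - g x) = inner mu h f - inner mu h g.
Proof. by move=> Lf Lg Lh; rewrite innerDr ?innerNr //; exact: L2N. Qed.

Lemma inner0l h : inner mu (fun=> 0) h = 0.
Proof. by rewrite /inner; under eq_fun do rewrite mul0r; exact: cintegral0. Qed.

Lemma inner_suml n (F : 'I_n -> T -> R[i]) h : (forall i, L2 mu (F i)) ->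
  L2 mu h ->
  inner mu (fun x => \sum_(i < n) F i x) h = \sum_(i < n) inner mu (F i) h.
Proof.
elim: n F => [|n IH] F LF Lh.
  by under eq_fun do rewrite big_ord0; rewrite big_ord0 inner0l.
under eq_fun do rewrite big_ord_recr /=.
by rewrite innerDl ?big_ord_recr /= ?IH //; exact: L2_sum.
Qed.

Lemma inner_sumr n (F : 'I_n -> T -> R[i]) h : (forall i, L2 mu (F i)) ->
  L2 mu h ->
  inner mu h (fun x => \sum_(i < n) F i x) = \sum_(i < n) inner mu h (F i).
Proof.
move=> LF Lh; rewrite innerC //; last exact: L2_sum.
rewrite inner_suml // rmorph_sum /=; apply: eq_bigr => i _.
by rewrite -innerC.
Qed.

Lemma inner_self f : inner mu f f = (nrm2 f)%:C.
Proof.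
rewrite /inner /nrm2; apply: complex_eq => /=.
  by apply: eq_Rintegral => x _; rewrite mulcJ.
by rewrite /Rintegral integral0_eq // => x _; rewrite mulcJ.
Qed.

Lemma nrm2_ge0 f : 0 <= nrm2 f.
Proof. by apply: Rintegral_ge0 => x _; exact: nsq_ge0. Qed.

Lemma nrm2E f : L2 mu f -> (nrm2 f)%:E = (\int[mu]_x (nsq (f x))%:E)%E.
Proof.
move=> Lf; rewrite /nrm2 /Rintegral fineK //.
by apply: integrable_fin_num => //; exact: L2_integrable.
Qed.

Lemma nrm2N f : nrm2 (fun x => - f x) = nrm2 f.
Proof. by apply: eq_Rintegral => x _; rewrite nsqN. Qed.

Lemma nrm2D f g : L2 mu f -> L2 mu g ->
  nrm2 (fun x => f x + g x) = nrm2 f + nrm2 g + 2 * complex.Re (inner mu f g).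
Proof.
move=> Lf Lg; have Lfg := L2D Lf Lg.
have := inner_self (fun x => f x + g x).
rewrite innerDl // !innerDr // !inner_self (innerC Lf Lg).
by move=> /(congr1 (@complex.Re _)); rewrite !ReD ReJ /= => <-; ring.
Qed.

Lemma nrm2B f g : L2 mu f -> L2 mu g ->
  nrm2 (fun x => f x - g x) = nrm2 f + nrm2 g - 2 * complex.Re (inner mu f g).
Proof.
move=> Lf Lg; rewrite nrm2D //; last exact: L2N.
by rewrite nrm2N innerNr // ReN mulrN.
Qed.

Lemma nrm2D_le f g : L2 mu f -> L2 mu g ->
  nrm2 (fun x => f x + g x) <= 2 * nrm2 f + 2 * nrm2 g.
Proof.
move=> Lf Lg; have := nrm2_ge0 (fun x => f x - g x).
by rewrite nrm2B // nrm2D // => ?; lra.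
Qed.

Lemma nrm2Z a f : L2 mu f -> nrm2 (fun x => a * f x) = nsq a * nrm2 f.
Proof.
move=> Lf; rewrite /nrm2 -RintegralZl//; last exact: L2_integrable.
by apply: eq_Rintegral => x _; rewrite nsqM.
Qed.

Lemma nrm2_eq0 f : L2 mu f -> nrm2 f = 0 -> {ae mu, forall x, f x = 0}.
Proof.
move=> Lf f0; have := nrm2E Lf; rewrite f0 => /esym I0.
have mf : measurable_fun setT (EFin \o (fun x => nsq (f x))).
  by apply/measurable_EFinP/cmeas_nsq/L2_cmeas.
have := (ae_eq_integral_abs mu measurableT mf).1.
move=> H.
have : (\int[mu]_x `|(EFin \o (fun x => nsq (f x))) x| = 0)%E.
  rewrite -[RHS]I0; apply: eq_integral => x _ /=.
  by rewrite ger0_norm ?nsq_ge0.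
move=> /H; apply: filterS => x /(_ I) /= [].
exact: nsq_eq0.
Qed.

Lemma ae_eq_inner f f' g g' : cmeas f -> cmeas f' -> cmeas g -> cmeas g' ->
  {ae mu, forall x, f x = f' x} -> {ae mu, forall x, g x = g' x} ->
  inner mu f g = inner mu f' g'.
Proof.
move=> mf mf' mg mg' ff gg; apply: ae_eq_cintegral.
- by apply: cmeasM => //; exact: cmeasJ.
- by apply: cmeasM => //; exact: cmeasJ.
- by apply: filterS2 ff gg => x -> ->.
Qed.

Lemma ae_eq_nrm2 f f' : cmeas f -> cmeas f' ->
  {ae mu, forall x, f x = f' x} -> nrm2 f = nrm2 f'.
Proof.
move=> mf mf' ff; have := ae_eq_inner mf mf' mf mf' ff ff.
by rewrite !inner_self => -[].
Qed.

Lemma cauchy_schwarz f g : L2 mu f -> L2 mu g ->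
  nsq (inner mu f g) <= nrm2 f * nrm2 g.
Proof.
move=> Lf Lg; have [g0|g0] := eqVneq (nrm2 g) 0.
  have -> : inner mu f g = inner mu f (fun=> 0).
    apply: ae_eq_inner; try exact: L2_cmeas.
    - exact/L2_cmeas/L2_0.
    - exact: aeW.
    - exact: nrm2_eq0.
  by rewrite innerC ?inner0l ?rmorph0 ?nsq0 ?g0 ?mulr0 //; exact: L2_0.
have gp : 0 < nrm2 g by rewrite lt_neqAle eq_sym g0 nrm2_ge0.
(* Scaling by [nrm2 g] instead of dividing by it: the expansion is [nrm2 g] times the difference of
   the two sides. *)
have := nrm2_ge0 (fun x => (nrm2 g)%:C * f x - inner mu f g * g x).
rewrite nrm2B; [|exact: L2Z..].
rewrite !nrm2Z // innerZl ?innerZr //; last exact: L2Z.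
rewrite nsq_real mulrCA [X in 2 * complex.Re X]mulrCA.
rewrite [_ * inner mu f g]mulrC [inner mu f g * (inner mu f g)^*]mulcJ.
rewrite -rmorphM /= => H; rewrite -(ler_pM2r gp); nra.
Qed.

End L2_theory.

Section L2_finite.
Context d (T : measurableType d) (R : realType).
Variable mu : {measure set T -> \bar R}.
Hypothesis mu_fin : (mu setT < +oo)%E.

Lemma integrable_bounded (f : T -> R) C : measurable_fun setT f ->
  (forall x, `|f x| <= C) -> mu.-integrable setT (EFin \o f).
Proof.
move=> mf fC; apply: measurable_bounded_integrable => //.
exists C; split; first exact: num_real.
by move=> y Cy x _ /=; exact: le_trans (fC x) (ltW Cy).
Qed.

Lemma L2_bounded (f : T -> R[i]) C : cmeas f -> (forall x, nsq (f x) <= C) ->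
  L2 mu f.
Proof.
move=> mf fC; apply: cmeas_L2 => //; apply: (@integrable_bounded _ C).
  exact: cmeas_nsq.
by move=> x; rewrite ger0_norm ?nsq_ge0.
Qed.

End L2_finite.

(** * Trigonometric polynomials and the Kaczmarz iteration *)

Section exponentials.
Context (R : realType).

Definition expz (j : int) (x : R) : R[i] :=
  cos (2 * pi * j%:~R * x) +i* sin (2 * pi * j%:~R * x).

Lemma expi_expz n : @expi R n = expz n%:Z.
Proof. by []. Qed.

Lemma expzD j k x : expz (j + k) x = expz j x * expz k x.
Proof.
apply: complex_eq; rewrite ?ReM ?ImM /= intrD mulrDr mulrDl ?cosD// sinD addrC.
by rewrite addrC mulrC [X in _ + X]mulrC addrC [X in X + _]mulrC.
Qed.

Lemma expzN j x : expz (- j) x = (expz j x)^*.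
Proof.
by apply: complex_eq; rewrite ?ReJ ?ImJ /= mulrNz mulrN mulNr ?cosN ?sinN.
Qed.

Lemma expz0 x : expz 0 x = 1.
Proof. by apply: complex_eq; rewrite /= mulr0 mul0r ?cos0 ?sin0. Qed.

Lemma nsq_expz j x : nsq (expz j x) = 1.
Proof. by rewrite /nsq /= cos2Dsin2. Qed.

Lemma expzX (n : nat) x : expz n%:Z x = expz 1 x ^+ n.
Proof.
elim: n => [|n IH]; first by rewrite expz0 expr0.
by rewrite exprS -IH -expzD -PoszD add1n.
Qed.

Lemma cmeas_expz j : cmeas (expz j).
Proof.
have mlin : measurable_fun setT (fun x : R => 2 * pi * j%:~R * x).
  exact: mulrl_measurable.
split.
  apply: (measurableT_comp (f := @cos R)) => //.
  by apply: continuous_measurable_fun; exact: continuous_cos.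
apply: (measurableT_comp (f := @sin R)) => //.
by apply: continuous_measurable_fun; exact: continuous_sin.
Qed.

(** Generated rather than given by coefficients: linear properties follow by an induction with two
    cases. *)
Inductive trig : (R -> R[i]) -> Prop :=
| trig_expz j : trig (expz j)
| trig_lin a f g : trig f -> trig g -> trig (fun x => a * f x + g x).

Lemma trig0 : trig (fun=> 0).
Proof.
have := trig_lin (-1) (trig_expz 0) (trig_expz 0).
by congr trig; apply/funext => x; rewrite mulN1r addNr.
Qed.

Lemma trigZ a f : trig f -> trig (fun x => a * f x).
Proof.
move=> tf; have := trig_lin a tf trig0.
by congr trig; apply/funext => x; rewrite addr0.
Qed.

Lemma trigD f g : trig f -> trig g -> trig (fun x => f x + g x).
Proof.
move=> tf tg; have := trig_lin 1 tf tg.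
by congr trig; apply/funext => x; rewrite mul1r.
Qed.

Lemma trigB f g : trig f -> trig g -> trig (fun x => f x - g x).
Proof.
move=> tf tg; have := trig_lin (-1) tg tf.
by congr trig; apply/funext => x; rewrite mulN1r addrC.
Qed.

Lemma trig_cst c : trig (fun=> c).
Proof.
have := trigZ c (trig_expz 0).
by congr trig; apply/funext => x; rewrite expz0 mulr1.
Qed.

Lemma trigM f g : trig f -> trig g -> trig (fun x => f x * g x).
Proof.
move=> tf tg; elim: tf => [j|a f1 f2 _ IH1 _ IH2].
  elim: tg => [k|a f1 f2 _ IH1 _ IH2].
    have := trig_expz (j + k).
    by congr trig; apply/funext => x; rewrite expzD.
  have := trig_lin a IH1 IH2.
  by congr trig; apply/funext => x; rewrite mulrDr mulrCA.
have := trig_lin a IH1 IH2.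
by congr trig; apply/funext => x; rewrite mulrDl mulrA.
Qed.

Lemma trigJ f : trig f -> trig (fun x => (f x)^*).
Proof.
elim=> [j|a f1 f2 _ IH1 _ IH2].
  by have := trig_expz (- j); congr trig; apply/funext => x; rewrite expzN.
have := trig_lin (a^*) IH1 IH2.
by congr trig; apply/funext => x; rewrite rmorphD rmorphM.
Qed.

Lemma trig_cmeas f : trig f -> cmeas f.
Proof.
elim=> [j|a f1 f2 _ IH1 _ IH2]; first exact: cmeas_expz.
by apply: cmeasD => //; exact: cmeasZ.
Qed.

Lemma trig_bounded f : trig f -> exists C, forall x, nsq (f x) <= C.
Proof.
elim=> [j|a f1 f2 _ [C1 h1] _ [C2 h2]]; first by exists 1 => x; rewrite nsq_expz.
exists (2 * (nsq a * C1) + 2 * C2) => x.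
rewrite (le_trans (nsqD_le _ _))// nsqM; apply: lerD.
  by rewrite ler_pM2l// ler_wpM2l ?nsq_ge0.
by rewrite ler_pM2l.
Qed.

End exponentials.
Arguments trig_expz {R} j.

(** The share of [e] granted to a term that gets multiplied by [s]; the [+ 1] keeps the quotient
    meaningful at [s = 0]. *)
Lemma scaled_share_le (R : realFieldType) (s e : R) : 0 <= s -> 0 < e ->
  s * (e / (4 * (s + 1))) <= e / 4.
Proof.
move=> s0 e0; rewrite mulrA ler_pdivrMr; last by lra.
have -> : e / 4 * (4 * (s + 1)) = e * (s + 1) by field.
nra.
Qed.

(** * Kaczmarz residuals and the reduction of their convergence to one exponential *)

Section kaczmarz.
Context (R : realType).
Variable nu : {measure set R -> \bar R}.
Hypothesis nu1 : nu setT = 1%E.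
Implicit Types f g : R -> R[i].

Let nu_fin : (nu setT < +oo)%E.
Proof. by rewrite nu1 ltry. Qed.

Lemma trig_L2 f : trig f -> L2 nu f.
Proof.
by move=> tf; have [C fC] := trig_bounded tf; apply: L2_bounded fC => //;
  exact: trig_cmeas.
Qed.

Lemma L2_expz j : L2 nu (expz j).
Proof. exact/trig_L2/trig_expz. Qed.

Lemma L2_expi n : L2 nu (expi n).
Proof. exact: (L2_expz n%:Z). Qed.

Lemma L2_expzM j f : L2 nu f -> L2 nu (fun x => expz j x * f x).
Proof.
by apply: (@L2M_bounded _ _ _ nu _ _ 1);
  [exact: cmeas_expz|move=> x; rewrite nsq_expz].
Qed.

(** The Fourier-Stieltjes coefficient of index [- j] in the usual sign convention. *)
Definition mom (j : int) : R[i] := cintegral nu (expz j).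

(** The Gram matrix of the exponentials is Toeplitz. *)
Lemma inner_expz j k : inner nu (expz j) (expz k) = mom (j - k).
Proof. by congr cintegral; apply/funext => x; rewrite expzD expzN. Qed.

Lemma mom0 : mom 0 = 1.
Proof.
rewrite /mom (_ : expz 0 = fun=> 1); last by apply/funext => x; rewrite expz0.
apply: complex_eq => /=; rewrite /Rintegral ?integral0//.
by rewrite integral_cst// mul1e nu1.
Qed.

Lemma nrm2_expz j : nrm2 nu (expz j) = 1.
Proof. by have := inner_expz j j; rewrite inner_self subrr mom0 => -[]. Qed.

Lemma momN j : mom (- j) = (mom j)^*.
Proof.
have := inner_expz 0 j; rewrite sub0r => <-.
by rewrite innerC; [rewrite inner_expz subr0|exact: L2_expz..].
Qed.

Lemma mom_le1 j : nsq (mom j) <= 1.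
Proof.
have := inner_expz j 0; rewrite subr0 => <-.
by rewrite (le_trans (cauchy_schwarz _ _)) ?nrm2_expz ?mulr1//; exact: L2_expz.
Qed.

Lemma aux_seq_trig n : trig (aux_seq nu n).
Proof.
have [m] := ubnP n; elim: m n => // m IH n; rewrite ltnS => nm.
rewrite (_ : aux_seq nu n = fun x => expi n x -
  \sum_(k < n) inner nu (expi n) (expi k) * aux_seq nu k x); last first.
  by apply/funext => x; exact: aux_seqE.
apply: trigB; first exact: (trig_expz n%:Z).
suff H l : (l <= n)%N ->
    trig (fun x => \sum_(k < l) inner nu (expi n) (expi k) * aux_seq nu k x).
  exact: H.
elim: l => [|l IHl] ln; first by under eq_fun do rewrite big_ord0; exact: trig0.
under eq_fun do rewrite big_ord_recr /=.
apply: trigD; first by apply: IHl; exact: ltnW.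
by apply: trigZ; apply: IH; rewrite (leq_trans ln).
Qed.

Lemma L2_aux n : L2 nu (aux_seq nu n).
Proof. exact/trig_L2/aux_seq_trig. Qed.

(* The residual after [n] steps of the Kaczmarz iteration: by [kresS] each step
   removes the component along [expi n], and [inner_aux] shows that the auxiliary
   sequence records the removed coefficients. *)
Definition kres f n x := f x - \sum_(k < n) inner nu f (aux_seq nu k) * expi k x.

Lemma kres0 f : kres f 0 = f.
Proof. by apply/funext => x; rewrite /kres big_ord0 subr0. Qed.

Lemma L2_kres f n : L2 nu f -> L2 nu (kres f n).
Proof.
move=> Lf; apply: L2B => //; apply: L2_sum => i; apply: L2Z; exact: L2_expi.
Qed.

Lemma inner_aux f n : L2 nu f ->
  inner nu f (aux_seq nu n) = inner nu (kres f n) (expi n).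
Proof.
move=> Lf.
have Li := L2_expi; have La := L2_aux.
have Ls : L2 nu (fun x => \sum_(k < n) inner nu f (aux_seq nu k) * expi k x).
  by apply: L2_sum => i; exact: L2Z.
have Ls' : L2 nu (fun x => \sum_(k < n) inner nu (expi n) (expi k) * aux_seq nu k x).
  by apply: L2_sum => i; exact: L2Z.
rewrite (_ : aux_seq nu n = fun x => expi n x -
  \sum_(k < n) inner nu (expi n) (expi k) * aux_seq nu k x); last first.
  by apply/funext => x; exact: aux_seqE.
rewrite innerBr // innerBl //; congr (_ - _).
rewrite inner_sumr //; last by move=> i; exact: L2Z.
rewrite inner_suml //; last by move=> i; exact: L2Z.
(* Both sides subtract the same terms, the recurrence of [aux_seq] being adjoint to the residual
   sum. *)
apply: eq_bigr => i _; rewrite innerZr // innerZl //.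
by rewrite -innerC // mulrC.
Qed.

Lemma kresS f n : L2 nu f -> kres f n.+1 =
  fun x => kres f n x - inner nu (kres f n) (expi n) * expi n x.
Proof.
move=> Lf; apply/funext => x.
by rewrite /kres big_ord_recr /= opprD addrA -inner_aux.
Qed.

(** A step projects away from the unit vector [expi n], so Pythagoras applies. *)
Lemma nrm2_kresS f n : L2 nu f ->
  nrm2 nu (kres f n.+1) = nrm2 nu (kres f n) - nsq (inner nu f (aux_seq nu n)).
Proof.
move=> Lf; have Lk := L2_kres n Lf; have Li := L2_expi n.
rewrite kresS // nrm2B //; last exact: L2Z.
rewrite nrm2Z // innerZr // -inner_aux // [X in complex.Re X]mulrC mulcJ /=.
by rewrite [nrm2 nu (expi n)](nrm2_expz n%:Z); ring.
Qed.

(** Bessel's inequality for the auxiliary sequence with its exact defect: Parseval for [f] amounts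
    to the vanishing of the residual norms. *)
Lemma kaczmarz_energy f n : L2 nu f ->
  nrm2 nu f = \sum_(k < n) nsq (inner nu f (aux_seq nu k)) + nrm2 nu (kres f n).
Proof.
move=> Lf; elim: n => [|n IH]; first by rewrite big_ord0 add0r kres0.
by rewrite big_ord_recr /= nrm2_kresS // {1}IH; ring.
Qed.

Lemma nrm2_kres_le f n : L2 nu f -> nrm2 nu (kres f n) <= nrm2 nu f.
Proof.
move=> Lf; rewrite (kaczmarz_energy n Lf) lerDr sumr_ge0 // => i _.
exact: nsq_ge0.
Qed.

Lemma nrm2_kres_homo f m n : L2 nu f -> (m <= n)%N ->
  nrm2 nu (kres f n) <= nrm2 nu (kres f m).
Proof.
move=> Lf /subnK <-; elim: (n - m)%N => // k IH.
by rewrite addSn nrm2_kresS // (le_trans _ IH)// gerBl nsq_ge0.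
Qed.

Lemma kres_lin a f g n : L2 nu f -> L2 nu g ->
  kres (fun x => a * f x + g x) n = fun x => a * kres f n x + kres g n x.
Proof.
move=> Lf Lg; apply/funext => x; rewrite /kres mulrBr mulr_sumr.
rewrite addrACA -opprD -big_split /=; congr (_ - _).
apply: eq_bigr => k _; rewrite innerDl ?innerZl //; try exact: L2_aux.
  by rewrite mulrDl mulrA.
exact: L2Z.
Qed.

(* Conjugating a Kaczmarz step by multiplication by [expz 1] advances its index
   by one, so only the initial step at [expi 0] has to be accounted for. *)
Lemma kres_shift f n : L2 nu f ->
  kres (fun x => expz 1 x * f x) n.+1 =
  fun x => expz 1 x * kres (fun y => f y -
    inner nu (fun z => expz 1 z * f z) (expi 0) * expz (- 1) y) n x.
Proof.
move=> Lf; set c := inner _ _ _; set f' := fun y => _ - _.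
have Lf' : L2 nu f' by apply: L2B => //; apply: L2Z; exact: L2_expz.
have LSf := L2_expzM 1 Lf.
elim: n => [|n IH].
  rewrite kresS // !kres0; apply/funext => x.
  by rewrite /f' mulrBr mulrCA -expzD subrr.
rewrite kresS // IH [in RHS]kresS //; apply/funext => x.
rewrite [RHS]mulrBr [in RHS]mulrCA; congr (_ - _ * _); last first.
  by rewrite !expi_expz -expzD -PoszD add1n.
congr cintegral; apply/funext => y; rewrite !expi_expz -add1n PoszD expzD.
by rewrite rmorphM /= mulrACA mulcJ nsq_expz mul1r.
Qed.

Definition kvanish f := L2 nu f /\
  forall e, 0 < e -> exists N, forall n, (N <= n)%N -> nrm2 nu (kres f n) <= e.

Lemma kvanishP f : L2 nu f ->
  (forall e, 0 < e -> exists n, nrm2 nu (kres f n) <= e) -> kvanish f.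
Proof.
move=> Lf H; split=> // e /H[N hN]; exists N => n Nn.
by apply: le_trans hN; exact: nrm2_kres_homo.
Qed.

Lemma kvanish_lin a f g : kvanish f -> kvanish g ->
  kvanish (fun x => a * f x + g x).
Proof.
move=> [Lf Hf] [Lg Hg]; apply: kvanishP => [|e e0]; first by apply: L2D=> //; exact: L2Z.
have a0 := nsq_ge0 a.
(* [nrm2D_le] doubles both norms, hence shares of [e / 4]. *)
have [|N1 h1] := Hf (e / (4 * (nsq a + 1))); first by rewrite divr_gt0//; lra.
have [|N2 h2] := Hg (e / 4); first by rewrite divr_gt0.
exists (maxn N1 N2); rewrite kres_lin //.
rewrite (le_trans (nrm2D_le _ _))//; [by apply: L2Z; exact: L2_kres|exact: L2_kres|].
rewrite nrm2Z; last exact: L2_kres.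
have {}h1 := h1 _ (leq_maxl N1 N2); have {}h2 := h2 _ (leq_maxr N1 N2).
have : nsq a * nrm2 nu (kres f (maxn N1 N2)) <= e / 4.
  apply: (@le_trans _ _ (nsq a * (e / (4 * (nsq a + 1))))).
    by rewrite ler_wpM2l.
  exact: scaled_share_le.
move: h2; move: (nsq a * _) (nrm2 nu (kres g _)) => u v; clear.
lra.
Qed.

Lemma nrm2_expzM j f : nrm2 nu (fun x => expz j x * f x) = nrm2 nu f.
Proof. by apply: eq_Rintegral => x _; rewrite nsqM nsq_expz mul1r. Qed.

Lemma kvanish0 : kvanish (expz 0).
Proof.
apply: kvanishP => [|e e0]; first exact: L2_expz.
exists 1%N; rewrite kresS ?kres0; last exact: L2_expz.
rewrite (_ : (fun x => _) = fun=> 0); last first.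
  apply/funext => x; rewrite (inner_expz 0 0) subrr mom0 mul1r.
  by rewrite [expi 0 x]expz0 expz0 subrr.
by rewrite /nrm2 nsq0 /Rintegral integral0 ltW.
Qed.

Section shifts.
Hypothesis kv : kvanish (expz (- 1)).

(** By [kres_shift] the residual has the norm of that of [f - c * expz (- 1)], a combination of two
    functions already treated. *)
Lemma kvanish_up f : kvanish f -> kvanish (fun x => expz 1 x * f x).
Proof.
move=> kf; have Lf := kf.1; apply: kvanishP => [|e e0]; first exact: L2_expzM.
set c := inner nu (fun z => expz 1 z * f z) (expi 0).
have E : (fun x => - c * expz (- 1) x + f x) = fun y => f y - c * expz (- 1) y.
  by apply/funext => x; rewrite mulNr addrC.
have := kvanish_lin (- c) kv kf; rewrite E => -[_ /(_ _ e0)[N hN]].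
exists N.+1; rewrite kres_shift // nrm2_expzM.
exact: hN.
Qed.

(** The shift identity read backwards: the residual of [f = expz 1 * g] controls that of
    [g - c * expz (- 1)], and the last term is added back. *)
Lemma kvanish_down f : kvanish f -> kvanish (fun x => expz (- 1) x * f x).
Proof.
move=> kf; have Lf := kf.1; set g := fun x => expz (- 1) x * f x.
have Lg : L2 nu g by exact: L2_expzM.
have fE : f = fun x => expz 1 x * g x.
  by apply/funext => x; rewrite /g mulrA -expzD subrr expz0 mul1r.
set c := inner nu (fun z => expz 1 z * g z) (expi 0).
have kg : kvanish (fun y => g y - c * expz (- 1) y).
  apply: kvanishP => [|e e0].
    by apply: L2B => //; apply: L2Z; exact: L2_expz.
  have [N hN] := kf.2 _ e0; exists N.
  have := hN _ (leqnSn N).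
  by rewrite {1}fE kres_shift // nrm2_expzM.
have := kvanish_lin c kv kg.
by congr kvanish; apply/funext => x; rewrite addrC subrK.
Qed.

Lemma kvanish_trig f : trig f -> kvanish f.
Proof.
elim=> [j|a f1 f2 _ IH1 _ IH2]; last exact: kvanish_lin.
elim/int_rec: j => [|n IH|n IH]; first exact: kvanish0.
  have := kvanish_up IH; congr kvanish; apply/funext => x.
  by rewrite -expzD -PoszD add1n.
have := kvanish_down IH; congr kvanish; apply/funext => x.
by rewrite -expzD -opprD -PoszD add1n.
Qed.

End shifts.

End kaczmarz.

(** * Density of trigonometric polynomials *)

Section smoothstep.
Context (R : realType).
Implicit Types y : R.

(* The iterates map [-1, 1] pointwise to the sign function and, being
   polynomial, preserve trigonometric polynomials; so the indicator of a
   superlevel set of a trigonometric polynomial is a bounded pointwise limit of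
   trigonometric polynomials. *)
Definition smoothstep y : R := y * (3 - y ^+ 2) / 2.

Lemma smoothstepN y : smoothstep (- y) = - smoothstep y.
Proof. by rewrite /smoothstep sqrrN !mulNr. Qed.

Lemma iter_smoothstepN n y : iter n smoothstep (- y) = - iter n smoothstep y.
Proof. by elim: n => //= n ->; rewrite smoothstepN. Qed.

Lemma iter_smoothstep0 n : iter n smoothstep 0 = 0.
Proof. by elim: n => //= n ->; rewrite /smoothstep !mul0r. Qed.

(** One iteration multiplies the distance of [z] to 1 by [(1 - z) * (2 + z) / 2], which is at most
    [1 - z / 2], hence at most [1 - y / 2] as the iterates stay above [y]. *)
Lemma iter_smoothstep_bound n y : 0 < y -> y <= 1 ->
  [/\ y <= iter n smoothstep y, iter n smoothstep y <= 1 &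
      1 - iter n smoothstep y <= (1 - y / 2) ^+ n].
Proof.
move=> y0 y1; elim: n => [|n [yz z1 zn]] /=.
  by split; rewrite ?expr0 //; lra.
move: (iter n smoothstep y) yz z1 zn => z yz z1 zn; rewrite /smoothstep.
have s1 : 1 - z * (3 - z ^+ 2) / 2 = (1 - z) * ((1 - z) * (2 + z) / 2) by field.
split.
- rewrite -subr_ge0 (_ : _ - y = (z - y) + z * ((1 - z) * (1 + z)) / 2); last by field.
  rewrite addr_ge0 ?subr_ge0// divr_ge0// !mulr_ge0//; lra.
- rewrite -subr_ge0 s1 mulr_ge0 ?subr_ge0// divr_ge0// mulr_ge0//; lra.
- rewrite s1 exprSr; apply: ler_pM => //; first by rewrite subr_ge0.
    by rewrite divr_ge0// mulr_ge0//; lra.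
  nra.
Qed.

Lemma iter_smoothstep_norm n y : `|y| <= 1 -> `|iter n smoothstep y| <= 1.
Proof.
have [y0|y0|->] := ltgtP y 0; last by rewrite iter_smoothstep0 normr0.
  rewrite ltr0_norm// => y1; rewrite -[y]opprK iter_smoothstepN normrN.
  have y0' : 0 < - y by rewrite oppr_gt0.
  have [a b _] := iter_smoothstep_bound n y0' y1.
  by rewrite ger0_norm// (le_trans _ a)// ltW.
rewrite gtr0_norm// => y1.
have [a b _] := iter_smoothstep_bound n y0 y1.
by rewrite ger0_norm// (le_trans _ a)// ltW.
Qed.

Lemma cvg_iter_smoothstep y : `|y| <= 1 ->
  (fun n => iter n smoothstep y) @ \oo --> Num.sg y.
Proof.
wlog y0 : y / 0 <= y => [H|].
  have [/H//|/ltW y0] := leP 0 y; rewrite -normrN => y1.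
  rewrite -[y]opprK sgrN; under eq_fun do rewrite iter_smoothstepN.
  by apply: cvgN; apply: H; rewrite ?oppr_ge0.
rewrite ger0_norm// => y1.
move: y0; rewrite le_eqVlt => /predU1P[<-|y0].
  by rewrite sgr0; under eq_fun do rewrite iter_smoothstep0; exact: cvg_cst.
rewrite gtr0_sg//.
apply: (@squeeze_cvgr _ _ _ _ (fun n => 1 - (1 - y / 2) ^+ n) (fun=> 1)).
- apply: nearW => n; have [a b c] := iter_smoothstep_bound n y0 y1.
  by apply/andP; split=> //; lra.
- rewrite -[X in _ --> X]subr0; apply: cvgB; first exact: cvg_cst.
  by apply: cvg_expr; rewrite ger0_norm; lra.
- exact: cvg_cst.
Qed.

End smoothstep.

Section density.
Context (R : realType).
Variable lam : {measure set R -> \bar R}.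
Hypothesis lam_fin : (lam setT < +oo)%E.
Hypothesis lamI : lam (~` `[0, 1[%classic) = 0%E.
Implicit Types f g : R -> R[i].

Lemma trig_L2_fin f : trig f -> L2 lam f.
Proof.
by move=> tf; have [C fC] := trig_bounded tf; apply: L2_bounded fC => //;
  exact: trig_cmeas.
Qed.

(** The closure of the trigonometric polynomials. The measure has arbitrary finite mass because it
    will be the sum of Lebesgue measure and a singular probability. *)
Definition dens f := L2 lam f /\
  forall e, 0 < e -> exists2 p, trig p & nrm2 lam (fun x => f x - p x) <= e.

Lemma dens_trig f : trig f -> dens f.
Proof.
move=> tf; split=> [|e e0]; first exact: trig_L2_fin.
exists f => //; under eq_fun do rewrite subrr.
by rewrite /nrm2 nsq0 /Rintegral integral0 ltW.
Qed.

Lemma dens_lin a f g : dens f -> dens g -> dens (fun x => a * f x + g x).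
Proof.
move=> [Lf Hf] [Lg Hg]; split=> [|e e0]; first by apply: L2D=> //; exact: L2Z.
have a0 := nsq_ge0 a.
have [|p tp h1] := Hf (e / (4 * (nsq a + 1))); first by rewrite divr_gt0//; lra.
have [|q tq h2] := Hg (e / 4); first by rewrite divr_gt0.
exists (fun x => a * p x + q x); first exact: trig_lin.
have Lp := trig_L2_fin tp; have Lq := trig_L2_fin tq.
rewrite (_ : (fun x => _) = fun x => a * (f x - p x) + (g x - q x)); last first.
  by apply/funext => x; rewrite mulrBr opprD addrACA.
have LA : L2 lam (fun x => a * (f x - p x)) by apply: L2Z; exact: L2B.
have LB : L2 lam (fun x => g x - q x) by exact: L2B.
apply: (le_trans (nrm2D_le LA LB)); rewrite nrm2Z; last exact: L2B.
have : nsq a * nrm2 lam (fun x => f x - p x) <= e / 4.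
  apply: (@le_trans _ _ (nsq a * (e / (4 * (nsq a + 1))))).
    by rewrite ler_wpM2l.
  exact: scaled_share_le.
move: h2; move: (nsq a * _) (nrm2 lam (fun x => g x - q x)) => u v; clear; lra.
Qed.

Lemma dens_lim f : L2 lam f -> (forall e, 0 < e ->
    exists2 g, dens g & nrm2 lam (fun x => f x - g x) <= e) -> dens f.
Proof.
move=> Lf H; split=> // e e0.
have [|g [Lg Hg] h1] := H (e / 4); first by rewrite divr_gt0.
have [|p tp h2] := Hg (e / 4); first by rewrite divr_gt0.
exists p => //; have Lp := trig_L2_fin tp.
rewrite (_ : (fun x => _) = fun x => (f x - g x) + (g x - p x)); last first.
  by apply/funext => x; rewrite addrA subrK.
have LA : L2 lam (fun x => f x - g x) by exact: L2B.
have LB : L2 lam (fun x => g x - p x) by exact: L2B.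
apply: (le_trans (nrm2D_le LA LB)).
move: h1 h2; move: (nrm2 lam (fun x => f x - g x)) (nrm2 lam _) => u v; clear; lra.
Qed.

(** Trigonometric polynomials are periodic, so functions can be matched on one period only; this
    discards the values off [[0, 1)]. *)
Lemma dens_ae f g : cmeas f -> {ae lam, forall x, f x = g x} -> dens g -> dens f.
Proof.
move=> mf fg [Lg Hg].
have Lf : L2 lam f.
  case: mf => m1 m2; split=> //; have [n1 n2 oo] := Lg.
  rewrite (_ : (\int[lam]_x _)%E = \int[lam]_x (nsq (g x))%:E)%E //.
  apply: ae_eq_integral => //.
  - by apply/measurable_EFinP; exact: (@cmeas_nsq _ _ _ f).
  - by apply/measurable_EFinP; exact: (@cmeas_nsq _ _ _ g).
  - by apply: filterS fg => x /= ->.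
split=> // e /Hg[p tp hp]; exists p => //.
apply: le_trans hp; rewrite (@ae_eq_nrm2 _ _ _ _ _ (fun x => g x - p x))//.
- by apply: cmeasB => //; exact: trig_cmeas.
- by apply: cmeasB; [exact: L2_cmeas Lg|exact: trig_cmeas].
- by apply: filterS fg => x ->.
Qed.

Lemma nrm2_cvg0 (f_ : nat -> R -> R[i]) f (h : R -> R) :
  (forall n, cmeas (f_ n)) -> cmeas f ->
  (forall x, (fun n => nsq (f x - f_ n x)) @ \oo --> (0 : R)) ->
  lam.-integrable setT (EFin \o h) ->
  (forall n x, nsq (f x - f_ n x) <= h x) ->
  forall e, 0 < e -> exists n, nrm2 lam (fun x => f x - f_ n x) <= e.
Proof.
move=> mf_ mf cf Ih fh e e0.
have m n : measurable_fun setT (EFin \o (fun x => nsq (f x - f_ n x))).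
  by apply/measurable_EFinP; apply: cmeas_nsq; exact: cmeasB.
have c0 : {ae lam, forall x, setT x ->
    (fun n => (nsq (f x - f_ n x))%:E) @ \oo --> 0%E}.
  apply: aeW => x _; apply: cvg_EFin; first exact: nearW.
  exact: cf.
pose G n x := nsq (f x - f_ n x).
have b0 : {ae lam, forall x, forall n : nat, setT x ->
    (`|(EFin \o G n) x| <= (EFin \o h) x)%E}.
  by apply: aeW => x n _; rewrite /= lee_fin ger0_norm ?nsq_ge0//; exact: fh.
have m0 : measurable_fun setT (fun _ : R => 0%E : \bar R) by exact: measurable_cst.
have [_ _] := dominated_convergence measurableT m m0 c0 Ih b0.
rewrite integral0 => /fine_cvgP[_ /cvgr_lt /(_ _ e0)[N _ /(_ N (leqnn N)) hN]].
by exists N; rewrite ltW.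
Qed.

Lemma dens_dct (f_ : nat -> R -> R[i]) f (h : R -> R) :
  (forall n, dens (f_ n)) -> L2 lam f ->
  (forall x, (fun n => nsq (f x - f_ n x)) @ \oo --> (0 : R)) ->
  lam.-integrable setT (EFin \o h) ->
  (forall n x, nsq (f x - f_ n x) <= h x) -> dens f.
Proof.
move=> df_ Lf cf Ih fh; apply: dens_lim => // e e0.
have [|n hn] := @nrm2_cvg0 f_ f h _ (L2_cmeas Lf) cf Ih fh e e0.
  by move=> n; exact: L2_cmeas (df_ n).1.
by exists (f_ n).
Qed.

End density.

Section density_all.
Context (R : realType).
Variable lam : {measure set R -> \bar R}.
Hypothesis lam_fin : (lam setT < +oo)%E.
Hypothesis lamI : lam (~` `[0, 1[%classic) = 0%E.
Implicit Types f g : R -> R[i].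

Lemma trig_smoothstep (h : R -> R) n : trig (fun x => (h x)%:C) ->
  trig (fun x => (iter n (@smoothstep R) (h x))%:C).
Proof.
move=> th; elim: n => //= n IH.
rewrite (_ : (fun x => _) = fun x => 2^-1 * ((iter n (@smoothstep R) (h x))%:C *
    (3 - (iter n (@smoothstep R) (h x))%:C * (iter n (@smoothstep R) (h x))%:C))).
  by apply: trigZ; apply: trigM => //; apply: trigB; [exact: trig_cst|exact: trigM].
apply/funext => x; move: (iter _ _ _) => y; rewrite /smoothstep.
by apply: complex_eq; simpc; rewrite /=; field.
Qed.

(** With [sg] the sign of [h], the indicator is [(sg + sg ^+ 2) / 2], approximated by the same
    expression in the iterates. The error lies in [[-2, 2]], whence the dominating constant 4. *)
Lemma dens_gt0 (h : R -> R) : trig (fun x => (h x)%:C) -> (forall x, `|h x| <= 1) ->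
  dens lam (fun x => (\1_[set x | 0 < h x] x)%:C).
Proof.
move=> th h1.
pose s n x := iter n (@smoothstep R) (h x).
have ts n : trig (fun x => (s n x)%:C) by exact: trig_smoothstep.
have mh : measurable_fun setT h by have [] := trig_cmeas th.
have mA : measurable [set x | 0 < h x].
  have := measurable_fun_ltr (measurable_cst (0 : R)) mh.
  by move=> /(_ measurableT [set true] I); rewrite setTI preimage_true.
apply: (@dens_dct _ lam lam_fin
  (fun n x => (2^-1 * (s n x + s n x ^+ 2))%:C) _ (fun=> 4)).
- move=> n; apply: dens_trig => //.
  rewrite (_ : (fun x => _) = fun x => 2^-1 * ((s n x)%:C + (s n x)%:C * (s n x)%:C)).
    by apply: trigZ; apply: trigD => //; exact: trigM.
  apply/funext => x; move: (s n x) => y.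
  by apply: complex_eq; simpc; rewrite /=; field.
- apply: (@L2_bounded _ _ _ lam lam_fin _ 1).
    by apply: cmeas_real; exact: measurable_indic.
  move=> x; rewrite nsq_real indicE; case: (_ \in _) => /=.
    by rewrite expr1n.
  by rewrite expr0n.
- move=> x; rewrite (_ : (fun n => _) = fun n =>
    (\1_[set x | 0 < h x] x - 2^-1 * (s n x + s n x ^+ 2)) ^+ 2); last first.
    by apply/funext => n; rewrite -rmorphB nsq_real.
  have E : (\1_[set x | 0 < h x] x - 2^-1 * (Num.sg (h x) + Num.sg (h x) ^+ 2)) ^+ 2 = 0.
    rewrite indicE; have [h0|h0|h0] := ltgtP (h x) 0.
    - rewrite ltr0_sg// sqrrN expr1n addNr mulr0 memNset ?subr0 ?expr0n//=.
      by rewrite ltNge (ltW h0).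
    - rewrite gtr0_sg// expr1n mem_set//= mulrDr mulr1.
      by rewrite [X in 1 - X](_ : _ = 1) ?subrr ?expr0n//; field.
    - rewrite h0 sgr0 expr0n addr0 mulr0 memNset ?subr0 ?expr0n//=.
      by rewrite h0 ltxx.
  rewrite -[X in _ --> X]E.
  have cs := cvg_iter_smoothstep (h1 x).
  have cs2 : (fun n => s n x ^+ 2) @ \oo --> Num.sg (h x) ^+ 2.
    by rewrite expr2; under eq_fun do rewrite expr2; exact: cvgM.
  under eq_fun do rewrite expr2.
  rewrite expr2; apply: cvgM; (apply: cvgB; first exact: cvg_cst);
    by apply: cvgM; [exact: cvg_cst|exact: cvgD].
- by apply: (@integrable_bounded _ _ _ lam lam_fin _ 4) => [|x];
    [exact: measurable_cst|rewrite ger0_norm].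
- move=> n x; rewrite -rmorphB nsq_real.
  have := iter_smoothstep_norm n (h1 x); rewrite -/(s n x) ler_norml => /andP[].
  move: (s n x) => y y1 y2.
  have i0 : 0 <= (\1_[set x | 0 < h x] x : R) <= 1.
    by rewrite indicE; case: (_ \in _); rewrite /= ?ler01 ?lexx.
  move: i0; move: (\1_[set x | 0 < h x] x : R) => i /andP[i0 i1].
  move: y1 y2 i0 i1; clear=> y1 y2 i0 i1.
  have [a b] : -2 <= i - 2^-1 * (y + y ^+ 2) /\ i - 2^-1 * (y + y ^+ 2) <= 2.
    by split; nra.
  nra.
Qed.

Lemma trig_cos_shift (c : R) : trig (fun x => (cos (2 * pi * (x - c)))%:C).
Proof.
rewrite (_ : (fun x => _) = fun x => 2^-1 * ((expz 1 c)^* * expz 1 x +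
    ((expz 1 c)^* * expz 1 x)^*)).
  apply: trigZ; apply: trigD; first by apply: trigZ; exact: trig_expz.
  by apply: trigJ; apply: trigZ; exact: trig_expz.
apply/funext => x; rewrite mulrBr cosB.
have e1 y : expz 1 y = cos (2 * pi * y) +i* sin (2 * pi * y) :> R[i].
  by rewrite /expz mulr1z mulr1.
rewrite !e1; move: (cos _) (sin _) (cos _) (sin _) => u v u' v'.
by apply: complex_eq; simpc; rewrite /=; field.
Qed.

(** Past [pi], replacing [v] by [2 * pi - v] keeps the cosine and returns to the range where it
    decreases. *)
Lemma cos_le_arc (v w : R) : 0 <= w -> w <= v -> v <= 2 * pi - w -> cos v <= cos w.
Proof.
move=> w0 wv vw; have pi0 := pi_gt0 R.
have [vpi|piv] := leP v pi.
  by rewrite leNgt ltr_cos ?in_itv/= -?leNgt//; apply/andP; split; lra.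
rewrite -[leLHS]cosN -[leLHS](cosD2pi).
rewrite leNgt ltr_cos ?in_itv/= -?leNgt ?mulr2n; first lra.
  by apply/andP; split; lra.
by apply/andP; split; lra.
Qed.

(** The interval from [a] to 1 is an arc with midpoint [(a + 1) / 2] and half-angle [pi * (1 - a)];
    membership means being angularly close to the midpoint. *)
Lemma cos_ray (a x : R) : 0 <= a < 1 -> 0 <= x < 1 ->
  (cos (pi * (1 - a)) < cos (2 * pi * (x - (a + 1) / 2))) = (a < x).
Proof.
move=> /andP[a0 a1] /andP[x0 x1]; have pi0 := pi_gt0 R.
have [xa|ax] := leP x a.
  apply/negbTE; rewrite -leNgt -[leLHS]cosN; apply: cos_le_arc.
  - by rewrite mulr_ge0// ?ltW// subr_gt0.
  - rewrite -subr_ge0 (_ : _ - _ = 2 * pi * (a - x)); last by field.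
    by rewrite mulr_ge0 ?subr_ge0// mulr_ge0// ltW.
  - rewrite -subr_ge0 (_ : _ - _ = 2 * pi * x); last by field.
    by rewrite mulr_ge0// mulr_ge0// ltW.
have p0 : 0 <= pi * (1 - a) by rewrite mulr_ge0// ?ltW// subr_gt0.
have p1 : pi * (1 - a) <= pi.
  by rewrite ger_pMr// lerBlDr lerDl.
have N : `|2 * pi * (x - (a + 1) / 2)| < pi * (1 - a).
  rewrite ltr_norml; apply/andP; split; rewrite -subr_gt0.
    rewrite (_ : _ - _ = 2 * pi * (x - a)); last by field.
    by rewrite mulr_gt0 ?subr_gt0// mulr_gt0.
  rewrite (_ : _ - _ = 2 * pi * (1 - x)); last by field.
  by rewrite mulr_gt0 ?subr_gt0// mulr_gt0.
rewrite -[ltRHS]cos_norm ltr_cos ?in_itv/= ?p0 ?p1//.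
by rewrite normr_ge0/= (le_trans (ltW N)).
Qed.

Lemma dens_cst c : dens lam (fun=> c).
Proof. by apply: dens_trig => //; exact: trig_cst. Qed.

Lemma dens_ray (a : R) : dens lam (fun x => (\1_(`]a, +oo[%classic) x)%:C).
Proof.
have m : cmeas (fun x => (\1_(`]a, +oo[%classic) x : R)%:C).
  by apply: cmeas_real; apply: measurable_indic; exact: measurable_itv.
have aeI : {ae lam, forall x, 0 <= x < 1}.
  exists (~` `[0, 1[%classic); split => //.
  by apply: measurableC; exact: measurable_itv.
have [a0|a0] := ltP a 0.
  apply: (dens_ae m _ (dens_cst 1)); apply: filterS aeI => x /andP[x0 _].
  by rewrite indicE mem_set//= in_itv/= andbT (lt_le_trans a0).
have [a1|a1] := ltP a 1; last first.
  apply: (dens_ae m _ (dens_cst 0)); apply: filterS aeI => x /andP[_ x1].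
  by rewrite indicE memNset//= in_itv/= andbT; apply/negP; rewrite -leNgt ltW// (lt_le_trans x1).
(* The factor [2^-1] brings [h] into [[-1, 1]], where the iterated smoothstep converges. *)
pose h x : R := 2^-1 * (cos (2 * pi * (x - (a + 1) / 2)) - cos (pi * (1 - a))).
have th : trig (fun x => (h x)%:C).
  rewrite (_ : (fun x => _) = fun x => 2^-1 *
     ((cos (2 * pi * (x - (a + 1) / 2)))%:C - (cos (pi * (1 - a)))%:C)).
    by apply: trigZ; apply: trigB; [exact: trig_cos_shift|exact: trig_cst].
  apply/funext => x; rewrite /h; move: (cos _) (cos _) => u v.
  by apply: complex_eq; simpc; rewrite /=; field.
have h1 x : `|h x| <= 1.
  rewrite /h normrM ger0_norm ?invr_ge0// ler_pdivrMl// mulr1.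
  by rewrite (le_trans (ler_normB _ _))// -[2]/(1 + 1) lerD// cos_max.
apply: (dens_ae m _ (dens_gt0 th h1)).
apply: filterS aeI => x x01; congr (_%:C); rewrite !indicE; congr (nat_of_bool _)%:R.
by apply/idP/idP => /set_mem/= H; apply: mem_set; move: H; rewrite /= in_itv/= andbT /h
  pmulr_rgt0 ?invr_gt0// subr_gt0 cos_ray// a0 a1.
Qed.

(** Dynkin induction from the rays. For a disjoint union the partial sums of indicators take values
    0 and 1 only, so dominated convergence applies. *)
Lemma dens_indic A : measurable A -> dens lam (fun x => (\1_A x)%:C).
Proof.
have nsqi (B : set R) x : nsq ((\1_B x : R)%:C) <= 1.
  by rewrite nsq_real indicE; case: (_ \in _); rewrite /= ?expr1n ?expr0n.
have L B : measurable B -> L2 lam (fun x => (\1_B x)%:C).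
  move=> mB; apply: (@L2_bounded _ _ _ lam lam_fin _ 1) => //.
  by apply: cmeas_real; exact: measurable_indic.
move=> mA.
have mE : @measurable _ R = <<s (@RGenOInfty.G R) >> by exact: RGenOInfty.measurableE.
move: mA; rewrite [X in X A -> _]mE.
apply: (@dynkin_induction _ _ (@RGenOInfty.G R)
  (fun A => dens lam (fun x => (\1_A x)%:C))).
- exact: mE.
- move=> _ _ [a ->] [b ->]; exists (Num.max a b); apply/seteqP; split => x /=.
    by rewrite !in_itv/= !andbT gt_max => -[-> ->].
  by rewrite !in_itv/= !andbT gt_max => /andP[].
- by rewrite indicT; exact: (dens_cst (1 : R)%:C).
- by move=> _ [a ->]; exact: dens_ray.
- move=> S mS dS.
  rewrite (_ : (fun x => _) = fun x => -1 * (\1_S x)%:C + 1).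
    by apply: dens_lin => //; exact: dens_cst.
  apply/funext => x; rewrite !indicE in_setC mulN1r.
  by case: (x \in S); rewrite /= ?addNr// oppr0 add0r.
- move=> F mF tF dF.
  have mUF : measurable (\bigcup_k F k) by exact: bigcup_measurable.
  have S1 j x : F j x -> forall n,
      \sum_(k < n) (\1_(F k) x)%:C = ((j < n)%N%:R : R)%:C.
    move=> Fjx; elim=> [|n IH]; first by rewrite big_ord0.
    have e : \1_(F n) x = (n == j)%:R :> R.
      rewrite indicE; have [->|nj] := eqVneq n j; first by rewrite mem_set.
      rewrite memNset// => Fnx; move/trivIsetP : tF => /(_ n j I I nj).
      by apply/eqP/set0P; exists x.
    rewrite big_ord_recr /= IH e.
    have -> : (j < n.+1)%N = ((j < n)%N + (n == j))%N :> nat.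
      by rewrite ltnS leq_eqVlt; case: ltngtP.
    by rewrite natrD rmorphD.
  have S0 x : ~ (\bigcup_k F k) x -> forall n, \sum_(k < n) (\1_(F k) x)%:C = 0 :> R[i].
    move=> Fx n; rewrite big1// => k _; rewrite indicE memNset// => Fkx.
    by apply: Fx; exists k.
  apply: (@dens_dct _ lam lam_fin (fun n x => \sum_(k < n) (\1_(F k) x)%:C) _ (fun=> 1)).
  + elim=> [|n IH]; first by under eq_fun do rewrite big_ord0; exact: dens_cst.
    under eq_fun do rewrite big_ord_recr /= addrC -[(\1__ _)%:C]mul1r.
    exact: dens_lin.
  + exact: L.
  + move=> x; have [[j _ Fjx]|Fx] := pselect ((\bigcup_k F k) x).
      apply: cvg_near_cst; exists j.+1 => // n /= jn.
      rewrite (S1 j)// jn indicE mem_set ?subrr ?nsq0//.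
      by exists j.
    apply: cvg_near_cst; apply: nearW => n.
    by rewrite S0// indicE memNset// subrr nsq0.
  + by apply: (@integrable_bounded _ _ _ lam lam_fin _ 1) => [|x];
      [exact: measurable_cst|rewrite ger0_norm].
  + move=> n x; have [[j _ Fjx]|Fx] := pselect ((\bigcup_k F k) x).
      rewrite (S1 j)// indicE mem_set; last by exists j.
      by rewrite -rmorphB nsq_real; case: (j < n)%N; rewrite ?subrr ?subr0 ?expr0n ?expr1n.
    by rewrite S0// subr0 nsqi.
Qed.

End density_all.

Section density_L2.
Context (R : realType).
Variable lam : {measure set R -> \bar R}.
Hypothesis lam_fin : (lam setT < +oo)%E.
Hypothesis lamI : lam (~` `[0, 1[%classic) = 0%E.
Implicit Types f g : R -> R[i].

Import HBNNSimple.

Lemma dens_nnsfun (h : {nnsfun R >-> R}) : dens lam (fun x => (h x)%:C).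
Proof.
under eq_fun do rewrite fimfunEord rmorph_sum.
move: (size _) => m; elim: m => [|m IH] /=.
  by under eq_fun do rewrite big_ord0; exact: dens_cst.
under eq_fun do rewrite big_ord_recr /= addrC rmorphM.
by apply: dens_lin => //; apply: dens_indic => //; exact: measurable_funPTI.
Qed.

Lemma dens_ge0 (h : R -> R) : (forall x, 0 <= h x) ->
  L2 lam (fun x => (h x)%:C) -> dens lam (fun x => (h x)%:C).
Proof.
move=> h0 Lh; have mh : measurable_fun setT h by have [] := L2_cmeas Lh.
have mEh : measurable_fun setT (EFin \o h) by exact/measurable_EFinP.
pose a n := nnsfun_approx measurableT mEh n.
have h0' x : setT x -> (0 <= (EFin \o h) x)%E by rewrite lee_fin.
have ca x : (fun n => a n x) @ \oo --> h x.
  have /fine_cvgP[_] := cvg_nnsfun_approx measurableT mEh h0' (I : setT x).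
  exact.
have ah n x : a n x <= h x.
  rewrite -lee_fin /a nnsfun_approxE; exact: le_approx.
apply: (@dens_dct _ lam lam_fin (fun n x => (a n x)%:C) _ (fun x => h x ^+ 2)) => //.
- by move=> n; exact: dens_nnsfun.
- move=> x; under eq_fun do rewrite -rmorphB nsq_real.
  rewrite (_ : 0 = (h x - h x) ^+ 2 :> R); last by rewrite subrr expr0n.
  rewrite expr2; under eq_fun do rewrite expr2.
  by apply: cvgM; apply: cvgB => //; exact: cvg_cst.
- by have := L2_integrable Lh; under eq_fun do rewrite nsq_real.
- move=> n x; rewrite -rmorphB nsq_real lerXn2r ?nnegrE ?subr_ge0//.
  by rewrite lerBlDr lerDl; exact: fun_ge0.
Qed.

Lemma dens_real (h : R -> R) : L2 lam (fun x => (h x)%:C) ->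
  dens lam (fun x => (h x)%:C).
Proof.
move=> Lh; have mh : measurable_fun setT h by have [] := L2_cmeas Lh.
have Ih := L2_integrable Lh.
have L (k : R -> R) : measurable_fun setT k -> (forall x, 0 <= k x <= `|h x|) ->
    dens lam (fun x => (k x)%:C).
  move=> mk kh; apply: dens_ge0 => [x|]; first by case/andP: (kh x).
  apply: (L2_le (cmeas_real mk) _ Ih) => x; rewrite !nsq_real.
  by case/andP: (kh x) => k0 kx; rewrite -[leRHS]real_normK ?num_real// lerXn2r ?nnegrE.
rewrite (_ : (fun x => _) = fun x => -1 * (h^\- x)%:C + (h^\+ x)%:C).
  apply: dens_lin => //; apply: L.
  - exact: measurable_funrneg.
  - move=> x; rewrite /funrneg le_max lexx orbT/= ge_max normr_ge0 andbT.
    by rewrite -normrN ler_norm.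
  - exact: measurable_funrpos.
  - by move=> x; rewrite /funrpos le_max lexx orbT/= ge_max normr_ge0 andbT ler_norm.
apply/funext => x; rewrite mulN1r addrC -rmorphB; congr (_%:C).
rewrite /funrpos /funrneg; have [H|/ltW H] := leP 0 (h x).
  by rewrite (@max_r _ _ (- h x)) ?oppr_le0// subr0.
by rewrite (@max_l _ _ (- h x)) ?oppr_ge0// sub0r opprK.
Qed.

Lemma dens_L2 f : L2 lam f -> dens lam f.
Proof.
move=> Lf; have [m1 m2] := L2_cmeas Lf; have If := L2_integrable Lf.
rewrite (_ : f = fun x => 'i%C * (complex.Im (f x))%:C + (complex.Re (f x))%:C).
  apply: dens_lin => //; apply: dens_real.
    apply: (L2_le (cmeas_real m2) _ If) => x; rewrite nsq_real /nsq lerDr.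
    exact: sqr_ge0.
  apply: (L2_le (cmeas_real m1) _ If) => x; rewrite nsq_real /nsq lerDl.
  exact: sqr_ge0.
by apply/funext => x; case: (f x) => u v; apply: complex_eq; simpc.
Qed.

End density_L2.

(** * Singular measures are effective *)

Section cauchy_product.
Context (R : realType).
Implicit Types z u : R[i].

Lemma normc_nsq z (r : R) : 0 <= r -> (`|z| <= r%:C) = (nsq z <= r ^+ 2).
Proof.
move=> r0; rewrite normc_def lecR -/(nsq z) -[RHS]ler_sqrt ?sqr_ge0//.
by rewrite sqrtr_sqr ger0_norm.
Qed.

Lemma Re_le_norm z (r : R) : `|z| <= r%:C -> `|complex.Re z| <= r.
Proof. by move=> zr; rewrite -lecR (le_trans _ zr)// normc_ge_Re. Qed.

Lemma Im_le_norm z (r : R) : `|z| <= r%:C -> `|complex.Im z| <= r.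
Proof.
move=> zr; rewrite -lecR (le_trans _ zr)// normc_def lecR -sqrtr_sqr.
by rewrite ler_wsqrtr// lerDr sqr_ge0.
Qed.

(** The convolution identity cancels every coefficient of the product of the truncations below
    degree [N.+1], apart from the constant 1. What remains has fewer than [D = 2 * N.+1]
    coefficients, each of modulus at most [D], whence [D ^+ 2 * r ^+ N.+1]. *)
Lemma cauchy_inverse_bound (m c : nat -> R[i]) N z (r : R) :
  m 0%N = 1 -> (forall n, `|m n| <= 1) -> (forall n, `|c n| <= 1) ->
  (forall n, \sum_(k < n.+1) m (n - k)%N * c k = m n.+1) ->
  0 <= r -> r <= 1 -> `|z| <= r%:C ->
  `|(\sum_(n < N.+1) m n * z ^+ n) * (1 - \sum_(k < N) c k * z ^+ k.+1) - 1| <=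
    ((2 * N.+1%:R) ^+ 2 * r ^+ N.+1)%:C.
Proof.
move=> m0 m1 c1 mc r0 r1 zr.
pose p := \poly_(i < N.+1) m i; pose q := \poly_(i < N) c i.
pose T := p * (1 - 'X * q) - 1.
have -> : (\sum_(n < N.+1) m n * z ^+ n) * (1 - \sum_(k < N) c k * z ^+ k.+1) - 1 =
    T.[z].
  rewrite /T !hornerE !horner_poly; congr (_ * (_ - _) - _).
  by rewrite mulr_sumr; apply: eq_bigr => i _; rewrite exprS mulrCA.
pose D := (2 * N.+1)%N.
have sT : (size T <= D)%N.
  rewrite /T mulrBr mulr1 -addrA (leq_trans (size_polyD _ _))// geq_max.
  have sp : (size p <= N.+1)%N by exact: size_poly.
  have sq : (size q <= N)%N by exact: size_poly.
  apply/andP; split; first by rewrite (leq_trans sp)// /D mul2n -addnn leq_addr.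
  rewrite -opprD size_polyN (leq_trans (size_polyD _ _))// geq_max size_poly1 andbT.
  have sXq : (size ('X * q)%R <= N.+1)%N.
    by rewrite (leq_trans (size_polyMleq _ _))// size_polyX.
  rewrite (leq_trans (size_polyMleq _ _))// (leq_trans (leq_pred _))//.
  by rewrite /D mul2n -addnn leq_add.
have T0 j : (j < N.+1)%N -> T`_j = 0.
  move=> jN; rewrite /T mulrBr mulr1 !coefB coef_poly jN coef1.
  case: j jN => [|j] jN.
    by rewrite m0 mulrCA coefXM subr0 subrr.
  rewrite mulrCA coefXM /= subr0 -mc coefM; apply/eqP; rewrite subr_eq0; apply/eqP.
  rewrite (reindex_inj rev_ord_inj) /=; apply: eq_bigr => i _.
  rewrite subSS !coef_poly.
  have ij : (i <= j)%N by rewrite -ltnS.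
  have iN : (i < N.+1)%N by rewrite (leq_ltn_trans ij)// ltnW.
  have jiN : (j - i < N)%N by rewrite (leq_ltn_trans (leq_subr _ _)).
  by rewrite subKn// iN jiN.
have p1 i : `|p`_i| <= 1 by rewrite coef_poly; case: ifP => _; rewrite ?normr0 ?ler01.
have q1 i : `|q`_i| <= 1 by rewrite coef_poly; case: ifP => _; rewrite ?normr0 ?ler01.
have T1 j : (N.+1 <= j < D)%N -> `|T`_j| <= D%:R.
  case: j => // j /andP[Nj jD].
  rewrite /T mulrBr mulr1 !coefB coef_poly ltnNge Nj /= coef1 subr0 sub0r normrN.
  rewrite mulrCA coefXM /= coefM (le_trans (ler_norm_sum _ _ _))//.
  apply: (@le_trans _ _ (\sum_(i < j.+1) 1)).
    by apply: ler_sum => i _; rewrite normrM mulr_ile1.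
  by rewrite sumr_const card_ord ler_nat ltnW.
rewrite (horner_coef_wide _ sT) (le_trans (ler_norm_sum _ _ _))//.
apply: (@le_trans _ _ (\sum_(j < D) (D%:R * r ^+ N.+1)%:C)).
  apply: ler_sum => j _; have [jN|Nj] := ltnP j N.+1.
    by rewrite T0// mul0r normr0 ler0c mulr_ge0// exprn_ge0.
  rewrite rmorphM /= normrM; apply: ler_pM => //.
    by rewrite rmorph_nat T1// Nj ltn_ord.
  rewrite normrX rmorphXn /= (@le_trans _ _ (r%:C ^+ j))//.
    by rewrite lerXn2r ?nnegrE ?normr_ge0 ?ler0c.
  by rewrite ler_wiXn2l ?ler0c// (lecR r 1).
have DE : D%:R = 2 * N.+1%:R :> R by rewrite natrM.
by rewrite sumr_const card_ord -rmorphMn lecR -mulr_natl mulrA -expr2 DE.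
Qed.

(** [1 / (1 - u)] has real part at least [2^-1] on the unit disc; the subtracted term bounds the
    tail of the series. *)
Lemma Re_geometric_ge u (r : R) N : 0 <= r -> r < 1 -> `|u| <= r%:C ->
  2^-1 - r ^+ N.+1 / (1 - r) <= complex.Re (\sum_(n < N.+1) u ^+ n).
Proof.
move=> r0 r1 ur.
have u1 : `|u| < 1 by rewrite (le_lt_trans ur)// ltcR.
have d0 : 1 - u != 0.
  by apply: contraTneq u1 => /eqP; rewrite subr_eq0 => /eqP <-; rewrite normr1 ltxx.
have nd : (1 - r)%:C <= `|1 - u|.
  rewrite rmorphB /= (le_trans _ (lerB_dist _ _))// normr1 lerB//.
have -> : \sum_(n < N.+1) u ^+ n = (1 - u)^-1 - u ^+ N.+1 / (1 - u).
  have := subrX1 u N.+1; move=> /(congr1 -%R); rewrite opprB -mulNr opprB => H.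
  by apply: (mulfI d0); rewrite -H mulrBr divff// mulrCA divff// mulr1.
rewrite ReD ReN; apply: lerB.
  have : nsq u <= 1.
    by rewrite -(expr1n _ 2) -normc_nsq// ltW.
  have : 0 < nsq (1 - u).
    rewrite lt_neqAle nsq_ge0 andbT eq_sym; apply: contra_neq d0.
    exact: nsq_eq0.
  clear ur u1 d0 nd; case: u => a b; rewrite /nsq /=.
  set D := (1 - a) ^+ 2 + _ => D0 ab.
  rewrite ler_pdivlMr// ler_pdivrMl//.
  by rewrite /D; nra.
rewrite (le_trans (ler_norm _))// Re_le_norm// normrM normfV.
rewrite rmorphM fmorphV /=; apply: ler_pM => //.
  by rewrite normrX rmorphXn /= lerXn2r ?nnegrE ?normr_ge0 ?ler0c.
by rewrite lef_pV2 ?posrE // ?normr_gt0// (ltcR 0) subr_gt0.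
Qed.

(** If [P * A = 1 + eps], then [|P|^2 * (1 - |1 - A|^2) = |P|^2 - |P - 1 - eps|^2], which is
    [2 * Re P - 1] up to terms in [eps]. The hypotheses give [|P| >= Re P >= 4^-1], so dividing by
    [|P|^2] costs a factor 16. *)
Lemma defect_bound (P A : R[i]) (d h K w : R) :
  `|P * A - 1| <= h%:C -> `|P| <= K%:C -> 2^-1 - d <= complex.Re P -> d <= 4^-1 ->
  2 * d + 4 * h * K + 2 * h <= w -> 0 <= h -> 0 <= d ->
  1 - nsq (1 - A) <= 16 * (2 * complex.Re P - 1 + w).
Proof.
move=> PAh PK Pd d4 dw h0 d0.
have := Re_le_norm PAh; have := Im_le_norm PAh.
have := Re_le_norm PK; have := Im_le_norm PK.
case: P A PAh PK Pd => [x y] [a b] _ _ /=; simpc; rewrite /nsq /=.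
rewrite !ler_norml.
set u := x * a - y * b - 1; set v := x * b + y * a.
move=> xd /andP[y1 y2] /andP[x1 x2] /andP[v1 v2] /andP[u1 u2].
set s := (X in X <= _); set W := 2 * x - 1 + w.
have E : (x ^+ 2 + y ^+ 2) * s =
    2 * x - 1 + 2 * (u * x) + 2 * (v * y) - 2 * u - u ^+ 2 - v ^+ 2.
  by rewrite /u /v /s; ring.
have ux : u * x <= h * K.
  by rewrite (le_trans (ler_norm _))// normrM ler_pM// ler_norml; apply/andP.
have vy : v * y <= h * K.
  by rewrite (le_trans (ler_norm _))// normrM ler_pM// ler_norml; apply/andP.
have sW : (x ^+ 2 + y ^+ 2) * s <= W.
  by rewrite E /W; have := sqr_ge0 u; have := sqr_ge0 v; lra.
have hK : 0 <= h * K by rewrite mulr_ge0//; lra.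
have W0 : 0 <= W by rewrite /W; lra.
have [s0|s0] := leP s 0; first by rewrite (le_trans s0)// mulr_ge0.
have x4 : 4^-1 <= x by lra.
have t16 : 16^-1 <= x ^+ 2 + y ^+ 2 by have := sqr_ge0 y; nra.
apply: (@le_trans _ _ (16 * ((x ^+ 2 + y ^+ 2) * s))); last by rewrite ler_pM2l.
by rewrite mulrA ler_peMl ?(ltW s0)//; lra.
Qed.

End cauchy_product.

Lemma cintegralB d (T : measurableType d) (R : realType)
    (mu : {measure set T -> \bar R}) (f g : T -> R[i]) :
  cintegrable mu f -> cintegrable mu g ->
  cintegral mu (fun x => f x - g x) = cintegral mu f - cintegral mu g.
Proof.
move=> If Ig; under eq_fun do rewrite -[- _]mulN1r.
by rewrite cintegralD ?cintegralZ ?mulN1r//; exact: cintegrableZ.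
Qed.

Lemma conj_realc (R : realType) (a : R) : (a%:C)^* = a%:C.
Proof. by apply: complex_eq; rewrite ?ReJ ?ImJ //= oppr0. Qed.

Section trig_integral.
Context (R : realType).
Variable nu : {measure set R -> \bar R}.
Hypothesis nu1 : nu setT = 1%E.
Implicit Types f g : R -> R[i].

Lemma trig_cintegrable f : trig f -> cintegrable nu f.
Proof.
move=> tf; have := L2_inner (trig_L2 nu1 tf) (trig_L2 nu1 (trig_cst 1)).
by congr cintegrable; apply/funext => x; rewrite rmorph1 mulr1.
Qed.

Lemma trig_sum n (F : 'I_n -> R -> R[i]) : (forall i, trig (F i)) ->
  trig (fun x => \sum_(i < n) F i x).
Proof.
elim: n F => [|n IH] F tF; first by under eq_fun do rewrite big_ord0; exact: trig0.
by under eq_fun do rewrite big_ord_recr /=; apply: trigD => //; exact: IH.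
Qed.

Lemma trig_integrable_real (h : R -> R) : trig (fun x => (h x)%:C) ->
  nu.-integrable setT (EFin \o h).
Proof. by move=> /trig_cintegrable[]. Qed.

Lemma trig_nsq f : trig f -> trig (fun x => (nsq (f x))%:C).
Proof. by move=> tf; under eq_fun do rewrite -mulcJ; apply: trigM => //; exact: trigJ. Qed.

(** The defining recurrence expands [expi n] in the auxiliary sequence with diagonal coefficient 1;
    pair this expansion with [expz (- 1)]. *)
Lemma inner_residual_moments n :
  \sum_(k < n.+1) (mom nu (n - k)%N%:Z)^* * inner nu (expz (- 1)) (aux_seq nu k) =
  (mom nu n.+1%:Z)^*.
Proof.
have Le := L2_expz nu1 (- 1); have La := L2_aux nu1.
have -> : (mom nu n.+1%:Z)^* = inner nu (expz (- 1)) (expi n).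
  by rewrite expi_expz inner_expz -momN//; congr mom; rewrite -opprD -PoszD add1n.
have eE : expi n = fun x => \sum_(k < n.+1) inner nu (expi n) (expi k) * aux_seq nu k x.
  apply/funext => x; rewrite big_ord_recr /= aux_seqE addrC.
  have -> : inner nu (expi n) (expi n) = 1.
    by rewrite expi_expz inner_expz subrr mom0.
  by rewrite mul1r subrK.
rewrite [in RHS]eE inner_sumr//; last by move=> i; exact: L2Z.
apply: eq_bigr => k _; rewrite innerZr//; congr (_^* * _).
by rewrite !expi_expz inner_expz subzn// -ltnS.
Qed.

End trig_integral.

(** * Truncated Poisson integrals against a measure with the moments of Lebesgue measure *)

Section circle.
Context (R : realType).
Variables m nu : {measure set R -> \bar R}.
Hypothesis m1 : m setT = 1%E.
Hypothesis nu1 : nu setT = 1%E.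
Hypothesis mom_m : forall j, mom m j = (j == 0)%:R.
Implicit Types f g : R -> R[i].

Local Notation c k := (inner nu (expz (- 1)) (aux_seq nu k)).

(* With [M] the power series of the conjugate moments at [z] and [B] the series
   of [c k * z ^ k.+1], [inner_residual_moments] says [M * (1 - B) = 1], and
   [2 * Re M - 1] is the Poisson integral of [nu]; hence
   [1 - |B|^2 = |1 / M|^2 * (2 * Re M - 1) <= 4 * (2 * Re M - 1)]. The truncated
   sums below satisfy this up to [defect]. *)
Definition moment_sum (r : R) N y : R[i] :=
  \sum_(n < N.+1) (mom nu n%:Z)^* * (r%:C * expz 1 y) ^+ n.

Definition residual_sum (r : R) N y : R[i] :=
  \sum_(k < N) c k * (r%:C * expz 1 y) ^+ k.+1.

Lemma scaled_expzX (r : R) n y : (r%:C * expz 1 y) ^+ n = (r ^+ n)%:C * expz n%:Z y.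
Proof. by rewrite exprMn rmorphXn expzX. Qed.

Lemma trig_scaled_expzX (r : R) n : trig (fun y => (r%:C * expz 1 y) ^+ n).
Proof. by under eq_fun do rewrite scaled_expzX; apply: trigZ; exact: trig_expz. Qed.

Lemma trig_moment_sum r N : trig (moment_sum r N).
Proof. by apply: trig_sum => i; apply: trigZ; exact: trig_scaled_expzX. Qed.

Lemma trig_residual_sum r N : trig (residual_sum r N).
Proof. by apply: trig_sum => i; apply: trigZ; exact: trig_scaled_expzX. Qed.

Lemma norm_scaled_expz (r : R) y : 0 <= r -> `|r%:C * expz 1 y| <= r%:C.
Proof. by move=> r0; rewrite normc_nsq// nsqM nsq_expz mulr1 nsq_real. Qed.

(** The moment sum is the [nu]-average of partial geometric sums with ratio
    [r%:C * expz 1 y * expz (- 1) x], and the lower bound on their real parts survives averaging. *)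
Lemma Re_moment_sum r N y : 0 <= r -> r < 1 ->
  2^-1 - r ^+ N.+1 / (1 - r) <= complex.Re (moment_sum r N y).
Proof.
move=> r0 r1; pose z := r%:C * expz 1 y.
pose G x := \sum_(n < N.+1) z ^+ n * expz (- n%:Z) x.
have tG : trig G by apply: trig_sum => i; apply: trigZ; exact: trig_expz.
have -> : moment_sum r N y = cintegral nu G.
  rewrite cintegral_sum; last first.
    by move=> i; apply: cintegrableZ; apply: trig_cintegrable; [exact: nu1|exact: trig_expz].
  apply: eq_bigr => i _; rewrite cintegralZ; last first.
    by apply: trig_cintegrable; [exact: nu1|exact: trig_expz].
  by rewrite mulrC -momN.
have [IG _] := trig_cintegrable nu1 tG.
rewrite /cintegral /=.
rewrite [leLHS](_ : _ = \int[nu]_x (2^-1 - r ^+ N.+1 / (1 - r))); last first.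
  by rewrite /Rintegral integral_cst// nu1 mule1.
apply: le_Rintegral => //.
  exact: (trig_cintegrable nu1 (trig_cst (2^-1 - r ^+ N.+1 / (1 - r))%:C)).1.
move=> x _; rewrite /G.
rewrite (eq_bigr (fun n : 'I_N.+1 => (z * expz (- 1) x) ^+ n)); last first.
  move=> n _; rewrite [RHS]exprMn; congr (_ * _).
  by rewrite !expzN expzX rmorphXn.
apply: Re_geometric_ge => //.
by rewrite normc_nsq// !nsqM nsq_real !nsq_expz !mulr1.
Qed.

Lemma norm_mom j : `|mom nu j| <= 1.
Proof. by rewrite (normc_nsq _ ler01) expr1n mom_le1. Qed.

Lemma norm_residual_coef k : `|c k| <= 1.
Proof.
rewrite (normc_nsq _ ler01) expr1n -[leRHS](nrm2_expz nu1 (- 1)).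
rewrite (kaczmarz_energy nu1 k.+1 (L2_expz nu1 _)) big_ord_recr /= -addrA addrCA.
by rewrite lerDl addr_ge0 ?nrm2_ge0 ?sumr_ge0// => i _; exact: nsq_ge0.
Qed.

(** The quantity [2 * d + 4 * h * K + 2 * h] of [defect_bound], with [d] the geometric tail, [h] the
    error of [cauchy_inverse_bound] and [K = N.+1] a bound on the moment sum. *)
Definition defect (r : R) N : R :=
  2 * (r ^+ N.+1 / (1 - r)) + 4 * ((2 * N.+1%:R) ^+ 2 * r ^+ N.+1) * N.+1%:R +
  2 * ((2 * N.+1%:R) ^+ 2 * r ^+ N.+1).

Lemma residual_sum_defect r N y : 0 <= r -> r < 1 -> r ^+ N.+1 / (1 - r) <= 4^-1 ->
  1 - nsq (residual_sum r N y) <=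
  16 * (2 * complex.Re (moment_sum r N y) - 1 + defect r N).
Proof.
move=> r0 r1 r4.
have P1 : `|moment_sum r N y| <= (N.+1%:R)%:C.
  rewrite (le_trans (ler_norm_sum _ _ _))//.
  apply: (@le_trans _ _ (\sum_(n < N.+1) 1)); last first.
    by rewrite sumr_const card_ord rmorph_nat.
  apply: ler_sum => i _; rewrite normrM mulr_ile1//.
    by rewrite -momN// norm_mom.
  rewrite normrX exprn_ile1// (le_trans (norm_scaled_expz _ r0))//.
  by rewrite (lecR r 1) ltW.
have PA : `|moment_sum r N y * (1 - residual_sum r N y) - 1| <=
    ((2 * N.+1%:R) ^+ 2 * r ^+ N.+1)%:C.
  apply: (cauchy_inverse_bound (m := fun n => (mom nu n%:Z)^*) (c := fun k => c k)) => //.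
  - by rewrite mom0// rmorph1.
  - by move=> n; rewrite -momN// norm_mom.
  - exact: norm_residual_coef.
  - exact: inner_residual_moments.
  - exact: ltW.
  - exact: norm_scaled_expz.
have := defect_bound PA P1 (Re_moment_sum N y r0 r1) r4 (lexx _).
rewrite subKr; apply.
  by rewrite mulr_ge0 ?sqr_ge0 ?exprn_ge0.
by rewrite divr_ge0 ?exprn_ge0// subr_ge0 ltW.
Qed.

Lemma nrm2_trig_sum N (a : nat -> R[i]) :
  nrm2 m (fun y => \sum_(k < N) a k * expz k.+1%:Z y) = \sum_(k < N) nsq (a k).
Proof.
elim: N => [|N IH].
  rewrite big_ord0; under eq_fun do rewrite big_ord0.
  by rewrite /nrm2 nsq0 /Rintegral integral0.
under eq_fun do rewrite big_ord_recr /=; rewrite big_ord_recr /=.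
have LN k : L2 m (fun y => a k * expz k.+1%:Z y) by apply: L2Z; exact: L2_expz.
rewrite nrm2D//; last by apply: L2_sum => k; exact: LN.
rewrite IH nrm2Z; last exact: L2_expz.
rewrite nrm2_expz// mulr1.
rewrite inner_suml//.
rewrite [X in complex.Re X]big1 /= ?mulr0 ?addr0// => k _.
rewrite innerZl; [|exact: L2_expz|exact: LN].
rewrite innerZr; [|exact: L2_expz|exact: L2_expz].
by rewrite inner_expz mom_m subr_eq0 eqz_nat eqSS (ltn_eqF (ltn_ord k)) !mulr0.
Qed.

Lemma nrm2_residual_sum r N : 0 <= r -> r <= 1 ->
  nrm2 m (residual_sum r N) <= \sum_(k < N) nsq (c k).
Proof.
move=> r0 r1; rewrite (_ : residual_sum r N = fun y =>
    \sum_(k < N) (c k * (r ^+ k.+1)%:C) * expz k.+1%:Z y); last first.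
  apply/funext => y; apply: eq_bigr => k _.
  by rewrite scaled_expzX mulrA.
rewrite (nrm2_trig_sum N (fun k => c k * (r ^+ k.+1)%:C)).
apply: ler_sum => k _; rewrite nsqM nsq_real ler_piMr ?nsq_ge0//.
by rewrite -exprM exprn_ile1.
Qed.

(** The factor of [f] is the Poisson integral of [nu] at radius [r], cut to frequencies at most [N];
    the [- 1] undoes the double count of frequency 0. *)
Definition poisson_pairing r N f : R[i] :=
  cintegral m (fun y => f y * (moment_sum r N y + (moment_sum r N y)^* - 1)).

Lemma trig_poisson r N : trig (fun y => moment_sum r N y + (moment_sum r N y)^* - 1).
Proof.
have tM := trig_moment_sum r N.
by apply: trigB; [apply: trigD => //; exact: trigJ|exact: trig_cst].
Qed.

Lemma poisson_pairing_expz r N j : (`|j|%N <= N)%N ->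
  poisson_pairing r N (expz j) = mom nu j * (r ^+ `|j|%N)%:C.
Proof.
move=> jN; rewrite /poisson_pairing.
have tM := trig_moment_sum r N; have te := trig_expz (R := R).
have E n : trig (fun y => expz j y * (r%:C * expz 1 y) ^+ n).
  by apply: trigM => //; exact: trig_scaled_expzX.
have EJ n : trig (fun y => expz j y * ((r%:C * expz 1 y) ^+ n)^*).
  by apply: trigM => //; apply: trigJ; exact: trig_scaled_expzX.
rewrite (_ : (fun y => _) = fun y =>
  (\sum_(n < N.+1) (mom nu n%:Z)^* * (expz j y * (r%:C * expz 1 y) ^+ n)) +
  (\sum_(n < N.+1) mom nu n%:Z * (expz j y * ((r%:C * expz 1 y) ^+ n)^*)) -
  expz j y); last first.
  apply/funext => y; rewrite mulrBr mulr1 mulrDr; congr (_ + _ - _).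
    by rewrite /moment_sum mulr_sumr; apply: eq_bigr => n _; rewrite mulrCA.
  rewrite /moment_sum rmorph_sum mulr_sumr; apply: eq_bigr => n _.
  by rewrite rmorphM /= conjCK mulrCA.
have t1 : trig (fun y => \sum_(n < N.+1) (mom nu n%:Z)^* *
    (expz j y * (r%:C * expz 1 y) ^+ n)).
  by apply: trig_sum => n; exact: trigZ.
have t2 : trig (fun y => \sum_(n < N.+1) mom nu n%:Z *
    (expz j y * ((r%:C * expz 1 y) ^+ n)^*)).
  by apply: trig_sum => n; exact: trigZ.
have ci := trig_cintegrable m1.
rewrite cintegralB; [|by apply: ci; exact: trigD|exact: ci].
rewrite cintegralD; [|exact: ci..].
rewrite !cintegral_sum; try (by move=> n; apply: cintegrableZ; exact: ci).
have I1 n : cintegral m (fun y => expz j y * (r%:C * expz 1 y) ^+ n) =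
    (r ^+ n)%:C * (j + n%:Z == 0)%:R.
  rewrite -mom_m -cintegralZ; last exact: ci.
  by congr cintegral; apply/funext => y; rewrite scaled_expzX mulrCA expzD.
have I2 n : cintegral m (fun y => expz j y * ((r%:C * expz 1 y) ^+ n)^*) =
    (r ^+ n)%:C * (j - n%:Z == 0)%:R.
  rewrite -mom_m -cintegralZ; last exact: ci.
  congr cintegral; apply/funext => y.
  by rewrite scaled_expzX rmorphM /= conj_realc mulrCA expzD expzN.
rewrite (eq_bigr (fun n : 'I_N.+1 => (mom nu n%:Z)^* *
  ((r ^+ n)%:C * (j + n%:Z == 0)%:R))); last first.
  by move=> n _; rewrite cintegralZ ?I1//; exact: ci.
rewrite [X in _ + X + _](eq_bigr (fun n : 'I_N.+1 => mom nu n%:Z *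
  ((r ^+ n)%:C * (j - n%:Z == 0)%:R))); last first.
  by move=> n _; rewrite cintegralZ ?I2//; exact: ci.
rewrite -/(mom m j) mom_m.
have pick (a : nat -> R[i]) k : (k <= N)%N ->
    \sum_(n < N.+1) a n * ((r ^+ n)%:C * (n == k :> nat)%:R) = a k * (r ^+ k)%:C.
  move=> kN; rewrite (bigD1 (Ordinal (ltnSE kN : (k < N.+1)%N)))//= eqxx mulr1.
  rewrite big1 ?addr0// => i /negPf; rewrite -val_eqE /= => ->.
  by rewrite !mulr0.
(* For [j >= 0] the conjugate sum supplies the answer, and the first sum contributes only at
   [j = 0], where the [- 1] cancels it. For [j < 0] the first sum alone survives. *)
case: j jN {t1 t2 E EJ I1 I2} => n jN.
  rewrite (eq_bigr (fun i : 'I_N.+1 => (mom nu i%:Z)^* *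
    ((r ^+ i)%:C * (i == 0%N :> nat)%:R) * (n == 0%N)%:R)); last first.
    move=> i _; rewrite -mulrA -mulrA -natrM mulnb; congr (_ * (_ * _%:R)).
    by rewrite -PoszD eqz_nat addn_eq0 andbC.
  rewrite -mulr_suml (pick (fun i => (mom nu i%:Z)^*))// mom0// rmorph1 expr0 !mul1r.
  rewrite addrAC subrr add0r.
  rewrite (eq_bigr (fun i : 'I_N.+1 => mom nu i%:Z *
    ((r ^+ i)%:C * (i == n :> nat)%:R))); last first.
    by move=> i _; rewrite subr_eq0 eqz_nat eq_sym.
  by rewrite (pick (fun i => mom nu i%:Z)).
rewrite (eq_bigr (fun i : 'I_N.+1 => (mom nu i%:Z)^* *
  ((r ^+ i)%:C * (i == n.+1 :> nat)%:R))); last first.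
  by move=> i _; rewrite NegzE addrC subr_eq0 eqz_nat.
rewrite (pick (fun i => (mom nu i%:Z)^*))//.
rewrite [X in _ + X + _]big1 ?addr0 ?subr0; last first.
  by move=> i _; rewrite NegzE -opprD oppr_eq0 -PoszD /= !mulr0.
by rewrite NegzE momN.
Qed.

End circle.

Section poisson.
Context (R : realType).
Variables m nu : {measure set R -> \bar R}.
Hypothesis m1 : m setT = 1%E.
Hypothesis nu1 : nu setT = 1%E.
Hypothesis mom_m : forall j, mom m j = (j == 0)%:R.
Implicit Types f g : R -> R[i].

Lemma poisson_pairing_lin r N a f g : trig f -> trig g ->
  poisson_pairing m nu r N (fun x => a * f x + g x) =
  a * poisson_pairing m nu r N f + poisson_pairing m nu r N g.
Proof.
move=> tf tg; have tP := trig_poisson nu r N; have ci := trig_cintegrable m1.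
rewrite /poisson_pairing -cintegralZ; last by apply: ci; exact: trigM.
rewrite -cintegralD; [|by apply: ci; apply: trigZ; exact: trigM|by apply: ci; exact: trigM].
by congr cintegral; apply/funext => y; rewrite mulrDl mulrA.
Qed.

Lemma expr_ge_bernoulli (r : R) n : 0 <= r -> r <= 1 -> 1 - r ^+ n <= n%:R * (1 - r).
Proof.
move=> r0 r1; elim: n => [|n IH]; first by rewrite expr0 subrr mul0r.
rewrite exprS -natr1 mulrDl mul1r.
rewrite [leLHS](_ : _ = r * (1 - r ^+ n) + (1 - r)); last by ring.
rewrite lerD2r (le_trans _ IH)// ler_piMl// subr_ge0 exprn_ile1//.
Qed.

(** The rate holds for all [N] beyond a threshold independent of [r], so [r] can be fixed before
    [N]. *)
Lemma poisson_pairing_cvg f : trig f -> exists (C : R) N0, 0 <= C /\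
  forall r N, 0 <= r -> r <= 1 -> (N0 <= N)%N ->
  `|poisson_pairing m nu r N f - cintegral nu f| <= (C * (1 - r))%:C.
Proof.
elim=> [j|a f1 f2 t1 [C1 [N1 [C10 H1]]] t2 [C2 [N2 [C20 H2]]]].
  exists (`|j|%N)%:R, `|j|%N; split=> // r N r0 r1 jN.
  rewrite poisson_pairing_expz// -/(mom nu j) -[X in _ - X]mulr1 -mulrBr.
  rewrite normrM (@le_trans _ _ (1 * (1 - r ^+ `|j|%N)%:C))//; last first.
    by rewrite mul1r lecR; exact: expr_ge_bernoulli.
  apply: ler_pM => //; first exact: norm_mom.
  rewrite -(rmorphB _ (r ^+ _) 1) normc_nsq ?subr_ge0 ?exprn_ile1// nsq_real.
  by rewrite -sqrrN opprB.
pose A := Num.sqrt (nsq a).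
exists (A * C1 + C2), (maxn N1 N2); split.
  by rewrite addr_ge0// mulr_ge0// sqrtr_ge0.
move=> r N r0 r1; rewrite geq_max => /andP[N1N N2N].
rewrite poisson_pairing_lin// cintegralD; last 2 first.
- by apply: trig_cintegrable => //; exact: trigZ.
- exact: trig_cintegrable.
rewrite cintegralZ; last exact: trig_cintegrable.
rewrite opprD addrACA -mulrBr (le_trans (ler_normD _ _))// mulrDl rmorphD /=.
apply: lerD; last exact: H2.
rewrite normrM normc_def -/(nsq a) -mulrA rmorphM /=.
by apply: ler_pM => //; [rewrite ler0c sqrtr_ge0|exact: H1].
Qed.

(* Integrates [1 <= 2 |p|^2 + 2 |1 - p|^2] times [1 - |B|^2] against [m]; the
   right-hand side is small when [p] approximates the indicator of a set carrying
   [nu] and null for [m]. *)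
Lemma residual_bound p : trig p -> exists (C : R) N0, 0 <= C /\
  forall r N, 0 <= r -> r < 1 -> (N0 <= N)%N -> r ^+ N.+1 / (1 - r) <= 4^-1 ->
  nrm2 nu (kres nu (expz (- 1)) N) <=
  2 * nrm2 m p + 32 * (nrm2 nu (fun y => 1 - p y) + C * (1 - r)) +
  32 * (defect r N * nrm2 m (fun y => 1 - p y)).
Proof.
move=> tp; pose q y := 1 - p y.
have tq : trig q by apply: trigB => //; exact: trig_cst.
have tq2 := trig_nsq tq.
have [C [N0 [C0 H]]] := poisson_pairing_cvg tq2.
exists C, N0; split=> // r N r0 r1 N0N r4.
have tB := trig_residual_sum nu r N; have tM := trig_moment_sum nu r N.
pose M y := 2 * complex.Re (moment_sum nu r N y) - 1.
have ME y : (M y)%:C = moment_sum nu r N y + (moment_sum nu r N y)^* - 1.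
  by rewrite /M; case: (moment_sum _ _ _ _) => u v; apply: complex_eq; simpc => //;
    rewrite /= ?subrr//; ring.
have tqM : trig (fun y => (nsq (q y) * M y)%:C).
  rewrite (_ : (fun y => _) = fun y => (nsq (q y))%:C *
    (moment_sum nu r N y + (moment_sum nu r N y)^* - 1)).
    by apply: trigM => //; exact: trig_poisson.
  by apply/funext => y; rewrite rmorphM /= ME.
have ii (h : R -> R) := @trig_integrable_real _ _ m1 h.
have iB := ii _ (trig_nsq tB); have ip := ii _ (trig_nsq tp).
have iq := ii _ tq2; have iqM := ii _ tqM.
have i1 : m.-integrable setT (EFin \o (fun _ : R => 1 : R)) by apply: ii; exact: trig_cst.
have pw y : 1 - nsq (residual_sum nu r N y) <=
    2 * nsq (p y) + (32 * (nsq (q y) * M y) + 32 * defect r N * nsq (q y)).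
  have D := residual_sum_defect nu1 y r0 r1 r4.
  rewrite -/(M y) in D.
  have W0 : 0 <= M y + defect r N.
    have := Re_moment_sum nu1 N y r0 r1; rewrite /M /defect.
    have : 0 <= (2 * N.+1%:R) ^+ 2 * r ^+ N.+1 :> R.
      by rewrite mulr_ge0 ?sqr_ge0 ?exprn_ge0.
    move: (complex.Re _) ((2 * _) ^+ 2 * _) (_ / _) => u h d h0 du.
    have : 0 <= h * N.+1%:R by rewrite mulr_ge0.
    by move: (N.+1%:R : R) => k; clear -h0 du; lra.
  have pq : 1 <= 2 * nsq (p y) + 2 * nsq (q y).
    by have := nsqD_le (p y) (q y); rewrite /q addrC subrK nsq1.
  have s1 : 1 - nsq (residual_sum nu r N y) <= 1 by rewrite gerBl nsq_ge0.
  have p0 := nsq_ge0 (p y); have q0 := nsq_ge0 (q y).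
  move: D pq s1 p0 q0 W0; move: (1 - nsq _) (nsq (p y)) (nsq (q y)) (M y) (defect r N).
  clear=> s P Q Mv w D pq s1 P0 Q0 W0.
  have QW : 0 <= Q * (Mv + w) by rewrite mulr_ge0.
  (* For [s > 0], multiply [1 <= 2 * P + 2 * Q] by [s], bounding [s] by 1 next to [P] and by
     [16 * (Mv + w)] next to [Q]. *)
  have [s0|s0] := leP s 0; first by lra.
  have sP : s * P <= P by rewrite ler_piMl.
  have sQ : s * Q <= 16 * (Mv + w) * Q by rewrite ler_wpM2r.
  have : s <= s * (2 * P + 2 * Q) by rewrite ler_peMr// ltW.
  by lra.
have iL := integrableB_real i1 iB.
have iR : m.-integrable setT (EFin \o (fun y =>
    2 * nsq (p y) + (32 * (nsq (q y) * M y) + 32 * defect r N * nsq (q y)))).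
  by apply: integrableD_real; [|apply: integrableD_real]; exact: integrableZ_real.
have := le_Rintegral measurableT iL iR (fun y _ => pw y).
rewrite RintegralB// [X in _ <= X -> _]RintegralD//; last 2 first.
- exact: integrableZ_real.
- by apply: integrableD_real; exact: integrableZ_real.
rewrite [X in _ <= _ + X -> _]RintegralD//; last 2 first.
- exact: integrableZ_real.
- exact: integrableZ_real.
rewrite !RintegralZl// -/(nrm2 m _) -/(nrm2 m _) -/(nrm2 m _).
have -> : \int[m]_x (1 : R) = 1 by rewrite /Rintegral integral_cst// m1 mule1.
have HP := H r N r0 (ltW r1) N0N.
have {HP} HP : \int[m]_y (nsq (q y) * M y) <= nrm2 nu q + C * (1 - r).
  have := Re_le_norm HP; rewrite ReD ReN.
  have -> : complex.Re (poisson_pairing m nu r N (fun x => (nsq (q x))%:C)) =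
      \int[m]_y (nsq (q y) * M y).
    rewrite /poisson_pairing /cintegral /=; apply: eq_Rintegral => y _.
    by rewrite -ME -rmorphM.
  have -> : complex.Re (cintegral nu (fun x => (nsq (q x))%:C)) = nrm2 nu q by [].
  by rewrite ler_norml => /andP[_]; rewrite lerBlDr addrC.
(* The residual norm is [1 - \sum nsq (c k)], and that sum dominates the norm of [residual_sum] in
   L^2(m), so the integral just bounded controls the residual. *)
have Hk := kaczmarz_energy nu1 N (L2_expz nu1 (- 1)).
rewrite nrm2_expz// in Hk.
have Hr := nrm2_residual_sum nu m1 mom_m N r0 (ltW r1).
move: HP Hk Hr; rewrite -/q.
move: (\int[m]_y (nsq (q y) * M y)) (nrm2 nu (kres _ _ _)) (nrm2 m _) (\sum_(k < N) _)
  (nrm2 nu q) (nrm2 m p) (nrm2 m q) (defect r N) => x1 x2 x3 x4 x5 x6 x7 x8.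
clear=> h1 h2 h3 h4; lra.
Qed.

(** Each of the [n] terms of [1 + s + ... + s ^+ n.-1] is at least [s ^+ n]. Hence [n * s ^+ n] is
    bounded by [(1 - s)^-1] uniformly in [n]. *)
Lemma expr_linear_bound (s : R) n : 0 <= s -> s <= 1 ->
  n%:R * s ^+ n * (1 - s) <= 1 - s ^+ n.
Proof.
move=> s0 s1; elim: n => [|n IH]; first by rewrite expr0 !mul0r subrr.
have sn : 0 <= s ^+ n by rewrite exprn_ge0.
have sn1 : s ^+ n <= 1 by rewrite exprn_ile1.
move: IH; rewrite exprS -natr1; move: (s ^+ n) sn sn1 (n%:R : R) => t t0 t1 k IH.
have h1 : s * (k * t * (1 - s)) <= s * (1 - t) by rewrite ler_wpM2l.
have h2 : s * t * (1 - s) <= 1 - s by rewrite ler_piMl ?subr_ge0// mulr_ile1.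
rewrite -subr_ge0.
rewrite (_ : _ - _ = (s * (1 - t) - s * (k * t * (1 - s))) + (1 - s - s * t * (1 - s))).
  by rewrite addr_ge0 ?subr_ge0.
by ring.
Qed.

(** Taking the radius to be [s ^+ 4] turns [r ^+ N.+1] into [t ^+ 4] with [t = s ^+ N.+1]. Three
    factors [t] absorb the at most cubic power of [N.+1], and the fourth tends to 0. The constant 26
    is [2 + 16 + 8], the weights of the three terms of [defect]. *)
Lemma defect_small (s e : R) N0 : 0 <= s -> s < 1 -> 0 < e ->
  exists2 N, (N0 <= N)%N &
    (s ^+ 4) ^+ N.+1 / (1 - s ^+ 4) <= 4^-1 /\ defect (s ^+ 4) N <= e.
Proof.
move=> s0 s1 e0; pose B := (1 - s)^-1.
have s1' : 0 < 1 - s by rewrite subr_gt0.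
have B0 : 0 < B by rewrite invr_gt0.
have B1 : 1 <= B by rewrite invf_ge1// gerBl.
pose e' := Num.min e 4^-1.
have e'0 : 0 < e' by rewrite lt_min e0/= invr_gt0.
have : (fun n => s ^+ n) @ \oo --> (0 : R) by apply: cvg_expr; rewrite ger0_norm.
move=> /cvgr_lt/(_ (e' / (26 * B ^+ 3))) [|K _ HK].
  by rewrite divr_gt0// mulr_gt0// exprn_gt0.
pose N := maxn N0 K; exists N; first exact: leq_maxl.
have {HK} := HK N.+1 (leqW (leq_maxr _ _)).
have Hx := expr_linear_bound N.+1 s0 (ltW s1).
have t0 : 0 <= s ^+ N.+1 by rewrite exprn_ge0.
have t1 : s ^+ N.+1 <= 1 by rewrite exprn_ile1// ltW.
rewrite /defect -[(s ^+ 4) ^+ _]exprM mulnC exprM.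
have n0 : 0 <= N.+1%:R :> R by [].
have xB : N.+1%:R * s ^+ N.+1 <= B.
  rewrite /B -[leRHS]mul1r ler_pdivlMr// (le_trans Hx)// gerBl//.
have s4 : (1 - s ^+ 4)^-1 <= B.
  rewrite lef_pV2 ?posrE// ?subr_gt0 ?exprn_ilt1//.
  by rewrite lerD2l lerN2 -[leRHS]expr1 ler_wiXn2l// ltW.
have s40 : 0 <= (1 - s ^+ 4)^-1 by rewrite invr_ge0 subr_ge0 exprn_ile1// ltW.
rewrite ltr_pdivlMr; last by rewrite mulr_gt0// exprn_gt0.
move: xB s4 s40 t0 t1 n0; move: (N.+1%:R : R) (s ^+ N.+1) ((1 - s ^+ 4)^-1) => n t v.
move=> nB vB v0 t0 t1 n0.
rewrite /e' lt_min => /andP[te t4].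
have t4t : t ^+ 4 <= t by rewrite -[leRHS]expr1 ler_wiXn2l.
have B3 : B <= B ^+ 3 by rewrite -[leLHS]expr1 ler_weXn2l.
have B2 : B ^+ 2 <= B ^+ 3 by rewrite ler_weXn2l.
have tv : t ^+ 4 * v <= t * B ^+ 3.
  by apply: ler_pM => //; [rewrite exprn_ge0|rewrite (le_trans vB)].
have nt0 : 0 <= n * t by rewrite mulr_ge0.
have n3 : n ^+ 3 * t ^+ 4 <= t * B ^+ 3.
  rewrite (_ : _ * _ = t * (n * t) ^+ 3); last by ring.
  by rewrite ler_wpM2l// lerXn2r ?nnegrE// ltW.
have n2 : n ^+ 2 * t ^+ 4 <= t * B ^+ 3.
  rewrite (_ : _ * _ = (t * t) * (n * t) ^+ 2); last by ring.
  apply: ler_pM; rewrite ?mulr_ge0 ?sqr_ge0//; first by rewrite ler_piMl.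
  by rewrite (le_trans _ B2)// lerXn2r ?nnegrE// ltW.
have tB : 0 <= t * B ^+ 3 by rewrite mulr_ge0// exprn_ge0// ltW.
clear Hx; split; first by rewrite (le_trans tv)//; nra.
move: tv n3 n2 te tB; move: (B ^+ 3) => b tv n3 n2 te tB.
rewrite (_ : _ + _ = 2 * (t ^+ 4 * v) + 16 * (n ^+ 3 * t ^+ 4) + 8 * (n ^+ 2 * t ^+ 4)).
  by lra.
by ring.
Qed.

End poisson.

(* [lebesgue_measure] and the uniform law live on [measurableTypeR R], which has
   the same measurable sets as [R] but another display. *)
Definition borel_id (R : realType) : measurableTypeR R -> R := id.

Lemma measurable_borel_id (R : realType) : measurable_fun setT (@borel_id R).
Proof. by move=> _ Y mY; rewrite setTI. Qed.

HB.instance Definition _ (R : realType) :=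
  isMeasurableFun.Build _ _ _ _ (@borel_id R) (@measurable_borel_id R).

(** * Lebesgue measure on the circle and its moments *)

Section circle_measure.
Context (R : realType).

Definition circle : probability R R :=
  distribution (uniform_prob (@ltr01 R)) (@borel_id R).

Lemma circle_setT : circle setT = 1%E.
Proof. exact: probability_setT. Qed.

Lemma expz_one j : expz j 1 = 1 :> R[i].
Proof.
have e1 : expz 1 1 = 1 :> R[i].
  rewrite /expz mulr1z !mulr1 mulr_natl.
  by apply: complex_eq; rewrite /= ?cos2pi ?sin2pi.
elim/int_rec: j => [|n IH|n IH]; first by rewrite expz0.
  by rewrite -add1n PoszD expzD IH e1 mulr1.
by rewrite -add1n PoszD opprD expzD IH expzN e1 rmorph1 mulr1.
Qed.

(** The integral is computed for the nonnegative [1 + h], with primitive [y + H y]; the mean 1 is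
    subtracted afterwards. *)
Lemma circle_integral0 (h H : R -> R) : (forall x, `|h x| <= 1) ->
  continuous h -> (forall x : R, is_derive x (1 : R) H (h x)) -> H 1 = H 0 ->
  \int[circle]_x h x = 0.
Proof.
move=> h1 ch dH H10.
have mh : measurable_fun setT h by exact: continuous_measurable_fun.
have fin : (circle setT < +oo)%E by rewrite circle_setT ltry.
have Ih : (circle : {measure set R -> \bar R}).-integrable setT (EFin \o h).
  exact: integrable_bounded h1.
have I1 : (circle : {measure set R -> \bar R}).-integrable setT (EFin \o (fun _ : R => 1 : R)).
  by apply: (@integrable_bounded _ _ _ circle fin _ 1) => [|x]; rewrite ?normr1.
have h0 x : 0 <= 1 + h x by have := h1 x; rewrite ler_norml => /andP[]; lra.
have dF (x : R) : is_derive x (1 : R) (fun y => y + H y) (1 + h x).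
  by have := dH x => ?; apply: is_deriveD.
have E : (\int[circle]_x (1 + h x)%:E = 1)%E.
  rewrite ge0_integral_distribution; last 2 first.
  - by apply/measurable_EFinP; apply: measurable_funD.
  - by move=> x; rewrite lee_fin.
  rewrite integral_uniform; last 2 first.
  - by apply/measurable_EFinP; apply: measurable_funD.
  - by move=> x; rewrite lee_fin.
  rewrite subr0 invr1 mul1e.
  rewrite (@continuous_FTC2 _ _ (fun y => y + H y)) ?ltr01//.
  - by rewrite -EFinB H10; congr (_%:E); ring.
  - apply: continuous_subspaceT => x; apply: cvgD; first exact: cvg_cst.
    exact: ch.
  - have cF x : {for x, continuous (fun y => y + H y)}.
      by apply: differentiable_continuous; apply/derivable1_diffP; case: (dF x).
    split.
    + by move=> x _; case: (dF x).
    + exact/cvg_at_right_filter/cF.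
    + exact/cvg_at_left_filter/cF.
  - by move=> x _; rewrite derive1E; case: (dF x).
have : \int[circle]_x (1 + h x) = 1 by rewrite /Rintegral E.
rewrite RintegralD// (_ : \int[circle]_x (1 : R) = 1); last first.
  rewrite /Rintegral integral_cst// mul1e -[RHS]/(fine 1%E).
  by congr fine; exact: circle_setT.
lra.
Qed.

Lemma mom_circle j : mom circle j = (j == 0)%:R.
Proof.
have [->|j0] := eqVneq j 0; first by rewrite (mom0 circle_setT).
pose w : R := 2 * pi * j%:~R.
have w0 : w != 0 by rewrite !mulf_neq0// ?intr_eq0// gt_eqF// pi_gt0.
have cw : continuous (fun x : R => w * x) by exact: mulrl_continuous.
have [sw cosw] : sin w = 0 /\ cos w = 1.
  by have := expz_one j; rewrite /expz mulr1 -/w => -[-> ->].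
have dw (x : R) : is_derive x (1 : R) (fun y : R => w * y) w.
  by apply: is_derive_eq; exact: mulr1.
rewrite /mom /cintegral; apply: complex_eq => /=.
  apply: (@circle_integral0 _ (fun x => w^-1 * sin (w * x))).
  - by move=> x; exact: cos_max.
  - by move=> x; apply: continuous_comp; [exact: cw|exact: continuous_cos].
  - move=> x; have ? := dw x; apply: is_derive_eq.
    by rewrite -[LHS]/(w^-1 * (cos (w * x) * w)) mulrCA mulVf// mulr1.
  - by rewrite mulr1 mulr0 sw sin0.
apply: (@circle_integral0 _ (fun x => - (w^-1 * cos (w * x)))).
- by move=> x; exact: sin_max.
- by move=> x; apply: continuous_comp; [exact: cw|exact: continuous_sin].
- move=> x; have ? := dw x; apply: is_derive_eq.
  by rewrite -[LHS]/(- (w^-1 * (- sin (w * x) * w))) mulNr mulrN opprK mulrCA mulVf// mulr1.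
- by rewrite mulr1 mulr0 cosw cos0.
Qed.

Lemma circle_null (S : set R) : measurable S -> lebesgue_measure S = 0%E ->
  circle S = 0%E.
Proof.
move=> mS S0; have /null_content_dominatesP := dominates_uniform_prob (@ltr01 R).
exact.
Qed.

Lemma circleI : circle (~` `[0, 1[%classic) = 0%E.
Proof.
rewrite /circle /= /uniform_prob integral_uniform_pdf.
rewrite (_ : _ `&` _ = [set 1]); last first.
  apply/seteqP; split => x /=; rewrite !in_itv/=.
    move=> [x01 /andP[x0 x1]]; apply/eqP; rewrite eq_le x1 leNgt.
    by apply/negP => x1'; apply: x01; rewrite x0.
  by move=> ->; rewrite ltxx andbF lexx ler01.
by rewrite integral_set1.
Qed.

End circle_measure.

(** * Convergence and Parseval for singular measures *)

Section effective.
Context (R : realType).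
Variable nu : {measure set R -> \bar R}.
Hypothesis nu1 : nu setT = 1%E.
Hypothesis nuI : nu (~` `[0, 1[%classic) = 0%E.
Hypothesis nu_sing : singular nu.
Implicit Types f g : R -> R[i].

(** One approximation in L^2 of the sum [lam] serves both bounds: the indicator of the carrier of
    [nu] is 0 almost everywhere for [circle] and 1 for [nu]. *)
Lemma singular_approx e : 0 < e -> exists2 p, trig p &
  nrm2 (circle R) p <= e /\ nrm2 nu (fun y => 1 - p y) <= e.
Proof.
move=> e0; have [S [mS SI S0 nuS]] := nu_sing.
pose lam : {measure set R -> \bar R} := measure_add (circle R) nu.
have lamE A : lam A = (circle R A + nu A)%E by exact: measure_addE.
have lam_fin : (lam setT < +oo)%E.
  by rewrite lamE nu1 [X in (X + _)%E]circle_setT ltry.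
have lamI : lam (~` `[0, 1[%classic) = 0%E.
  by rewrite lamE nuI [X in (X + _)%E]circleI adde0.
have [Li Hi] := dens_indic lam_fin lamI mS.
have [p tp hp] := Hi _ e0; exists p => //.
have Lp := trig_L2_fin lam_fin tp.
have nuS1 : {ae nu, forall x, \1_S x = 1 :> R}.
  have mI : measurable (`[0, 1[%classic : set R) by exact: measurable_itv.
  exists (~` `[0, 1[%classic `|` (`[0, 1[%classic `\` S)); split.
  - by apply: measurableU; [exact: measurableC|exact: measurableD].
  - by rewrite measureU0//; [exact: measurableC|exact: measurableD].
  - move=> x /= Sx; have [xI|xI] := pselect (`[0, 1[%classic x); [right|by left].
    by split=> // xS; apply: Sx; rewrite indicE mem_set.
have cS1 : {ae (circle R : {measure set R -> \bar R}), forall x, \1_S x = 0 :> R}.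
  exists S; split=> //; first exact: circle_null.
  by move=> x /= Sx; apply: contrapT => xS; apply: Sx; rewrite indicE memNset.
have mi : cmeas (fun x => (\1_S x : R)%:C).
  by apply: cmeas_real; exact: measurable_indic.
have mp := trig_cmeas tp.
have E : ((nrm2 lam (fun x => (\1_S x)%:C - p x))%:E =
    (nrm2 (circle R) (fun x => (\1_S x)%:C - p x))%:E +
    (nrm2 nu (fun x => (\1_S x)%:C - p x))%:E)%E.
  have Lc : L2 (circle R : {measure set R -> \bar R}) (fun x => (\1_S x)%:C - p x).
    apply: L2B; last by apply: trig_L2 => //; exact: circle_setT.
    apply: (@L2_bounded _ _ _ _ _ _ 1) => //; first by rewrite [X in (X < _)%E]circle_setT ltry.
    by move=> x; rewrite nsq_real indicE; case: (_ \in _); rewrite /= ?expr1n ?expr0n.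
  have Ln : L2 nu (fun x => (\1_S x)%:C - p x).
    apply: L2B; last exact: trig_L2.
    apply: (@L2_bounded _ _ _ _ _ _ 1) => //; first by rewrite nu1 ltry.
    by move=> x; rewrite nsq_real indicE; case: (_ \in _); rewrite /= ?expr1n ?expr0n.
  rewrite !nrm2E//; last exact: L2B.
  rewrite ge0_integral_measure_add// => [x _|]; first by rewrite lee_fin nsq_ge0.
  by apply/measurable_EFinP; apply: cmeas_nsq; exact: cmeasB.
move: E => [E].
have E1 : nrm2 (circle R) p = nrm2 (circle R) (fun x => (\1_S x)%:C - p x).
  rewrite -nrm2N; apply: ae_eq_nrm2; [exact: cmeasN|exact: cmeasB|].
  by apply: filterS cS1 => x ->; rewrite sub0r.
have E2 : nrm2 nu (fun y => 1 - p y) = nrm2 nu (fun x => (\1_S x)%:C - p x).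
  apply: ae_eq_nrm2; [by apply: cmeasB => //; exact: cmeas_cst|exact: cmeasB|].
  by apply: filterS nuS1 => x ->.
have := nrm2_ge0 (circle R) (fun x => (\1_S x)%:C - p x).
have := nrm2_ge0 nu (fun x => (\1_S x)%:C - p x).
move: hp; rewrite E E1 E2; move: (nrm2 (circle R) _) (nrm2 nu _) => u v.
by clear=> *; split; lra.
Qed.

Lemma kvanish_singular : kvanish nu (expz (- 1)).
Proof.
apply: kvanishP => // [|e e0]; first exact: L2_expz.
(* [98 = 2 + 32 * 2 + 32]: the four error terms of [residual_bound], each at most [t], with their
   weights. *)
pose t := e / 98%:R.
have t0 : 0 < t by rewrite divr_gt0// ltr0n.
have te : 98%:R * t = e by rewrite mulrC divfK// pnatr_eq0.
have [p tp [hp1 hp2]] := singular_approx t0.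
have [C [N0 [C0 H]]] := residual_bound (circle_setT R) nu1 (@mom_circle R) tp.
have C1 : 0 < C + 1 by rewrite ltr_wpDl.
have tC0 : 0 < t / (C + 1) / 4 by rewrite !divr_gt0.
(* The radius will be [(1 - eta) ^+ 4], as [defect_small] asks, and
   [1 - (1 - eta) ^+ 4 <= 4 * eta]. *)
pose eta := Num.min 2^-1 (t / (C + 1) / 4).
have eta0 : 0 < eta by rewrite lt_min invr_gt0 ltr0n tC0.
have eta1 : eta <= 2^-1 by rewrite ge_min lexx.
have etaC : (C + 1) * (4 * eta) <= t.
  have : eta <= t / (C + 1) / 4 by rewrite ge_min lexx orbT.
  by rewrite !ler_pdivlMr// (mulrC (C + 1)) (mulrC 4).
clearbody eta.
pose Q := nrm2 (circle R) (fun y => 1 - p y).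
have Q0 : 0 <= Q by exact: nrm2_ge0.
have Q1 : 0 < Q + 1 by rewrite ltr_wpDl.
have s0 : 0 <= 1 - eta by rewrite subr_ge0 (le_trans eta1)// invf_le1 ?ler1n.
have s1 : 1 - eta < 1 by rewrite gtrBl.
have [|N N0N [h1 h2]] := @defect_small _ (1 - eta) (t / (Q + 1)) N0 s0 s1.
  exact: divr_gt0.
exists N; apply: (le_trans (H _ N _ _ N0N h1)).
- by rewrite exprn_ge0.
- by rewrite exprn_ilt1.
have dQ : defect ((1 - eta) ^+ 4) N * Q <= t.
  apply: (@le_trans _ _ (t / (Q + 1) * Q)); first by rewrite ler_wpM2r.
  by rewrite mulrAC ler_pdivrMr// ler_wpM2l ?(ltW t0)// lerDl.
have s4 : C * (1 - (1 - eta) ^+ 4) <= t.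
  apply: le_trans etaC; apply: ler_pM => //.
  - by rewrite subr_ge0 exprn_ile1// ltW.
  - by rewrite lerDl.
  - by have := @expr_ge_bernoulli R (1 - eta) 4 s0 (ltW s1); rewrite subKr.
rewrite -te; move: hp1 hp2 dQ s4 t0; rewrite -/Q.
move: (nrm2 (circle R) p) (nrm2 nu _) (C * _) (defect _ _ * _) => x1 x2 x3 x4.
by clear; move: t => u *; lra.
Qed.

(** The residual maps are linear and do not increase the norm, so convergence passes from
    trigonometric polynomials to their closure. *)
Lemma kvanish_L2 f : L2 nu f -> kvanish nu f.
Proof.
move=> Lf; have nu_fin : (nu setT < +oo)%E by rewrite nu1 ltry.
apply: kvanishP => // e e0.
have [|p tp hp] := (dens_L2 nu_fin nuI Lf).2 (e / 4); first by rewrite divr_gt0.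
have Lp := trig_L2 nu1 tp.
have [_ Hp] := kvanish_trig nu1 kvanish_singular tp.
have [|N /(_ N (leqnn N)) hN] := Hp (e / 4); first by rewrite divr_gt0.
exists N.
have Lfp : L2 nu (fun x => f x - p x) by exact: L2B.
have fE : f = fun x => 1 * (f x - p x) + p x.
  by apply/funext => x; rewrite mul1r subrK.
rewrite [X in kres nu X]fE kres_lin//.
have Lk : L2 nu (fun x => 1 * kres nu (fun x => f x - p x) N x).
  by apply: L2Z; exact: L2_kres.
have Lkp := L2_kres nu1 N Lp.
apply: (le_trans (nrm2D_le Lk Lkp)).
rewrite nrm2Z; last exact: L2_kres.
rewrite nsq1 mul1r.
have := nrm2_kres_le nu1 N Lfp.
move: hp hN; move: (nrm2 nu (fun x => f x - p x)) (nrm2 nu (kres nu (fun x => f x - p x) N))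
  (nrm2 nu (kres nu p N)) => x1 x2 x3.
by clear=> *; lra.
Qed.

Lemma parseval f : L2 nu f ->
  (\sum_(0 <= k <oo) (nsq (inner nu f (aux_seq nu k)))%:E = (nrm2 nu f)%:E)%E.
Proof.
move=> Lf; have [_ H] := kvanish_L2 Lf.
apply/cvg_lim => //.
rewrite (_ : (fun n => _) = fun n => (nrm2 nu f - nrm2 nu (kres nu f n))%:E); last first.
  apply/funext => n; rewrite big_mkord sumEFin; congr (_%:E).
  by rewrite {1}(kaczmarz_energy nu1 n Lf) addrK.
apply: cvg_EFin; first exact: nearW.
rewrite -[X in _ --> X]subr0; apply: cvgB; first exact: cvg_cst.
apply/cvgrPdist_le => e e0; have [N hN] := H _ e0.
near=> n; rewrite sub0r normrN ger0_norm ?nrm2_ge0// hN//.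
by near: n; exists N.
Unshelve. all: by end_near. Qed.

End effective.

(** * Slices *)

Section kernel_integral.
Context (R : realType).
Variable K : R.-pker R ~> R.

Lemma measurable_kernel_ge0 (f : R * R -> R) : measurable_fun setT f ->
  (forall z, 0 <= f z) ->
  measurable_fun setT (fun x => (\int[K x]_y (f (x, y))%:E)%E).
Proof.
move=> mf f0; apply: (@measurable_fun_integral_finite_kernel _ _ _ _ _ (EFin \o f) K).
  by move=> z; rewrite lee_fin.
exact/measurable_EFinP.
Qed.

Lemma measurable_kernel_eintegral (f : R * R -> R) : measurable_fun setT f ->
  measurable_fun setT (fun x => (\int[K x]_y (f (x, y))%:E)%E).
Proof.
move=> mf; rewrite (_ : (fun x => _) = fun x => (\int[K x]_y (f^\+ (x, y))%:E -
    \int[K x]_y (f^\- (x, y))%:E)%E).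
  apply: emeasurable_funB; apply: measurable_kernel_ge0 => //.
  - exact: measurable_funrpos.
  - exact: measurable_funrneg.
apply/funext => x; rewrite integralE; congr (_ - _)%E.
  by apply: eq_integral => y _; rewrite funeposE /funrpos EFin_max.
by apply: eq_integral => y _; rewrite funenegE /funrneg EFin_max.
Qed.

Lemma measurable_kernel_integral (f : R * R -> R) : measurable_fun setT f ->
  measurable_fun setT (fun x => \int[K x]_y f (x, y)).
Proof.
move=> mf; apply: measurableT_comp; first exact: fine_measurable.
exact: measurable_kernel_eintegral.
Qed.

Lemma cmeas_kernel_integral (f : R * R -> R[i]) : cmeas f ->
  cmeas (fun x => cintegral (K x) (fun y => f (x, y))).
Proof.
move=> [f1 f2]; split; rewrite /cintegral /=.
  exact: (measurable_kernel_integral f1).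
exact: (measurable_kernel_integral f2).
Qed.

Lemma kernel_setT x : K x setT = 1%E.
Proof. exact: prob_kernel. Qed.

Lemma measurable_pair x : measurable_fun setT (fun y : R => (x, y) : R * R).
Proof. exact: pair1_measurable. Qed.

Lemma cmeas_slice (f : R * R -> R[i]) x : cmeas f -> cmeas (fun y => f (x, y)).
Proof. by move=> mf; apply: (cmeas_comp (measurable_pair x)). Qed.

Lemma cmeas_kernel_inner (f g : R * R -> R[i]) : cmeas f -> cmeas g ->
  cmeas (fun x => inner (K x) (fun y => f (x, y)) (fun y => g (x, y))).
Proof.
move=> mf mg; apply: (@cmeas_kernel_integral (fun z => f z * (g z)^*)).
by apply: cmeasM => //; exact: cmeasJ.
Qed.

(** Joint measurability: the coefficients of the recurrence depend measurably on the parameter of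
    the kernel. *)
Lemma cmeas_aux_seq n : cmeas (fun z : R * R => aux_seq (K z.1) n z.2).
Proof.
have [m] := ubnP n; elim: m n => // m IH n; rewrite ltnS => nm.
under eq_fun do rewrite aux_seqE.
have me k : cmeas (fun z : R * R => expi k z.2 : R[i]).
  by apply: (@cmeas_comp _ _ _ _ _ snd (expi k));
    [exact: measurable_snd|exact: (cmeas_expz R k%:Z)].
apply: cmeasB => //; apply: cmeas_sum => i; apply: cmeasM; last first.
  by apply: IH; rewrite (leq_trans (ltn_ord i)).
apply: (@cmeas_comp _ _ _ _ _ fst (fun x => inner (K x) (expi n) (expi i))).
  exact: measurable_fst.
exact: (@cmeas_kernel_inner (fun z => expi n z.2) (fun z => expi i z.2)).
Qed.

Lemma cmeas_mom j : cmeas (fun x => mom (K x) j).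
Proof.
apply: (@cmeas_kernel_integral (fun z => expz j z.2)).
by apply: (@cmeas_comp _ _ _ _ _ snd (expz j)); [exact: measurable_snd|exact: cmeas_expz].
Qed.

End kernel_integral.

Section aux_bound.
Context (R : realType).

(** The moments have modulus at most 1, so the recurrence at most doubles the bound. Uniformity in
    [nu] and [x] puts the products over slices in L^2(mu). *)
Lemma nsq_aux_seq_le (nu : {measure set R -> \bar R}) n x : nu setT = 1%E ->
  nsq (aux_seq nu n x) <= (2 ^+ n) ^+ 2.
Proof.
move=> nu1; rewrite -normc_nsq ?exprn_ge0//.
have [m] := ubnP n; elim: m n => // m IH n; rewrite ltnS => nm.
rewrite aux_seqE (le_trans (ler_normB _ _))//.
have E k : 1 + \sum_(i < k) 2 ^+ i = 2 ^+ k :> R.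
  elim: k => [|k IHk]; first by rewrite big_ord0 addr0 expr0.
  by rewrite big_ord_recr /= addrA IHk exprS mulr_natl.
rewrite -E rmorphD /=; apply: lerD.
  by rewrite (normc_nsq _ ler01) [nsq _](nsq_expz n%:Z) expr1n.
rewrite (le_trans (ler_norm_sum _ _ _))// rmorph_sum; apply: ler_sum => i _.
rewrite normrM -[leRHS]mul1r; apply: ler_pM => //.
  by rewrite !expi_expz inner_expz norm_mom.
by apply: IH; rewrite (leq_trans (ltn_ord i)).
Qed.

End aux_bound.

(* [sg] is the identity or the exchange of coordinates, so that both orders of
   the variables are treated at once. *)
Section slices.
Context (R : realType).
Variables (mu : probability (R * R)%type R) (nu : probability R R).
Variables (K : R.-pker R ~> R) (sg : R * R -> R * R).
Hypothesis msg : measurable_fun setT sg.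
Hypothesis sgK : involutive sg.
Hypothesis disint : forall f : R * R -> R,
  mu.-integrable setT (EFin \o (fun z => f (sg z))) ->
  (\int[mu]_z (f (sg z))%:E = \int[nu]_x \int[K x]_y (f (x, y))%:E)%E.

Lemma measurable_unswap (f : R * R -> R) :
  measurable_fun setT (fun z => f (sg z)) -> measurable_fun setT f.
Proof.
move=> mf; have := measurableT_comp mf msg.
by congr measurable_fun; apply/funext => z /=; rewrite sgK.
Qed.

Lemma cmeas_unswap (F : R * R -> R[i]) : cmeas (fun z => F (sg z)) -> cmeas F.
Proof.
move=> mf; have := cmeas_comp msg mf.
by congr cmeas; apply/funext => z /=; rewrite sgK.
Qed.

Lemma slice_integrable_abs (f : R * R -> R) :
  mu.-integrable setT (EFin \o (fun z => f (sg z))) ->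
  nu.-integrable setT (fun x => (\int[K x]_y (`|f (x, y)|)%:E)%E).
Proof.
move=> If; have mf : measurable_fun setT f.
  by apply: measurable_unswap; apply/measurable_EFinP; exact: measurable_int If.
have Ia : mu.-integrable setT (EFin \o (fun z => `|f (sg z)|)).
  exact: integrable_norm If.
have ma : measurable_fun setT (fun z => `|f z|) by exact: measurableT_comp.
apply/integrableP; split.
  exact: (measurable_kernel_ge0 K (f := fun z => `|f z|)).
under eq_integral => x _ do rewrite gee0_abs ?integral_ge0//.
rewrite -(@disint (fun z => `|f z|))//.
have /integrableP[_] := Ia.
by under eq_integral => x _ do rewrite /= ger0_norm//.
Qed.

Lemma slice_integrable_ae (f : R * R -> R) :
  mu.-integrable setT (EFin \o (fun z => f (sg z))) ->
  {ae nu, forall x, (K x).-integrable setT (EFin \o (fun y => f (x, y)))}.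
Proof.
move=> If; have mf : measurable_fun setT f.
  by apply: measurable_unswap; apply/measurable_EFinP; exact: measurable_int If.
have := integrable_ae measurableT (slice_integrable_abs If).
apply: filterS => x /(_ I) fin; apply/integrableP; split.
  by apply/measurable_EFinP; exact: (measurableT_comp mf (measurable_pair x)).
by move: fin; rewrite ge0_fin_numE// integral_ge0.
Qed.

Lemma slice_Rintegral (f : R * R -> R) :
  mu.-integrable setT (EFin \o (fun z => f (sg z))) ->
  nu.-integrable setT (EFin \o (fun x => \int[K x]_y f (x, y))) /\
  \int[mu]_z f (sg z) = \int[nu]_x \int[K x]_y f (x, y).
Proof.
move=> If; have mf : measurable_fun setT f.
  by apply: measurable_unswap; apply/measurable_EFinP; exact: measurable_int If.
have mk := measurable_kernel_integral K mf.
split.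
  apply: le_integrable (slice_integrable_abs If) => //.
    exact/measurable_EFinP.
  move=> x _; rewrite [leRHS]gee0_abs ?integral_ge0//.
  (* Where the slice integral is infinite, the real integral takes the default value 0 and the bound
     persists. *)
  apply: (@le_trans _ _ `|\int[K x]_y (f (x, y))%:E|%E).
    by rewrite /= /Rintegral; case: (integral _ _ _) => //= *; rewrite ?normr0 ?leey.
  rewrite (le_trans (le_abse_integral _ _ _))//.
  by apply/measurable_EFinP; exact: (measurableT_comp mf (measurable_pair x)).
rewrite {1}/Rintegral disint// [in RHS]/Rintegral; congr fine.
apply: ae_eq_integral => //.
- exact: measurable_kernel_eintegral.
- exact/measurable_EFinP.
apply: filterS (slice_integrable_ae If) => x Ix _.
by rewrite /Rintegral fineK//; apply: integrable_fin_num.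
Qed.

Lemma slice_cintegral (F : R * R -> R[i]) : cintegrable mu (fun z => F (sg z)) ->
  cintegrable nu (fun x => cintegral (K x) (fun y => F (x, y))) /\
  cintegral mu (fun z => F (sg z)) =
  cintegral nu (fun x => cintegral (K x) (fun y => F (x, y))).
Proof.
move=> [I1 I2].
have [J1 E1] := slice_Rintegral (f := fun z => complex.Re (F z)) I1.
have [J2 E2] := slice_Rintegral (f := fun z => complex.Im (F z)) I2.
by split=> //; rewrite /cintegral E1 E2.
Qed.

Section L2_slices.
Variable F : R * R -> R[i].
Hypothesis LF : L2 mu (fun z => F (sg z)).

Let mF : cmeas F.
Proof. exact/cmeas_unswap/L2_cmeas/LF. Qed.

Lemma slice_L2 : {ae nu, forall x, L2 (K x) (fun y => F (x, y))}.
Proof.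
apply: filterS (slice_integrable_ae (f := fun z => nsq (F z)) (L2_integrable LF)) => x.
by apply: cmeas_L2; exact: cmeas_slice.
Qed.

Lemma slice_nrm2 :
  nu.-integrable setT (EFin \o (fun x => nrm2 (K x) (fun y => F (x, y)))) /\
  nrm2 mu (fun z => F (sg z)) = \int[nu]_x nrm2 (K x) (fun y => F (x, y)).
Proof. exact: (slice_Rintegral (f := fun z => nsq (F z)) (L2_integrable LF)). Qed.

Definition slice_coef m x := inner (K x) (fun y => F (x, y)) (aux_seq (K x) m).

Lemma cmeas_slice_coef m : cmeas (slice_coef m).
Proof.
apply: (cmeas_kernel_inner K (g := fun z => aux_seq (K z.1) m z.2)) => //.
exact: cmeas_aux_seq.
Qed.

(** Bessel's inequality on almost every slice, then integration. *)
Lemma slice_coef_nrm2_le m :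
  (\int[nu]_x (nsq (slice_coef m x))%:E <= (nrm2 mu (fun z => F (sg z)))%:E)%E.
Proof.
have [I ->] := slice_nrm2; have mc := cmeas_slice_coef m.
rewrite [leRHS]fineK; last exact: integrable_fin_num.
apply: ae_ge0_le_integral => //.
- by move=> x _; rewrite lee_fin nsq_ge0.
- by apply/measurable_EFinP; exact: (cmeas_nsq mc).
- by move=> x _; rewrite lee_fin nrm2_ge0.
- exact: measurable_int I.
apply: filterS slice_L2 => x Lx _ /=; rewrite lee_fin.
rewrite (kaczmarz_energy (kernel_setT K x) m.+1 Lx) big_ord_recr /= -addrA addrCA.
by rewrite lerDl addr_ge0 ?nrm2_ge0 ?sumr_ge0// => i _; exact: nsq_ge0.
Qed.

Lemma slice_coef_L2 m : L2 nu (slice_coef m).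
Proof.
have [c1 c2] := cmeas_slice_coef m; split=> //.
by apply: le_lt_trans (slice_coef_nrm2_le m) _; rewrite ltry.
Qed.

End L2_slices.

Definition slice_aux n m (z : R * R) := aux_seq (K z.1) m z.2 * aux_seq nu n z.1.

Lemma cmeas_slice_aux n m : cmeas (slice_aux n m).
Proof.
apply: cmeasM; first exact: cmeas_aux_seq.
apply: (@cmeas_comp _ _ _ _ _ fst (aux_seq nu n)); first exact: measurable_fst.
by apply: trig_cmeas; apply: aux_seq_trig; exact: probability_setT.
Qed.

Lemma slice_aux_L2 n m : L2 mu (fun z => slice_aux n m (sg z)).
Proof.
have mu_fin : (mu setT < +oo)%E by rewrite probability_setT ltry.
apply: (@L2_bounded _ _ _ _ mu_fin _ ((2 ^+ m) ^+ 2 * (2 ^+ n) ^+ 2)).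
- exact: (cmeas_comp msg (cmeas_slice_aux n m)).
- move=> z; rewrite nsqM; apply: ler_pM; rewrite ?nsq_ge0// nsq_aux_seq_le//.
    exact: kernel_setT.
  exact: probability_setT.
Qed.

(** Coefficients are taken in two stages, on the slices and then on the marginal, because the
    marginal factor is constant on a slice. *)
Lemma slice_inner F n m : L2 mu (fun z => F (sg z)) ->
  inner mu (fun z => F (sg z)) (fun z => slice_aux n m (sg z)) =
  inner nu (slice_coef F m) (aux_seq nu n).
Proof.
move=> LF; have mF : cmeas F by exact/cmeas_unswap/L2_cmeas/LF.
have [_] := slice_cintegral (F := fun z => F z * (slice_aux n m z)^*)
  (L2_inner LF (slice_aux_L2 n m)).
rewrite -/(inner mu (fun z => F (sg z)) (fun z => slice_aux n m (sg z))) => ->.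
apply: ae_eq_cintegral.
- apply: (@cmeas_kernel_integral _ K (fun z => F z * (slice_aux n m z)^*)).
  by apply: cmeasM => //; apply: cmeasJ; exact: cmeas_slice_aux.
- apply: cmeasM; first exact: cmeas_slice_coef.
  apply: cmeasJ; apply: trig_cmeas; apply: aux_seq_trig; exact: probability_setT.
apply: filterS (slice_L2 LF) => x Lx.
have Lg := L2_aux (kernel_setT K x) m.
rewrite mulrC /slice_coef /inner -cintegralZ; last exact: L2_inner.
congr cintegral; apply/funext => y; rewrite /slice_aux /= rmorphM.
by rewrite [LHS]mulrA; exact: mulrC.
Qed.

Lemma slice_inner_le F n m : L2 mu (fun z => F (sg z)) ->
  nsq (inner mu (fun z => F (sg z)) (fun z => slice_aux n m (sg z))) <=
  nrm2 mu (fun z => F (sg z)).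
Proof.
move=> LF; rewrite slice_inner//; have Lc := slice_coef_L2 LF m.
apply: (@le_trans _ _ (nrm2 nu (slice_coef F m))); last first.
  by rewrite -lee_fin nrm2E// slice_coef_nrm2_le.
rewrite (kaczmarz_energy (probability_setT nu) n.+1 Lc) big_ord_recr /= -addrA addrCA.
by rewrite lerDl addr_ge0 ?nrm2_ge0 ?sumr_ge0// => i _; exact: nsq_ge0.
Qed.

Hypothesis nuI : nu (~` `[0, 1[%classic) = 0%E.
Hypothesis nu_sing : singular nu.
Hypothesis KI : {ae nu, forall x, K x (~` `[0, 1[%classic) = 0%E}.
Hypothesis K_sing : {ae nu, forall x, singular (K x)}.

(** At fixed [m] the inner sum is Parseval on the marginal; monotone convergence then moves the sum
    over [m] inside the integral, where Parseval holds on almost every slice. *)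
Lemma slice_parseval F : L2 mu (fun z => F (sg z)) ->
  (\sum_(0 <= m <oo) \sum_(0 <= n <oo) (nsq (inner mu (fun z => F (sg z))
    (fun z => slice_aux n m (sg z))))%:E = (nrm2 mu (fun z => F (sg z)))%:E)%E.
Proof.
move=> LF; have mF : cmeas F by exact/cmeas_unswap/L2_cmeas/LF.
have nu1 : nu setT = 1%E by exact: probability_setT.
transitivity (\sum_(0 <= m <oo) \int[nu]_x (nsq (slice_coef F m x))%:E)%E.
  apply: eq_eseriesr => m _.
  rewrite -nrm2E; last exact: slice_coef_L2.
  rewrite -(parseval nu1 nuI nu_sing (slice_coef_L2 LF m)).
  by apply: eq_eseriesr => n _; rewrite slice_inner.
rewrite -integral_nneseries//; last 2 first.
- by move=> m; apply/measurable_EFinP; exact: (cmeas_nsq (cmeas_slice_coef LF m)).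
- by move=> m x _; rewrite lee_fin nsq_ge0.
have [I ->] := slice_nrm2 LF.
rewrite /Rintegral fineK; last exact: integrable_fin_num.
apply: ae_eq_integral => //.
- apply: ge0_emeasurable_sum => [m x _ _|m _]; first by rewrite lee_fin nsq_ge0.
  by apply/measurable_EFinP; exact: (cmeas_nsq (cmeas_slice_coef LF m)).
- exact: measurable_int I.
apply: filterS3 KI K_sing (slice_L2 LF) => x KxI Kxs Lx _.
by rewrite -(parseval (kernel_setT K x) KxI Kxs Lx).
Qed.

End slices.

(** * Power series on the bidisc *)

Section complex_series.
Context (R : realType).
Implicit Types (r A B : R).

Lemma geometric_partial_sum r n : 0 <= r -> r < 1 ->
  \sum_(k < n) r ^+ k <= (1 - r)^-1.
Proof.
move=> r0 r1; have r1' : 0 < 1 - r by rewrite subr_gt0.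
rewrite -[leRHS]mul1r ler_pdivlMr// mulrC -opprB mulNr -subrX1 opprB.
by rewrite gerBl exprn_ge0.
Qed.

Lemma real_series_tail (u : nat -> R) A r : 0 <= A -> 0 <= r -> r < 1 ->
  (forall n, `|u n| <= A * r ^+ n) ->
  exists l, forall N, `|l - \sum_(k < N) u k| <= A / (1 - r) * r ^+ N.
Proof.
move=> A0 r0 r1 uA.
have D N n : `|\sum_(k < N + n) u k - \sum_(k < N) u k| <= A / (1 - r) * r ^+ N.
  rewrite big_split_ord /= addrAC subrr add0r (le_trans (ler_norm_sum _ _ _))//.
  apply: (@le_trans _ _ (A * r ^+ N * \sum_(k < n) r ^+ k)).
    rewrite mulr_sumr; apply: ler_sum => i _.
    by rewrite (le_trans (uA _))// exprD mulrA.
  by rewrite mulrAC ler_wpM2r ?exprn_ge0// ler_wpM2l// geometric_partial_sum.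
have cu : cvgn (series u).
  apply: normed_cvg; apply: (@series_le_cvg _ _ (geometric A r)).
  - by move=> n; rewrite normr_ge0.
  - by move=> n; rewrite /geometric /= mulr_ge0// exprn_ge0.
  - by move=> n; exact: uA.
  - by apply: is_cvg_geometric_series; rewrite ger0_norm.
exists (limn (series u)) => N.
have nN : \forall n \near \oo, (N <= n)%N by exists N.
rewrite ler_norml lerBrDr lerBlDr; apply/andP; split.
  apply: limr_ge => //; near=> n.
  have Nn : (N <= n)%N by near: n.
  have := D N (n - N)%N; rewrite subnKC// /series /= big_mkord ler_norml => /andP[+ _].
  by rewrite lerBrDr.
apply: limr_le => //; near=> n.
have Nn : (N <= n)%N by near: n.
have := D N (n - N)%N; rewrite subnKC// /series /= big_mkord ler_norml => /andP[_].
by rewrite lerBlDr.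
Unshelve. all: by end_near. Qed.

Lemma cseries_eq (u : nat -> R[i]) (l : R[i]) B r : 0 <= r -> r < 1 ->
  (forall N, `|l - \sum_(k < N) u k| <= (B * r ^+ N)%:C) -> cseries u = l.
Proof.
move=> r0 r1 H; rewrite /cseries.
suff : (series (u : nat -> R[i]^o)) @ \oo --> (l : R[i]^o).
  exact: (cvg_lim (@norm_hausdorff _ R[i]^o)).
apply/cvgrPdist_lt => e; rewrite ltcE /= => /andP[/eqP eI eR].
have : (fun N => B * r ^+ N) @ \oo --> (0 : R).
  rewrite -[X in _ --> X](mulr0 B); apply: cvgM; first exact: cvg_cst.
  by apply: cvg_expr; rewrite ger0_norm.
move=> /cvgr_lt/(_ _ eR); apply: filterS => N BN.
rewrite /series /= big_mkord (le_lt_trans (H N))// ltcE /=.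
by rewrite eI eqxx.
Qed.

Lemma normc_le_Re_Im (z : R[i]) : `|z| <= (`|complex.Re z| + `|complex.Im z|)%:C.
Proof.
rewrite normc_nsq ?addr_ge0// /nsq sqrrD !real_normK ?num_real// -addrA lerD2l.
by rewrite lerDr mulrn_wge0// mulr_ge0.
Qed.

(** The factor 2 comes from estimating real and imaginary parts separately. *)
Lemma cseries_tail (u : nat -> R[i]) A r : 0 <= A -> 0 <= r -> r < 1 ->
  (forall n, `|u n| <= (A * r ^+ n)%:C) ->
  forall N, `|cseries u - \sum_(k < N) u k| <= (2 * A / (1 - r) * r ^+ N)%:C.
Proof.
move=> A0 r0 r1 uA.
have [a Ha] := real_series_tail A0 r0 r1 (fun n => Re_le_norm (uA n)).
have [b Hb] := real_series_tail A0 r0 r1 (fun n => Im_le_norm (uA n)).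
have H N : `|(a +i* b) - \sum_(k < N) u k| <= (2 * A / (1 - r) * r ^+ N)%:C.
  rewrite (le_trans (normc_le_Re_Im _))// lecR ReD ImD ReN ImN Re_sum Im_sum /=.
  rewrite -!mulrA mulr_natl mulr2n !mulrA; apply: lerD; [exact: Ha|exact: Hb].
by move=> N; rewrite (cseries_eq r0 r1 H).
Qed.

Lemma cseries_norm (u : nat -> R[i]) A r : 0 <= A -> 0 <= r -> r < 1 ->
  (forall n, `|u n| <= (A * r ^+ n)%:C) -> `|cseries u| <= (2 * A / (1 - r))%:C.
Proof.
move=> A0 r0 r1 uA; have := cseries_tail A0 r0 r1 uA 0.
by rewrite big_ord0 subr0 expr0 mulr1.
Qed.

Lemma cseriesZ (u : nat -> R[i]) (c : R[i]) A r : 0 <= A -> 0 <= r -> r < 1 ->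
  (forall n, `|u n| <= (A * r ^+ n)%:C) ->
  cseries (fun n => u n * c) = cseries u * c.
Proof.
move=> A0 r0 r1 uA.
apply: (@cseries_eq _ _ (2 * A / (1 - r) * Num.sqrt (nsq c)) r) => // N.
rewrite -mulr_suml -mulrBl normrM [X in _ <= X%:C]mulrAC rmorphM /=.
apply: ler_pM => //; first exact: cseries_tail.
by rewrite normc_def.
Qed.

(** Square partial sums are symmetric in the indices, so the same estimate for the other order gives
    the exchange. The 6 is 4 for the outer tail plus 2 for the inner ones. *)
Lemma iterated_series_tail (b : nat -> nat -> R[i]) A r : 0 <= A -> 0 <= r -> r < 1 ->
  (forall j i, `|b j i| <= (A * r ^+ j * r ^+ i)%:C) ->
  forall N, `|cseries (fun j => cseries (b j)) - \sum_(j < N) \sum_(i < N) b j i| <=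
  (6 * A / (1 - r) ^+ 2 * r ^+ N)%:C.
Proof.
move=> A0 r0 r1 bA N; have r1' : 0 < 1 - r by rewrite subr_gt0.
have Aj j : 0 <= A * r ^+ j by rewrite mulr_ge0// exprn_ge0.
have sj j : `|cseries (b j)| <= (2 * A / (1 - r) * r ^+ j)%:C.
  rewrite (le_trans (cseries_norm (Aj j) r0 r1 (bA j)))// lecR.
  by rewrite mulrA mulrAC.
have C0 : 0 <= 2 * A / (1 - r) by rewrite divr_ge0 ?(ltW r1')// mulr_ge0.
have H1 := cseries_tail C0 r0 r1 sj N.
rewrite -(subrK (\sum_(j < N) cseries (b j)) (cseries _)) -addrA.
rewrite (le_trans (ler_normD _ _))//.
have H2 : `|\sum_(j < N) cseries (b j) - \sum_(j < N) \sum_(i < N) b j i| <=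
    (2 * A / (1 - r) ^+ 2 * r ^+ N)%:C.
  rewrite -sumrB (le_trans (ler_norm_sum _ _ _))//.
  apply: (@le_trans _ _ (\sum_(j < N) (2 * A / (1 - r) * r ^+ N * r ^+ j)%:C)).
    apply: ler_sum => j _.
    rewrite (le_trans (cseries_tail (Aj j) r0 r1 (bA j) N))// lecR.
    by rewrite le_eqVlt; apply/orP; left; apply/eqP; ring.
  rewrite -rmorph_sum lecR -mulr_sumr.
  rewrite [leRHS](_ : _ = 2 * A / (1 - r) * r ^+ N * (1 - r)^-1); last first.
    by field; rewrite gt_eqF.
  apply: ler_wpM2l; last exact: geometric_partial_sum.
  by rewrite mulr_ge0// exprn_ge0.
apply: (le_trans (lerD H1 H2)); rewrite -rmorphD lecR le_eqVlt.
by apply/orP; left; apply/eqP; field; rewrite gt_eqF.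
Qed.

Lemma le_geometric_eq0 (z : R[i]) B r : 0 <= r -> r < 1 ->
  (forall N, `|z| <= (B * r ^+ N)%:C) -> z = 0.
Proof.
move=> r0 r1 H.
have E1 : cseries (fun=> 0 : R[i]) = z.
  by apply: (@cseries_eq _ _ B r) => // N; rewrite big1// subr0.
have E2 : cseries (fun=> 0 : R[i]) = 0.
  by apply: (@cseries_eq _ _ 0 r) => // N; rewrite big1// subr0 normr0 mul0r.
by rewrite -E1.
Qed.

Lemma iterated_series_exchange (b : nat -> nat -> R[i]) A r :
  0 <= A -> 0 <= r -> r < 1 ->
  (forall j i, `|b j i| <= (A * r ^+ j * r ^+ i)%:C) ->
  cseries (fun j => cseries (fun i => b j i)) =
  cseries (fun i => cseries (fun j => b j i)).
Proof.
move=> A0 r0 r1 bA; apply/eqP; rewrite -subr_eq0; apply/eqP.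
apply: (@le_geometric_eq0 _ (2 * (6 * A / (1 - r) ^+ 2)) r) => // N.
have H1 := iterated_series_tail A0 r0 r1 bA N.
have bA' i j : `|b j i| <= (A * r ^+ i * r ^+ j)%:C by rewrite mulrAC.
have := iterated_series_tail A0 r0 r1 bA' N.
rewrite exchange_big /= distrC => H2.
rewrite -(subrK (\sum_(j < N) \sum_(i < N) b j i) (cseries (fun j => _))) -addrA.
rewrite (le_trans (ler_normD _ _))// (le_trans (lerD H1 H2))// -rmorphD lecR.
by rewrite -[leRHS]mulrA [leRHS]mulr_natl [leRHS]mulr2n.
Qed.

(** Once the lower coefficients agree, evaluation at a small real [r] bounds [|u n - v n| * r ^+ n]
    by a multiple of [r ^+ n.+1]. The radii [2^-1 ^+ N.+1] stay below [2^-1], so [4 * A / (1 - r)]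
    is at most [8 * A]. *)
Lemma power_series_inj (u v : nat -> R[i]) A : 0 <= A ->
  (forall n, `|u n| <= A%:C) -> (forall n, `|v n| <= A%:C) ->
  (forall z, `|z| < 1 ->
    cseries (fun n => u n * z ^+ n) = cseries (fun n => v n * z ^+ n)) ->
  forall n, u n = v n.
Proof.
move=> A0 uA vA uv n; have [m] := ubnP n; elim: m n => // m IH n; rewrite ltnS => nm.
apply/eqP; rewrite -subr_eq0; apply/eqP.
have zb (w : nat -> R[i]) r k : (forall n, `|w n| <= A%:C) -> 0 <= r ->
    `|w k * r%:C ^+ k| <= (A * r ^+ k)%:C.
  move=> wA r0; rewrite normrM rmorphM /=; apply: ler_pM => //.
  by rewrite -rmorphXn ger0_norm// ler0c exprn_ge0.
have key r : 0 < r -> r < 1 -> `|u n - v n| <= (4 * A / (1 - r) * r)%:C.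
  move=> rp r1; have r0 := ltW rp; have r1' : 0 < 1 - r by rewrite subr_gt0.
  have rz : `|r%:C| < 1 by rewrite ger0_norm ?ler0c// (ltcR r 1).
  have H1 := cseries_tail A0 r0 r1 (fun k => zb u r k uA r0) n.+1.
  have H2 := cseries_tail A0 r0 r1 (fun k => zb v r k vA r0) n.+1.
  have E : (u n - v n) * r%:C ^+ n =
      \sum_(k < n.+1) u k * r%:C ^+ k - \sum_(k < n.+1) v k * r%:C ^+ k.
    rewrite -sumrB big_ord_recr /= big1 ?add0r ?mulrBl// => i _.
    by rewrite (IH i) ?subrr// (leq_trans (ltn_ord i)).
  have : `|(u n - v n) * r%:C ^+ n| <= (4 * A / (1 - r) * r ^+ n.+1)%:C.
    rewrite E -(subrK (cseries (fun k => u k * r%:C ^+ k)) (\sum_(k < n.+1) u k * _)).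
    rewrite -addrA (le_trans (ler_normD _ _))// {2}uv// distrC (le_trans (lerD H1 H2))//.
    rewrite -rmorphD lecR le_eqVlt; apply/orP; left; apply/eqP; field.
    by rewrite gt_eqF.
  rewrite normrM -rmorphXn [X in _ * X]ger0_norm ?ler0c ?exprn_ge0//.
  rewrite exprS [X in _ <= X%:C]mulrA [X in _ <= X]rmorphM /= ler_pM2r// (ltcR 0) exprn_gt0//.
apply: (@le_geometric_eq0 _ (8 * A) 2^-1) => [||N]; rewrite ?invr_ge0 ?invf_lt1 ?ltr1n//.
pose r : R := 2^-1 ^+ N.+1.
have r0 : 0 < r by rewrite exprn_gt0// invr_gt0.
have rN : r <= 2^-1 ^+ N.
  by rewrite /r exprS ler_piMl ?exprn_ge0 ?invr_ge0// invf_le1 ?ler1n.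
have r2 : r <= 2^-1.
  rewrite /r exprS ler_piMr ?invr_ge0// exprn_ile1// ?invr_ge0//.
  by rewrite invf_le1 ?ler1n.
have r1 : 2^-1 <= 1 - r by lra.
have r1' : 0 < 1 - r by lra.
have rl1 : r < 1 by rewrite -subr_gt0.
clearbody r; apply: (le_trans (key r r0 rl1)); rewrite lecR.
have v2 : (1 - r)^-1 <= 2 by rewrite -[leRHS]invrK lef_pV2 ?posrE// invr_gt0.
apply: ler_pM; rewrite ?(ltW r0)//.
  by rewrite divr_ge0 ?mulr_ge0// ltW.
rewrite [leRHS](_ : _ = 4 * A * 2); last by ring.
by rewrite ler_wpM2l// mulr_ge0.
Qed.

Lemma norm_lt1_real (z : R[i]) : `|z| < 1 ->
  exists2 r : R, 0 <= r < 1 & `|z| = r%:C.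
Proof.
rewrite normc_def => z1; eexists; last reflexivity.
by rewrite sqrtr_ge0 -(ltcR _ 1).
Qed.

Lemma double_series_exchange (a : nat -> nat -> R[i]) A (z w : R[i]) : 0 <= A ->
  (forall i j, `|a i j| <= A%:C) -> `|z| < 1 -> `|w| < 1 ->
  cseries (fun j => cseries (fun i => a i j * z ^+ i * w ^+ j)) =
  cseries (fun i => cseries (fun j => a i j * w ^+ j * z ^+ i)).
Proof.
move=> A0 aA /norm_lt1_real[s /andP[s0 s1] zs] /norm_lt1_real[t /andP[t0 t1] wt].
pose r := Num.max s t.
have r0 : 0 <= r by rewrite le_max s0.
have r1 : r < 1 by rewrite gt_max s1 t1.
have bA j i : `|a i j * z ^+ i * w ^+ j| <= (A * r ^+ j * r ^+ i)%:C.
  apply: (@le_trans _ _ (A * s ^+ i * t ^+ j)%:C).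
    rewrite !normrM !normrX zs wt -!rmorphXn !rmorphM.
    by rewrite !ler_wpM2r// ler0c exprn_ge0.
  rewrite lecR mulrAC; apply: ler_pM; rewrite ?mulr_ge0 ?exprn_ge0//.
    by rewrite ler_wpM2l// lerXn2r ?nnegrE// le_max lexx orbT.
  by rewrite lerXn2r ?nnegrE// le_max lexx.
rewrite (iterated_series_exchange A0 r0 r1 bA).
congr cseries; apply/funext => i; congr cseries; apply/funext => j.
by rewrite mulrAC.
Qed.

(** For frozen [z], uniqueness in [w] identifies the inner sums; uniqueness in [z] then identifies
    the coefficients. *)
Lemma double_series_inj (a b : nat -> nat -> R[i]) A : 0 <= A ->
  (forall i j, `|a i j| <= A%:C) -> (forall i j, `|b i j| <= A%:C) ->
  (forall z w, `|z| < 1 -> `|w| < 1 ->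
    cseries (fun j => cseries (fun i => a i j * z ^+ i * w ^+ j)) =
    cseries (fun j => cseries (fun i => b i j * z ^+ i * w ^+ j))) ->
  forall i j, a i j = b i j.
Proof.
move=> A0 aA bA ab i j.
apply: (@power_series_inj (fun i => a i j) (fun i => b i j) A A0) => // z z1.
have [r /andP[r0 r1] zr] := norm_lt1_real z1.
have bound (c : nat -> nat -> R[i]) k : (forall i j, `|c i j| <= A%:C) ->
    forall n, `|c n k * z ^+ n| <= (A * r ^+ n)%:C.
  move=> cA n; rewrite normrM normrX zr rmorphM rmorphXn /=; apply: ler_pM => //.
  by rewrite -rmorphXn ler0c exprn_ge0.
pose S (c : nat -> nat -> R[i]) k := cseries (fun i => c i k * z ^+ i).
apply: (@power_series_inj (S a) (S b) (2 * A / (1 - r))).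
- by rewrite divr_ge0 ?mulr_ge0// subr_ge0 ltW.
- by move=> n; exact: (cseries_norm A0 r0 r1 (bound a n aA)).
- by move=> n; exact: (cseries_norm A0 r0 r1 (bound b n bA)).
move=> w w1; have := ab z w z1 w1.
have E (c : nat -> nat -> R[i]) : (forall i j, `|c i j| <= A%:C) ->
    (fun j => cseries (fun i => c i j * z ^+ i * w ^+ j)) = fun j => S c j * w ^+ j.
  move=> cA; apply/funext => k.
  exact: (cseriesZ (w ^+ k) A0 r0 r1 (bound c k cA)).
by rewrite !E.
Qed.

End complex_series.

(** * Gram matrices of auxiliary sequences *)

Section bounded_functions.
Context d (T : measurableType d) (R : realType).
Variable nu : {measure set T -> \bar R}.
Hypothesis nu1 : nu setT = 1%E.
Implicit Type f : T -> R[i].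

Lemma nrm2_le_bound f C : cmeas f -> (forall x, nsq (f x) <= C) -> nrm2 nu f <= C.
Proof.
move=> mf fC; have fin : (nu setT < +oo)%E by rewrite nu1 ltry.
have Lf := L2_bounded fin mf fC.
rewrite -lee_fin nrm2E//.
apply: (@le_trans _ _ (\int[nu]_x C%:E)%E).
  apply: ge0_le_integral => //.
  - by move=> x _; rewrite lee_fin nsq_ge0.
  - by apply/measurable_EFinP; exact: cmeas_nsq.
  - by move=> x _; rewrite lee_fin; exact: fC.
by rewrite integral_cst// nu1 mule1.
Qed.

Lemma cintegrable_bounded f C : cmeas f -> (forall x, nsq (f x) <= C) ->
  cintegrable nu f.
Proof.
move=> [f1 f2] fC; have fin : (nu setT < +oo)%E by rewrite nu1 ltry.
split.
  apply: (integrable_bounded fin f1 (C := 1 + C)) => x.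
  by rewrite (le_trans (normr_Re_le _))// lerD2l.
apply: (integrable_bounded fin f2 (C := 1 + C)) => x.
by rewrite (le_trans (normr_Im_le _))// lerD2l.
Qed.

End bounded_functions.

Section aux_coefficients.
Context (R : realType).
Variable nu : {measure set R -> \bar R}.
Hypothesis nu1 : nu setT = 1%E.

(** The constant a_n with [g_(n+1) = e_1 g_n + a_n]. It is minus the conjugate of the coefficient of
    [expz (- 1)] at [aux_seq nu n]. *)
Definition aux_coef n : R[i] :=
  - inner nu (fun x => expz 1 x * aux_seq nu n x) (expz 0).

Lemma aux_seq_mom n x : aux_seq nu n x =
  expz n%:Z x - \sum_(k < n) mom nu (n - k)%N%:Z * aux_seq nu k x.
Proof.
rewrite aux_seqE; congr (_ - _); apply: eq_bigr => k _.
by rewrite !expi_expz inner_expz subzn// ltnW.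
Qed.

(** By induction only the term [k = 0] of the recurrence meets [expz 0], and it cancels the moment
    of the leading exponential. *)
Lemma aux_seq_ortho n : inner nu (aux_seq nu n.+1) (expz 0) = 0.
Proof.
have Le := L2_expz nu1; have La := L2_aux nu1.
have [m] := ubnP n; elim: m n => // m IH n; rewrite ltnS => nm.
rewrite (_ : aux_seq nu n.+1 = fun x => expz n.+1%:Z x -
  \sum_(k < n.+1) mom nu (n.+1 - k)%N%:Z * aux_seq nu k x); last first.
  by apply/funext => x; rewrite aux_seq_mom.
rewrite innerBl//; last by apply: L2_sum => k; exact: L2Z.
rewrite inner_suml//; last by move=> k; exact: L2Z.
rewrite big_ord_recl /= big1 ?addr0; last first.
  move=> k _; rewrite innerZl// /bump /= add1n IH ?mulr0//.
  by rewrite (leq_trans (ltn_ord k)).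
rewrite innerZl// subn0 inner_expz subr0 aux_seq0 expi_expz.
by rewrite inner_expz subrr mom0// mulr1 subrr.
Qed.

(** Both claims are proved together: the shift relation at smaller indices produces some additive
    constant, and orthogonality to [expz 0] identifies it with [aux_coef n]. *)
Lemma aux_coef_rec n :
  aux_coef n = - (mom nu n.+1%:Z + \sum_(k < n) mom nu (n - k)%N%:Z * aux_coef k) /\
  forall x, aux_seq nu n.+1 x = expz 1 x * aux_seq nu n x + aux_coef n.
Proof.
have Le := L2_expz nu1; have La := L2_aux nu1.
have [m] := ubnP n; elim: m n => // m IH n; rewrite ltnS => nm.
set D := - (_ + _).
have E x : aux_seq nu n.+1 x = expz 1 x * aux_seq nu n x + D * expz 0 x.
  rewrite aux_seq_mom big_ord_recl /= subn0 aux_seq0 expi_expz expz0 !mulr1.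
  rewrite (eq_bigr (fun k : 'I_n => expz 1 x * (mom nu (n - k)%N%:Z * aux_seq nu k x) +
      mom nu (n - k)%N%:Z * aux_coef k)); last first.
    move=> k _; rewrite /bump /= add1n subSS.
    have [_ ->] := IH k (leq_trans (ltn_ord k) nm).
    by rewrite mulrDr mulrCA.
  rewrite big_split /= -mulr_sumr [in RHS]aux_seq_mom mulrBr -expzD -PoszD add1n.
  by rewrite /D; ring.
have DE : D = aux_coef n.
  have := aux_seq_ortho n.
  rewrite (_ : aux_seq nu n.+1 = fun x => expz 1 x * aux_seq nu n x + D * expz 0 x);
    last exact/funext.
  have LS := L2_expzM 1 (La n).
  rewrite innerDl//; last exact: L2Z.
  rewrite innerZl// inner_expz subrr mom0// mulr1 => /eqP.
  by rewrite addrC addr_eq0 => /eqP.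
by split=> // x; rewrite E expz0 mulr1 DE.
Qed.

(** Multiplication by [expz 1] preserves inner products. Each cross term contributes
    [- a_n conj(a_m)] and the constants contribute it once positively. *)
Lemma aux_gram n m : inner nu (aux_seq nu n.+1) (aux_seq nu m.+1) =
  inner nu (aux_seq nu n) (aux_seq nu m) - aux_coef n * (aux_coef m)^*.
Proof.
have Le := L2_expz nu1; have La := L2_aux nu1.
have LS k := L2_expzM 1 (La k).
have E k : aux_seq nu k.+1 = fun x => expz 1 x * aux_seq nu k x + aux_coef k * expz 0 x.
  by apply/funext => x; rewrite (aux_coef_rec k).2 expz0 mulr1.
have LZ k : L2 nu (fun x => aux_coef k * expz 0 x) by exact: L2Z.
have c1 k : inner nu (fun x => expz 1 x * aux_seq nu k x) (expz 0) = - aux_coef k.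
  by rewrite opprK.
have c2 k : inner nu (expz 0) (fun x => expz 1 x * aux_seq nu k x) = - (aux_coef k)^*.
  by rewrite innerC// c1 rmorphN.
rewrite !E innerDl ?innerDr//; last exact: L2D.
rewrite !innerZl// ?innerZr// c1 c2 inner_expz subrr mom0//.
have -> : inner nu (fun x => expz 1 x * aux_seq nu n x)
    (fun x => expz 1 x * aux_seq nu m x) = inner nu (aux_seq nu n) (aux_seq nu m).
  congr cintegral; apply/funext => x.
  by rewrite rmorphM /= mulrACA mulcJ nsq_expz mul1r.
ring.
Qed.

Lemma nrm2_aux_le n : nrm2 nu (aux_seq nu n) <= (2 ^+ n) ^+ 2.
Proof.
apply: (nrm2_le_bound nu1) => [|x]; first exact/L2_cmeas/(L2_aux nu1).
exact: nsq_aux_seq_le.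
Qed.

Lemma nsq_inner_aux_le n m :
  nsq (inner nu (aux_seq nu n) (aux_seq nu m)) <= (2 ^+ n) ^+ 2 * (2 ^+ m) ^+ 2.
Proof.
have La := L2_aux nu1; apply: (le_trans (cauchy_schwarz (La n) (La m))).
by apply: ler_pM; rewrite ?nrm2_ge0// nrm2_aux_le.
Qed.

Lemma nsq_aux_coef_le n : nsq (aux_coef n) <= (2 ^+ n) ^+ 2.
Proof.
have La := L2_aux nu1 n; have LS := L2_expzM 1 La.
rewrite /aux_coef nsqN (le_trans (cauchy_schwarz LS (L2_expz nu1 0)))//.
by rewrite nrm2_expz// mulr1 nrm2_expzM nrm2_aux_le.
Qed.

(** The variance of [f] is [nrm2 f - nsq a], which vanishes. *)
Lemma ae_eq_mean (f : R -> R[i]) (a : R[i]) : L2 nu f ->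
  cintegral nu f = a -> nrm2 nu f = nsq a -> {ae nu, forall x, f x = a}.
Proof.
move=> Lf fa f2; have L0 := L2_expz nu1 0.
have La : L2 nu (fun x => a * expz 0 x) by exact: L2Z.
have : nrm2 nu (fun x => f x - a * expz 0 x) = 0.
  rewrite nrm2B// nrm2Z// nrm2_expz// mulr1 f2 innerZr//.
  have -> : inner nu f (expz 0) = a.
    rewrite -fa; congr cintegral; apply/funext => x.
    by rewrite expz0 rmorph1 mulr1.
  by rewrite [X in complex.Re X]mulrC mulcJ /=; ring.
move=> /(nrm2_eq0 (L2B Lf La)); apply: filterS => x.
by rewrite expz0 mulr1 => /eqP; rewrite subr_eq0 => /eqP.
Qed.

End aux_coefficients.

(** * From averaged Gram matrices to constant slice moments *)

Section constant_moments.
Context (R : realType).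
Variables (M1 M2 : probability R R) (K : R.-pker R ~> R).
Hypothesis gramE : forall n m, inner M1 (aux_seq M1 n) (aux_seq M1 m) =
  cintegral M2 (fun x => inner (K x) (aux_seq (K x) n) (aux_seq (K x) m)).
Hypothesis momE : forall j, mom M1 j = cintegral M2 (fun x => mom (K x) j).

Let M11 : M1 setT = 1%E. Proof. exact: probability_setT. Qed.
Let M21 : M2 setT = 1%E. Proof. exact: probability_setT. Qed.

Lemma cmeas_kernel_gram n m :
  cmeas (fun x => inner (K x) (aux_seq (K x) n) (aux_seq (K x) m)).
Proof.
apply: (@cmeas_kernel_inner _ K (fun z => aux_seq (K z.1) n z.2)
  (fun z => aux_seq (K z.1) m z.2)); exact: cmeas_aux_seq.
Qed.

Lemma cmeas_aux_coef n : cmeas (fun x => aux_coef (K x) n).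
Proof.
apply: cmeasN; apply: (@cmeas_kernel_inner _ K
  (fun z => expz 1 z.2 * aux_seq (K z.1) n z.2) (fun z => expz 0 z.2)).
  apply: cmeasM; last exact: cmeas_aux_seq.
  by apply: (@cmeas_comp _ _ _ _ _ snd (expz 1)); [exact: measurable_snd|exact: cmeas_expz].
by apply: (@cmeas_comp _ _ _ _ _ snd (expz 0)); [exact: measurable_snd|exact: cmeas_expz].
Qed.

Lemma L2_aux_coef n : L2 M2 (fun x => aux_coef (K x) n).
Proof.
have fin : (M2 setT < +oo)%E by rewrite M21 ltry.
apply: (L2_bounded fin (cmeas_aux_coef n) (C := (2 ^+ n) ^+ 2)) => x.
exact/nsq_aux_coef_le/kernel_setT.
Qed.

(** By [aux_gram] the products are differences of consecutive diagonal Gram entries, which average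
    by hypothesis. *)
Lemma inner_aux_coef n m :
  inner M2 (fun x => aux_coef (K x) n) (fun x => aux_coef (K x) m) =
  aux_coef M1 n * (aux_coef M1 m)^*.
Proof.
have ci k l : cintegrable M2 (fun x => inner (K x) (aux_seq (K x) k) (aux_seq (K x) l)).
  apply: (cintegrable_bounded M21 (cmeas_kernel_gram k l)) => x.
  exact/nsq_inner_aux_le/kernel_setT.
have -> : aux_coef M1 n * (aux_coef M1 m)^* =
    inner M1 (aux_seq M1 n) (aux_seq M1 m) - inner M1 (aux_seq M1 n.+1) (aux_seq M1 m.+1).
  by rewrite aux_gram// opprB addrC subrK.
rewrite !gramE -cintegralB//; congr cintegral; apply/funext => x.
by rewrite aux_gram ?kernel_setT// opprB addrC subrK.
Qed.

Lemma aux_coef_ae n : {ae M2, forall x, aux_coef (K x) n = aux_coef M1 n}.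
Proof.
have Lb := L2_aux_coef.
have N k : nrm2 M2 (fun x => aux_coef (K x) k) = nsq (aux_coef M1 k).
  by have := inner_aux_coef k k; rewrite inner_self mulcJ => -[].
have Z k : aux_coef M1 k = 0 -> {ae M2, forall x, aux_coef (K x) k = 0}.
  by move=> k0; apply: (nrm2_eq0 (Lb k)); rewrite N k0 nsq0.
(* Without a nonzero coefficient for [M1] there is no pivot, but then the norm identity alone makes
   the slice coefficients vanish. *)
have [[p0 hp0]|nop] := pselect (exists p, aux_coef M1 p != 0); last first.
  have k0 : aux_coef M1 n = 0.
    by apply/eqP; apply: contrapT => /negP h; apply: nop; exists n.
  by rewrite k0; exact: Z.
have ex : exists p, aux_coef M1 p != 0 by exists p0.
pose p := ex_minn ex.
have [hp pmin] : aux_coef M1 p != 0 /\ forall k, (k < p)%N -> aux_coef M1 k = 0.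
  rewrite /p; case: ex_minnP => q hq qmin; split=> // k kq.
  by apply/eqP; apply: contraTT kq => /qmin; rewrite -leqNgt.
have rec0 (nu : {measure set R -> \bar R}) : nu setT = 1%E ->
    (forall k, (k < p)%N -> aux_coef nu k = 0) -> aux_coef nu p = - mom nu p.+1%:Z.
  move=> nu1 H; rewrite (aux_coef_rec nu1 p).1 big1 ?addr0// => k _.
  by rewrite H ?mulr0// ltn_ord.
have bp : {ae M2, forall x, aux_coef (K x) p = aux_coef M1 p}.
  apply: ae_eq_mean => //.
  rewrite (rec0 _ M11 pmin) momE.
  have H : {ae M2, forall x, forall k, (k < p)%N -> aux_coef (K x) k = 0}.
    apply/ae_foralln => k; have [kp|kp] := ltnP k p.
      by apply: filterS (Z k (pmin k kp)) => x xk _.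
    exact: aeW.
  rewrite -[RHS]mulN1r -cintegralZ; last first.
    apply: (cintegrable_bounded M21 (cmeas_mom K _) (C := 1)) => x.
    exact/mom_le1/kernel_setT.
  apply: ae_eq_cintegral.
  - exact: cmeas_aux_coef.
  - exact/cmeasZ/cmeas_mom.
  - by apply: filterS H => x hx; rewrite mulN1r; exact: (rec0 _ (kernel_setT K x)).
apply: ae_eq_mean => //.
(* Since the [p]-th slice coefficient is constant and nonzero, it can be pulled out and cancelled:
   the mean of the [n]-th one is [aux_coef M1 n]. *)
have := inner_aux_coef n p.
have -> : inner M2 (fun x => aux_coef (K x) n) (fun x => aux_coef (K x) p) =
    (aux_coef M1 p)^* * cintegral M2 (fun x => aux_coef (K x) n).
  rewrite -cintegralZ; last first.
    apply: (cintegrable_bounded M21 (cmeas_aux_coef n)) => x.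
    exact/nsq_aux_coef_le/kernel_setT.
  apply: ae_eq_cintegral.
  - by apply: cmeasM; [|apply: cmeasJ]; exact: cmeas_aux_coef.
  - exact/cmeasZ/cmeas_aux_coef.
  - by apply: filterS bp => x ->; rewrite mulrC.
rewrite mulrC => /(mulIf _); apply.
by rewrite conjC_eq0.
Qed.

(** The recurrence of [aux_coef_rec], solved for its top moment, recovers the moments from the
    coefficients. *)
Lemma mom_ae : {ae M2, forall x, forall j, mom (K x) j = mom M1 j}.
Proof.
have H : {ae M2, forall x, forall n, aux_coef (K x) n = aux_coef M1 n}.
  by apply/ae_foralln => n; exact: aux_coef_ae.
apply: filterS H => x hx.
have Kx := kernel_setT K x.
have pos (n : nat) : mom (K x) n%:Z = mom M1 n%:Z.
  have [m] := ubnP n; elim: m n => // m IH [|n]; rewrite ltnS => nm.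
    by rewrite !mom0.
  have S : \sum_(k < n) mom (K x) (n - k)%N%:Z * aux_coef (K x) k =
      \sum_(k < n) mom M1 (n - k)%N%:Z * aux_coef M1 k.
    apply: eq_bigr => k _.
    by rewrite hx IH// (leq_ltn_trans (leq_subr _ _)).
  have := (aux_coef_rec Kx n).1; rewrite hx (aux_coef_rec M11 n).1 S.
  by move=> /oppr_inj/addIr.
case=> n; first exact: pos.
by rewrite NegzE !momN// pos.
Qed.

End constant_moments.

(** * Slices of a product measure *)

Section product_moments.
Context (R : realType).
Variables (mu : probability (R * R)%type R) (nu nu2 : probability R R).
Variables (K : R.-pker R ~> R) (sg : R * R -> R * R).
Hypothesis msg : measurable_fun setT sg.
Hypothesis sgK : involutive sg.
Hypothesis disint : forall f : R * R -> R,
  mu.-integrable setT (EFin \o (fun z => f (sg z))) ->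
  (\int[mu]_z (f (sg z))%:E = \int[nu]_x \int[K x]_y (f (x, y))%:E)%E.
Hypothesis prod_disint : forall f : R * R -> R,
  mu.-integrable setT (EFin \o (fun z => f (sg z))) ->
  (\int[mu]_z (f (sg z))%:E = \int[nu]_x \int[nu2]_y (f (x, y))%:E)%E.

(** Test both disintegrations on [Phi (x, y) = conj(F x) * G y]. The one through [K] gives the
    squared norm of [F], and the product gives 0 because [G] has mean 0 under [nu2]. *)
Lemma product_mom_ae : {ae nu, forall x, forall j, mom (K x) j = mom nu2 j}.
Proof.
have nu1 : nu setT = 1%E by exact: probability_setT.
have nu21 : nu2 setT = 1%E by exact: probability_setT.
have mu11 : mu setT = 1%E by exact: probability_setT.
pose K2 : R.-pker R ~> R := kprobability (@measurable_cst _ _ R (pprobability R R) setT nu2).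
suff H (n : nat) : {ae nu, forall x, mom (K x) n%:Z = mom nu2 n%:Z}.
  have : {ae nu, forall x, forall n : nat, mom (K x) n%:Z = mom nu2 n%:Z}.
    by apply/ae_foralln => n; exact: H.
  apply: filterS => x hx; case=> k; first exact: hx.
  by rewrite NegzE !momN ?kernel_setT// hx.
pose c := mom nu2 n%:Z; pose F x := mom (K x) n%:Z - c.
have mF : cmeas F by apply: cmeasB; [exact: cmeas_mom|exact: cmeas_cst].
have bF x : nsq (F x) <= 4.
  rewrite (le_trans (nsqB_le _ _))//.
  have := mom_le1 (kernel_setT K x) n%:Z; have := mom_le1 nu21 n%:Z.
  by rewrite -/c; move: (nsq _) (nsq _) => u v; lra.
pose G y := expz n%:Z y - c * expz 0 y.
have tG : trig G by apply: trigB; [exact: trig_expz|apply: trigZ; exact: trig_expz].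
have [C GC] := trig_bounded tG.
pose Phi (z : R * R) := (F z.1)^* * G z.2.
have mPhi : cmeas Phi.
  apply: cmeasM.
    by apply/cmeasJ/(cmeas_comp measurable_fst).
  by apply/(cmeas_comp measurable_snd)/trig_cmeas.
have IPhi : cintegrable mu (fun z => Phi (sg z)).
  apply: (cintegrable_bounded mu11 (cmeas_comp msg mPhi) (C := 4 * C)) => z.
  by rewrite nsqM nsqJ; apply: ler_pM => //; exact: nsq_ge0.
have G_int (m : {measure set R -> \bar R}) : m setT = 1%E ->
    cintegral m G = mom m n%:Z - c.
  move=> m1; rewrite cintegralB; last 2 first.
  - exact/(trig_cintegrable m1)/trig_expz.
  - apply: cintegrableZ; exact/(trig_cintegrable m1)/trig_expz.
  rewrite cintegralZ; last exact/(trig_cintegrable m1)/trig_expz.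
  by rewrite -/(mom m 0) mom0// mulr1.
have [_ E1] := slice_cintegral msg sgK disint IPhi.
have [_ E2] := @slice_cintegral _ mu nu K2 sg msg sgK prod_disint Phi IPhi.
have LF : L2 nu F.
  have nu_fin : (nu setT < +oo)%E by rewrite nu1 ltry.
  exact: (L2_bounded nu_fin mF bF).
have F0 : nrm2 nu F = 0.
  have : inner nu F F = 0.
    transitivity (cintegral mu (fun z => Phi (sg z))).
      rewrite E1; congr cintegral; apply/funext => x.
      rewrite /Phi /= cintegralZ; last first.
        exact/(trig_cintegrable (kernel_setT K x)).
      by rewrite G_int ?kernel_setT// mulrC.
    rewrite E2 -[RHS](cintegral0 nu); congr cintegral; apply/funext => x.
    rewrite /Phi /= cintegralZ; last exact: (trig_cintegrable nu21).
    by rewrite (G_int nu2)// subrr mulr0.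
  by rewrite inner_self => -[].
by apply: filterS (nrm2_eq0 LF F0) => x /eqP; rewrite subr_eq0 => /eqP.
Qed.

End product_moments.

(** * Constant slice moments give a product measure *)

Section moments_product.
Context (R : realType).
Variables (mu : probability (R * R)%type R) (K : R.-pker R ~> R).
Local Notation M1 := (marginal1 mu).
Local Notation M2 := (marginal2 mu).
Local Notation swap := (fun z : R * R => (z.2, z.1)).
Hypothesis disint : forall f : R * R -> R,
  mu.-integrable setT (EFin \o (fun z => f (swap z))) ->
  (\int[mu]_z (f (swap z))%:E = \int[M2]_x \int[K x]_y (f (x, y))%:E)%E.
Hypothesis M1I : M1 (~` `[0, 1[%classic) = 0%E.
Hypothesis momK : {ae M2, forall x, forall j, mom (K x) j = mom M1 j}.

Lemma cintegral_indic d (T : measurableType d) (P : probability T R) (A : set T) :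
  measurable A -> cintegral P (fun x => (\1_A x)%:C) = (fine (P A))%:C.
Proof.
move=> mA; apply: complex_eq => /=; last by rewrite /Rintegral integral0.
by rewrite /Rintegral integral_indic// setIT.
Qed.

Lemma nsq_cintegral_le d (T : measurableType d) (P : {measure set T -> \bar R}) f :
  P setT = 1%E -> L2 P f -> nsq (cintegral P f) <= nrm2 P f.
Proof.
move=> P1 Lf; have P_fin : (P setT < +oo)%E by rewrite P1 ltry.
have m1 : cmeas (fun _ : T => 1 : R[i]) by exact: cmeas_cst.
have b1 (x : T) : nsq (1 : R[i]) <= 1 by rewrite nsq1.
have L1 := L2_bounded P_fin m1 b1.
have -> : cintegral P f = inner P f (fun=> 1).
  by congr cintegral; apply/funext => x; rewrite rmorph1 mulr1.
apply: (le_trans (cauchy_schwarz Lf L1)).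
by rewrite -[leRHS]mulr1 ler_wpM2l ?nrm2_ge0// nrm2_le_bound.
Qed.

Lemma nrm2_marginal1 f : cmeas f -> nrm2 mu (fun z => f z.1) = nrm2 M1 f.
Proof.
move=> mf; rewrite /nrm2 /Rintegral; congr fine.
rewrite ge0_integral_distribution//.
  by apply/measurable_EFinP; exact: cmeas_nsq.
by move=> y; rewrite lee_fin nsq_ge0.
Qed.

Lemma trig_moments (m1 m2 : {measure set R -> \bar R}) p : m1 setT = 1%E ->
  m2 setT = 1%E -> (forall j, mom m1 j = mom m2 j) -> trig p ->
  cintegral m1 p = cintegral m2 p.
Proof.
move=> m11 m21 mm; elim=> [j|a f g tf IHf tg IHg]; first exact: mm.
rewrite !cintegralD ?cintegralZ ?IHf ?IHg//;
  by [exact: (trig_cintegrable m11) | exact: (trig_cintegrable m21)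
     |exact/cintegrableZ/(trig_cintegrable m11)|exact/cintegrableZ/(trig_cintegrable m21)].
Qed.

(** Replace the indicator of [A] by a trigonometric polynomial [p] close to it in L^2 of the first
    marginal. For [p] the slice integrals are almost surely constant, so the integral factors; [Y]
    is this intermediate value, within [e] in squared modulus of both [X] and [Z], and [nsqD_le]
    yields [4 * e]. *)
Lemma mom_product A B : measurable A -> measurable B ->
  mu (A `*` B) = (M1 A * M2 B)%E.
Proof.
move=> mA mB.
have M11 : M1 setT = 1%E by exact: probability_setT.
have M21 : M2 setT = 1%E by exact: probability_setT.
have mu1 : mu setT = 1%E by exact: probability_setT.
have mu_fin : (mu setT < +oo)%E by rewrite mu1 ltry.
have M1_fin : (M1 setT < +oo)%E by rewrite M11 ltry.
have M2_fin : (M2 setT < +oo)%E by rewrite M21 ltry.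
have iA (T : Type) (S : set T) (x : T) : nsq ((\1_S x : R)%:C) <= 1.
  by rewrite nsq_real indicE; case: (_ \in _); rewrite /= ?expr1n ?expr0n.
have m1A : cmeas (fun x => (\1_A x : R)%:C) by apply: cmeas_real; exact: measurable_indic.
have m1B : cmeas (fun x => (\1_B x : R)%:C) by apply: cmeas_real; exact: measurable_indic.
pose X := cintegral mu (fun z => (\1_(A `*` B) z)%:C).
pose Z := cintegral M1 (fun x => (\1_A x)%:C) * cintegral M2 (fun x => (\1_B x)%:C).
suff XZ : X = Z.
  move: XZ; rewrite /X /Z !cintegral_indic//; last exact: measurableX.
  rewrite -rmorphM /= => -[E].
  have fin d (T : measurableType d) (P : probability T R) S : measurable S ->
      P S \is a fin_num.
    by move=> mS; exact: fin_num_measure.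
  rewrite -(fineK (fin _ _ mu (A `*` B) (measurableX mA mB))) E EFinM.
  by rewrite !fineK//; exact: fin.
have LA : L2 M1 (fun x => (\1_A x)%:C).
  exact: (L2_bounded M1_fin m1A (C := 1)).
have LB2 : L2 M2 (fun x => (\1_B x)%:C) by exact: (L2_bounded M2_fin m1B (C := 1)).
have LB : L2 mu (fun z => (\1_B z.2)%:C).
  by apply: (L2_bounded mu_fin (cmeas_comp measurable_snd m1B) (C := 1)).
have nB : nrm2 mu (fun z => (\1_B z.2)%:C) <= 1.
  by apply: (nrm2_le_bound mu1) => //; exact: (cmeas_comp measurable_snd m1B).
have small e : 0 < e -> nsq (X - Z) <= 4 * e.
  move=> e0.
  have [p tp pe] := (dens_indic M1_fin M1I mA).2 e e0.
  have mp : cmeas p by exact: trig_cmeas.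
  have [C pC] := trig_bounded tp.
  have mD : cmeas (fun x => (\1_A x)%:C - p x) by exact: cmeasB.
  have Lp : L2 M1 p by exact: (L2_bounded M1_fin mp pC).
  have LD : L2 mu (fun z => (\1_A z.1)%:C - p z.1).
    apply: (L2_bounded mu_fin (cmeas_comp measurable_fst mD) (C := 2 * 1 + 2 * C)) => z.
    by rewrite (le_trans (nsqB_le _ _))// lerD// ler_wpM2l.
  pose Phi (z : R * R) := (\1_B z.1)%:C * p z.2.
  have mPhi : cmeas Phi.
    by apply: cmeasM; [exact: (cmeas_comp measurable_fst m1B)|
                       exact: (cmeas_comp measurable_snd mp)].
  have PhiC z : nsq (Phi z) <= C.
    rewrite nsqM -[leRHS]mul1r; apply: ler_pM => //; exact: nsq_ge0.
  have swapK : involutive swap by case.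
  have msw : measurable_fun setT swap by exact: measurable_swap.
  have IPhi : cintegrable mu (fun z => Phi (swap z)).
    by apply: (cintegrable_bounded mu1 (cmeas_comp msw mPhi) (C := C)) => z.
  pose Y := cintegral mu (fun z => Phi (swap z)).
  have XY : nsq (X - Y) <= e.
    have -> : X - Y = inner mu (fun z => (\1_A z.1)%:C - p z.1) (fun z => (\1_B z.2)%:C).
      rewrite /X /Y -cintegralB//; last first.
        apply: (cintegrable_bounded mu1 (C := 1)) => //.
        by apply: cmeas_real; apply: measurable_indic; exact: measurableX.
      congr cintegral; apply/funext => z /=.
      rewrite conj_realc mulrBl; congr (_ - _); last by rewrite mulrC.
      by rewrite -rmorphM /= !indicE in_setX -natrM mulnb.
    apply: (le_trans (cauchy_schwarz LD LB)).
    rewrite (nrm2_marginal1 mD) -[leRHS]mulr1.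
    by apply: ler_pM => //; exact: nrm2_ge0.
  have YE : Y = cintegral M1 p * cintegral M2 (fun x => (\1_B x)%:C).
    have [_ E] := slice_cintegral msw swapK disint IPhi; rewrite /Y {}E.
    rewrite -cintegralZ; last exact: (cintegrable_bounded M21 m1B (C := 1)).
    apply: ae_eq_cintegral.
    - exact: (cmeas_kernel_integral K mPhi).
    - exact: cmeasZ.
    - apply: filterS momK => x hx; rewrite /Phi /=.
      rewrite cintegralZ; last exact: (trig_cintegrable (kernel_setT K x)).
      by rewrite mulrC (trig_moments (kernel_setT K x) M11 hx).
  have YZ : nsq (Y - Z) <= e.
    rewrite YE /Z -mulrBl nsqM -[leRHS]mulr1.
    apply: ler_pM; try exact: nsq_ge0.
      rewrite -cintegralB; last 2 first.
      - exact: trig_cintegrable.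
      - exact: (cintegrable_bounded M11 m1A (C := 1)).
      under eq_fun do rewrite -opprB.
      have LAp : L2 M1 (fun x => (\1_A x)%:C - p x) by exact: L2B.
      apply: (le_trans (nsq_cintegral_le M11 (L2N LAp))).
      by rewrite nrm2N.
    apply: (le_trans (nsq_cintegral_le M21 LB2)).
    exact: (nrm2_le_bound M21 m1B).
  rewrite -(subrK Y X) -addrA (le_trans (nsqD_le _ _))//.
  by move: (nsq _) (nsq _) XY YZ => u v; lra.
apply/eqP; rewrite -subr_eq0; apply/eqP/nsq_eq0/eqP; rewrite eq_le nsq_ge0 andbT.
apply/ler_addgt0Pl => e e0; rewrite addr0.
have e4 : 0 < e / 4 by rewrite divr_gt0.
by have := small _ e4; move: (nsq _) => u; lra.
Qed.

End moments_product.

(** * The equivalence *)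

Section unitary_from_coefficients.
Context d (T : measurableType d) (R : realType).
Variable mu : {measure set T -> \bar R}.
Variables u v : nat -> nat -> T -> R[i].
Hypothesis Lu : forall n m, L2 mu (u n m).
Hypothesis Lv : forall n m, L2 mu (v n m).
Hypothesis parseval_u : forall f, L2 mu f ->
  (\sum_(0 <= m <oo) \sum_(0 <= n <oo) (nsq (inner mu f (u n m)))%:E =
   (nrm2 mu f)%:E)%E.
Hypothesis parseval_v : forall f, L2 mu f ->
  (\sum_(0 <= n <oo) \sum_(0 <= m <oo) (nsq (inner mu f (v n m)))%:E =
   (nrm2 mu f)%:E)%E.
Hypothesis coef_uv : forall f, L2 mu f ->
  exists2 f', L2 mu f' & forall n m, inner mu f' (v n m) = inner mu f (u n m).
Hypothesis coef_vu : forall f, L2 mu f ->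
  exists2 f', L2 mu f' & forall n m, inner mu f' (u n m) = inner mu f (v n m).

Lemma coef_ae_eq f g : L2 mu f -> L2 mu g ->
  (forall n m, inner mu f (v n m) = inner mu g (v n m)) ->
  {ae mu, forall x, f x = g x}.
Proof.
move=> Lf Lg fg; have LD := L2B Lf Lg.
have D0 : nrm2 mu (fun x => f x - g x) = 0.
  apply: EFin_inj; rewrite -parseval_v// eseries0// => n _ _.
  by rewrite eseries0// => m _ _; rewrite innerBl// fg subrr nsq0.
by apply: filterS (nrm2_eq0 LD D0) => x /eqP; rewrite subr_eq0 => /eqP.
Qed.

(** The two Parseval identities sum in opposite orders, since slices and marginal exchange roles;
    nonnegative terms permit the interchange. *)
Lemma coef_nrm2 f f' : L2 mu f -> L2 mu f' ->
  (forall n m, inner mu f' (v n m) = inner mu f (u n m)) ->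
  nrm2 mu f' = nrm2 mu f.
Proof.
move=> Lf Lf' E; apply: EFin_inj.
rewrite -(parseval_v Lf') -(parseval_u Lf).
rewrite nneseries_interchange; last by move=> i j; rewrite lee_fin nsq_ge0.
by apply: eq_eseriesr => m _; apply: eq_eseriesr => n _; rewrite E.
Qed.

Lemma Re_inner f g : L2 mu f -> L2 mu g ->
  complex.Re (inner mu f g) =
  (nrm2 mu (fun x => f x + g x) - nrm2 mu f - nrm2 mu g) / 2.
Proof. by move=> Lf Lg; rewrite nrm2D//; field. Qed.

(** Second half of polarization: a norm-preserving map that is linear almost everywhere then
    preserves inner products. *)
Lemma Im_inner f g : L2 mu f -> L2 mu g ->
  complex.Im (inner mu f g) = complex.Re (inner mu f (fun x => (0 +i* 1) * g x)).
Proof.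
by move=> Lf Lg; rewrite innerZr//; case: (inner mu f g) => a b /=; ring.
Qed.

Lemma exists_unitary : exists2 U, unitary_L2 mu U &
  forall n m, {ae mu, forall x, U (u n m) x = v n m x}.
Proof.
(* [U] picks a representative by choice. Coefficients determine it only up to null sets, so every
   property of [U] below holds almost everywhere. *)
have [U HU] : exists U : (T -> R[i]) -> (T -> R[i]), forall f, L2 mu f ->
    L2 mu (U f) /\ forall n m, inner mu (U f) (v n m) = inner mu f (u n m).
  have H f : exists f', L2 mu f ->
      L2 mu f' /\ forall n m, inner mu f' (v n m) = inner mu f (u n m).
    have [/coef_uv[f' ? ?]|nL] := pselect (L2 mu f); first by exists f'.
    by exists f => /nL.
  by exists (fun f => projT1 (cid (H f))) => f; exact: projT2 (cid (H f)).
have cm f : L2 mu f -> cmeas f by exact: L2_cmeas.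
have LU f : L2 mu f -> L2 mu (U f) by move=> /HU[].
have cU f n m : L2 mu f -> inner mu (U f) (v n m) = inner mu f (u n m).
  by move=> /HU[_ ->].
have nU f : L2 mu f -> nrm2 mu (U f) = nrm2 mu f.
  by move=> Lf; apply: coef_nrm2 => //; [exact: LU|move=> n m; exact: cU].
have linU a f g : L2 mu f -> L2 mu g ->
    {ae mu, forall x, U (fun y => a * f y + g y) x = a * U f x + U g x}.
  move=> Lf Lg; have Laf : L2 mu (fun y => a * f y) by exact: L2Z.
  have LaU : L2 mu (fun y => a * U f y) by apply: L2Z; exact: LU.
  apply: coef_ae_eq => [||n m]; first by apply: LU; exact: L2D.
    by apply: L2D => //; exact: LU.
  rewrite cU; last exact: L2D.
  rewrite !innerDl ?innerZl ?cU//; exact: LU.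
have scaleU a f : L2 mu f -> {ae mu, forall x, U (fun y => a * f y) x = a * U f x}.
  move=> Lf; have Laf : L2 mu (fun y => a * f y) by exact: L2Z.
  have LUf := LU _ Lf.
  apply: coef_ae_eq => [||n m]; [exact: LU|exact: L2Z|].
  by rewrite cU// !innerZl// cU.
have aeU f g : L2 mu f -> L2 mu g -> {ae mu, forall x, f x = g x} ->
    {ae mu, forall x, U f x = U g x}.
  move=> Lf Lg fg; apply: coef_ae_eq => [||n m]; [exact: LU|exact: LU|].
  rewrite !cU//; apply: (ae_eq_inner (cm _ Lf) (cm _ Lg) _ _ fg).
  - exact: cm.
  - exact: cm.
  - exact: aeW.
have reU f g : L2 mu f -> L2 mu g ->
    complex.Re (inner mu (U f) (U g)) = complex.Re (inner mu f g).
  move=> Lf Lg; have LUf := LU _ Lf; have LUg := LU _ Lg.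
  rewrite !Re_inner// !nU//; congr ((_ - _ - _) / _).
  have LS : L2 mu (fun x => f x + g x) by exact: L2D.
  rewrite -[RHS]nU//.
  apply: ae_eq_nrm2; [exact/cm/L2D|exact/cm/LU|].
  apply: filterS (linU 1 f g Lf Lg) => x.
  by rewrite mul1r => <-; congr (U _ _); apply/funext => y; rewrite mul1r.
have isoU f g : L2 mu f -> L2 mu g -> inner mu (U f) (U g) = inner mu f g.
  move=> Lf Lg; have LUf := LU _ Lf; have LUg := LU _ Lg.
  apply: complex_eq; first exact: reU.
  have Lig : L2 mu (fun x => (0 +i* 1) * g x) by exact: L2Z.
  rewrite !Im_inner// -[RHS]reU//.
  congr complex.Re; apply: ae_eq_inner; try exact: cm.
  - by apply: cm; exact: L2Z.
  - by apply: cm; exact: LU.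
  - exact: aeW.
  - by apply: filterS (scaleU (0 +i* 1) g Lg) => x ->.
have surU g : L2 mu g -> exists2 f, L2 mu f & {ae mu, forall x, U f x = g x}.
  move=> Lg; have [f Lf fg] := coef_vu Lg; exists f => //.
  by apply: coef_ae_eq => [||n m]; [exact: LU|by []|rewrite cU].
exists U; first by split.
move=> n m; have LUu := LU _ (Lu n m).
(* By surjectivity [D] is some [U f] almost everywhere, and [<U f, U (u n m)> = <f, u n m> = <U f, v
   n m>], so [D] is orthogonal to itself. *)
pose D x := U (u n m) x - v n m x.
have LD : L2 mu D by exact: L2B.
have [f Lf fD] := surU D LD; have LUf := LU _ Lf.
have D0 : nrm2 mu D = 0.
  have : inner mu D D = 0.
    rewrite [LHS](_ : _ = inner mu (U f) D); last first.
      apply: ae_eq_inner; [exact: cm|exact: cm|exact: cm|exact: cm| |exact: aeW].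
      by apply: filterS fD.
    by rewrite innerBr// isoU// cU// subrr.
  by rewrite inner_self => -[].
by apply: filterS (nrm2_eq0 LD D0) => x /eqP; rewrite subr_eq0 => /eqP.
Qed.

End unitary_from_coefficients.

(** * The transforms and their coefficients *)

Section transform_coefficients.
Context (R : realType).

Lemma ae_distribution d d' (T : measurableType d) (T' : measurableType d')
    (P : probability T R) (X : {mfun T >-> T'}) (Q : T' -> Prop) :
  {ae distribution P X, forall x, Q x} -> {ae P, forall x, Q (X x)}.
Proof.
move=> [A [mA A0 QA]]; exists (X @^-1` A); split=> //.
  by rewrite -[X in measurable X]setTI; exact: measurable_funPT.
by move=> x /= nQ; exact: QA.
Qed.

Lemma aux_seq_eq_mom (nu1 nu2 : {measure set R -> \bar R}) n x :
  (forall j, mom nu1 j = mom nu2 j) -> aux_seq nu1 n x = aux_seq nu2 n x.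
Proof.
move=> E; have [m] := ubnP n; elim: m n => // m IH n; rewrite ltnS => nm.
rewrite !aux_seq_mom; congr (_ - _); apply: eq_bigr => k _.
by rewrite E IH// (leq_trans (ltn_ord k)).
Qed.

Lemma cintegral_cst d (T : measurableType d) (P : {measure set T -> \bar R}) (c : R[i]) :
  P setT = 1%E -> cintegral P (fun=> c) = c.
Proof.
by move=> P1; apply: complex_eq; rewrite /= Rintegral_cst// P1 mulr1.
Qed.

(** [1 + A] exceeds the square root of [A], which need not be mentioned. *)
Lemma norm_le_nsq (z : R[i]) (n A : R) : 0 <= n -> nsq z <= n -> n <= A ->
  `|z| <= (1 + A)%:C.
Proof.
move=> n0 zn nA; have A0 : 0 <= A by exact: le_trans nA.
rewrite normc_nsq ?addr_ge0// (le_trans zn)// (le_trans nA)// sqrrD expr1n mul1r.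
by rewrite -addrA ler_wpDl// mulr2n -addrA lerDl addr_ge0// sqr_ge0.
Qed.

(** A disintegration constrains the slices over [[0, 1)] only; the other points are negligible for
    the marginal. *)
Lemma singular_concentrated (K : R.-pker R ~> R) (nu : probability R R)
    (I := `[0, 1[%classic : set R) : nu (~` I) = 0%E ->
  (forall x, I x -> K x I = 1%E) -> {ae nu, forall x, K x (~` I) = 0%E}.
Proof.
move=> nuI KI; have mI : measurable I by exact: measurable_itv.
exists (~` I); split=> //; first exact: measurableC.
move=> x /= nx Ix; apply: nx.
have : (K x I + K x (~` I) = 1)%E.
  rewrite -measureU ?setUv ?setICr//; [exact: kernel_setT|exact: measurableC].
rewrite (KI x Ix); case: (K x (~` I)) => [r| |] //= [r0].
by congr (_%:E); lra.
Qed.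

Variables (mu : probability (R * R)%type R) (gamma rho : R.-pker R ~> R).
Hypothesis mu_square : mu (`[0, 1[ `*` `[0, 1[) = 1%E.
Hypothesis mu_gamma : disintegration1 mu gamma.
Hypothesis mu_rho : disintegration2 mu rho.
Local Notation I := (`[0, 1[%classic : set R).
Local Notation M1 := (marginal1 mu).
Local Notation M2 := (marginal2 mu).
Definition sw (z : R * R) : R * R := (z.2, z.1).

Lemma swK : involutive sw. Proof. by case. Qed.

Lemma measurable_sw : measurable_fun setT sw.
Proof. exact: measurable_swap. Qed.

Lemma idK : involutive (@id (R * R)). Proof. by []. Qed.

Lemma measurable_idRR : measurable_fun setT (@id (R * R)).
Proof. exact: measurable_id. Qed.

Lemma disint1 (f : R * R -> R) : mu.-integrable setT (EFin \o (fun z => f (id z))) ->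
  (\int[mu]_z (f (id z))%:E = \int[M1]_x \int[gamma x]_y (f (x, y))%:E)%E.
Proof. exact: mu_gamma.2. Qed.

Lemma disint2 (f : R * R -> R) : mu.-integrable setT (EFin \o (fun z => f (sw z))) ->
  (\int[mu]_z (f (sw z))%:E = \int[M2]_x \int[rho x]_y (f (x, y))%:E)%E.
Proof. exact: (mu_rho.2 (fun z => f (sw z))). Qed.

Lemma mu_outside (A : set (R * R)) : measurable A -> A `<=` ~` (I `*` I) -> mu A = 0%E.
Proof.
move=> mA AI; have mII : measurable (I `*` I) by apply: measurableX; exact: measurable_itv.
have : mu (~` (I `*` I)) = 0%E by rewrite probability_setC// mu_square subee.
move=> H; apply/eqP; rewrite eq_le measure_ge0 andbT -H.
by apply: le_measure; rewrite ?inE//; exact: measurableC.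
Qed.

Lemma marginal1_outside : M1 (~` I) = 0%E.
Proof.
apply: mu_outside; last by move=> z nz [].
rewrite -[X in measurable X]setTI; apply: measurable_fst => //.
by apply: measurableC; exact: measurable_itv.
Qed.

Lemma marginal2_outside : M2 (~` I) = 0%E.
Proof.
apply: mu_outside; last by move=> z nz [].
rewrite -[X in measurable X]setTI; apply: measurable_snd => //.
by apply: measurableC; exact: measurable_itv.
Qed.

Lemma slice_aux1_L2 n1 n2 : L2 mu (slice_aux1 mu gamma n1 n2).
Proof.
exact: (slice_aux_L2 mu M1 gamma measurable_idRR n1 n2). Qed.

Lemma slice_aux2_L2 n1 n2 : L2 mu (slice_aux2 mu rho n1 n2).
Proof. exact: (slice_aux_L2 mu M2 rho measurable_sw n2 n1). Qed.

Lemma coef1_le f n1 n2 : L2 mu f ->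
  nsq (inner mu f (slice_aux1 mu gamma n1 n2)) <= nrm2 mu f.
Proof. exact: (slice_inner_le measurable_idRR idK disint1 (F := f) n1 n2). Qed.

Lemma coef2_le f n1 n2 : L2 mu f ->
  nsq (inner mu f (slice_aux2 mu rho n1 n2)) <= nrm2 mu f.
Proof.
have -> : f = fun z => f (sw (sw z)) by apply/funext => z; rewrite swK.
exact: (slice_inner_le measurable_sw swK disint2 (F := fun z => f (sw z)) n2 n1).
Qed.

(** The transforms sum in opposite orders, so one double series is exchanged before coefficients are
    compared; Bessel's inequality supplies the uniform bound [A]. *)
Lemma NCT_eqP f f' : L2 mu f -> L2 mu f' ->
  NCT1 mu gamma f = NCT2 mu rho f' <->
  forall n1 n2, inner mu f (slice_aux1 mu gamma n1 n2) =
    inner mu f' (slice_aux2 mu rho n1 n2).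
Proof.
move=> Lf Lf'; pose A := 1 + (nrm2 mu f + nrm2 mu f').
have n0 := nrm2_ge0 mu f; have n0' := nrm2_ge0 mu f'.
have A0 : 0 <= A by rewrite !addr_ge0.
pose a i j := inner mu f (slice_aux1 mu gamma i j).
pose b i j := inner mu f' (slice_aux2 mu rho i j).
have aA i j : `|a i j| <= A%:C.
  by apply: (norm_le_nsq n0 (coef1_le i j Lf)); rewrite lerDl.
have bA i j : `|b i j| <= A%:C.
  by apply: (norm_le_nsq n0' (coef2_le i j Lf')); rewrite lerDr.
split=> [E|E].
  apply: (double_series_inj A0 aA bA) => z w z1 w1.
  have zw1 : (`|(z, w).1| < 1) && (`|(z, w).2| < 1) by rewrite /= z1 w1.
  rewrite (double_series_exchange A0 bA z1 w1).
  exact: (congr1 (fun F => F (exist _ (z, w) zw1)) E).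
apply/funext => -[[z w] /= zw]; have /andP[z1 w1] := zw.
rewrite /NCT1 /NCT2 /= -/(b _ _).
transitivity (cseries (fun j => cseries (fun i => b i j * z ^+ i * w ^+ j))).
  congr cseries; apply/funext => j; congr cseries; apply/funext => i.
  by rewrite E.
exact: double_series_exchange A0 bA z1 w1.
Qed.

End transform_coefficients.

(** * The implications between the four conditions *)

Section implications.
Context (R : realType).
Variables (mu : probability (R * R)%type R) (gamma rho : R.-pker R ~> R).
Hypothesis mu_square : mu (`[0, 1[ `*` `[0, 1[) = 1%E.
Hypothesis mu_gamma : disintegration1 mu gamma.
Hypothesis mu_rho : disintegration2 mu rho.
Hypothesis mu_sing : slice_singular mu gamma rho.
Local Notation I := (`[0, 1[%classic : set R).
Local Notation M1 := (marginal1 mu).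
Local Notation M2 := (marginal2 mu).
Local Notation aux1 := (slice_aux1 mu gamma).
Local Notation aux2 := (slice_aux2 mu rho).

Let M11 : M1 setT = 1%E. Proof. exact: probability_setT. Qed.
Let M21 : M2 setT = 1%E. Proof. exact: probability_setT. Qed.
Let mu1 : mu setT = 1%E. Proof. exact: probability_setT. Qed.

Lemma parseval_slice1 f : L2 mu f ->
  (\sum_(0 <= m <oo) \sum_(0 <= n <oo) (nsq (inner mu f (aux1 n m)))%:E =
   (nrm2 mu f)%:E)%E.
Proof.
have [s1 s2 s3 s4] := mu_sing.
apply: (slice_parseval (measurable_idRR (R := R)) (idK (R := R)) (disint1 mu_gamma)
  (marginal1_outside mu_square) s1 _ s3 (F := f)).
by apply: singular_concentrated; [exact: marginal1_outside|exact: mu_gamma.1].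
Qed.

Lemma parseval_slice2 f : L2 mu f ->
  (\sum_(0 <= n <oo) \sum_(0 <= m <oo) (nsq (inner mu f (aux2 n m)))%:E =
   (nrm2 mu f)%:E)%E.
Proof.
have [s1 s2 s3 s4] := mu_sing.
have -> : f = fun z => f (sw (sw z)) by apply/funext => z; rewrite swK.
apply: (slice_parseval (measurable_sw (R := R)) (swK (R := R)) (disint2 mu_rho)
  (marginal2_outside mu_square) s2 _ s4 (F := fun z => f (sw z))).
by apply: singular_concentrated; [exact: marginal2_outside|exact: mu_rho.1].
Qed.

Lemma unitary_of_image_eq :
  NCT1 mu gamma @` L2 mu = NCT2 mu rho @` L2 mu ->
  exists2 U, unitary_L2 mu U &
    forall n1 n2 : nat, {ae mu, forall x, U (aux1 n1 n2) x = aux2 n1 n2 x}.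
Proof.
move=> E; apply: exists_unitary.
- exact: slice_aux1_L2.
- exact: slice_aux2_L2.
- exact: parseval_slice1.
- exact: parseval_slice2.
- move=> f Lf; have : (NCT2 mu rho @` L2 mu) (NCT1 mu gamma f) by rewrite -E; exists f.
  move=> [f' Lf' /esym/(NCT_eqP mu_gamma mu_rho Lf Lf') H].
  by exists f' => // n m; rewrite H.
- move=> f Lf; have : (NCT1 mu gamma @` L2 mu) (NCT2 mu rho f) by rewrite E; exists f.
  move=> [f' Lf' /(NCT_eqP mu_gamma mu_rho Lf' Lf) H].
  by exists f' => // n m; rewrite H.
Qed.

Lemma cintegral_marginal1 (f : R -> R[i]) C : cmeas f -> (forall x, nsq (f x) <= C) ->
  cintegral mu (fun z => f z.1) = cintegral M1 f.
Proof.
move=> mf fC.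
have If : cintegrable mu (fun z => f z.1).
  by apply: (cintegrable_bounded mu1 (cmeas_comp measurable_fst mf) (C := C)) => z.
have [_ ->] := slice_cintegral (measurable_idRR (R := R)) (idK (R := R))
  (disint1 mu_gamma) (F := fun z => f z.1) If.
congr cintegral; apply/funext => x /=.
exact: (cintegral_cst (f x) (kernel_setT gamma x)).
Qed.

Lemma product_of_unitary :
  (exists2 U, unitary_L2 mu U &
    forall n1 n2 : nat, {ae mu, forall x, U (aux1 n1 n2) x = aux2 n1 n2 x}) ->
  product_measure_on_square mu.
Proof.
move=> [U [LU _ _ isoU _] UE].
have L1 := slice_aux1_L2 mu gamma; have L22 := slice_aux2_L2 mu rho.
have La n : L2 M1 (aux_seq M1 n) by exact: L2_aux.
have fstE (f : R -> R[i]) : trig f -> cintegral mu (fun z => f z.1) = cintegral M1 f.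
  move=> tf; have [C fC] := trig_bounded tf.
  exact: (cintegral_marginal1 (trig_cmeas tf) fC).
have momE j : mom M1 j = cintegral M2 (fun x => mom (rho x) j).
  rewrite /mom -fstE; last exact: trig_expz.
  have If : cintegrable mu (fun z : R * R => expz j (sw z).2).
    apply: (cintegrable_bounded mu1 (C := 1)) => [|z]; last by rewrite nsq_expz.
    exact: (cmeas_comp measurable_fst (cmeas_expz R j)).
  by have [_ ->] := slice_cintegral (measurable_sw (R := R)) (swK (R := R))
    (disint2 mu_rho) (F := fun z => expz j z.2) If.
have gramE n m : inner M1 (aux_seq M1 n) (aux_seq M1 m) =
    cintegral M2 (fun x => inner (rho x) (aux_seq (rho x) n) (aux_seq (rho x) m)).
  have aux0 (nu : {measure set R -> \bar R}) x : aux_seq nu 0 x = 1.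
    by rewrite aux_seq0 expi_expz expz0.
  (* Second index 0 trivialises the slice factor in the first family and the marginal factor in the
     second, so [U] sends marginal functions to slice functions. *)
  transitivity (inner mu (aux1 n 0) (aux1 m 0)).
    rewrite /inner -fstE; last first.
      by apply: trigM; [|apply: trigJ]; exact: aux_seq_trig.
    by congr cintegral; apply/funext => z; rewrite /slice_aux1 !aux0 !mul1r.
  transitivity (inner mu (aux2 n 0) (aux2 m 0)).
    rewrite -isoU//; apply: ae_eq_inner; try exact: UE; apply: L2_cmeas;
      by [exact: LU|exact: L22].
  have If : cintegrable mu (fun z => slice_aux M2 rho 0 n (sw z) *
      (slice_aux M2 rho 0 m (sw z))^*).
    exact: (L2_inner (L22 n 0%N) (L22 m 0%N)).
  have [_ E] := slice_cintegral (measurable_sw (R := R)) (swK (R := R))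
    (disint2 mu_rho) (F := fun z => slice_aux M2 rho 0 n z * (slice_aux M2 rho 0 m z)^*) If.
  rewrite -[LHS]/(cintegral mu _) [LHS]E; congr cintegral; apply/funext => x.
  by congr cintegral; apply/funext => y; rewrite /slice_aux /= !aux0 !mulr1.
have momK := mom_ae gramE momE.
have M1I := marginal1_outside mu_square; have M2I := marginal2_outside mu_square.
have one (P : probability R R) : P (~` I) = 0%E -> P I = 1%E.
  move=> P0; rewrite -[I]setCK probability_setC ?P0 ?sube0//.
  by apply: measurableC; exact: measurable_itv.
exists M1, M2; split; [exact: one|exact: one|] => A mA.
apply/esym; apply: (product_measure_unique (m' := mu)) => // B C mB mC.
exact: (mom_product (disint2 mu_rho)).
Qed.

Lemma NCT_eq_of_product : product_measure_on_square mu ->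
  forall f, L2 mu f -> NCT1 mu gamma f = NCT2 mu rho f.
Proof.
move=> [nu1 [nu2 [_ _ muE]]].
have rect A B : measurable A -> measurable B -> mu (A `*` B) = (nu1 A * nu2 B)%E.
  by move=> mA mB; rewrite muE ?product_measure1E//; exact: measurableX.
(* The given factors are identified with the marginals, to which [gamma] and [rho] are tied. *)
have M1E A : measurable A -> M1 A = nu1 A.
  move=> mA; rewrite -[RHS]mule1 -[1%E](@probability_setT _ _ _ nu2) -rect//.
  by congr (mu _); apply/seteqP; split => z //= -[].
have M2E A : measurable A -> M2 A = nu2 A.
  move=> mA; rewrite -[RHS]mul1e -[1%E](@probability_setT _ _ _ nu1) -rect//.
  by congr (mu _); apply/seteqP; split => z //= -[].
have muP A : measurable A -> mu A = (M1 \x M2)%E A.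
  move=> mA; apply/esym; apply: (product_measure_unique (m' := mu)) => // B C mB mC.
  apply: (etrans (rect B C mB mC)); congr (_ * _)%E; [exact/esym/M1E|exact/esym/M2E].
have intP (f : R * R -> \bar R) :
    (\int[mu]_z f z = \int[(M1 \x M2)%E]_z f z)%E.
  by apply: eq_measure_integral => A mA _; exact: muP.
have integP (f : R * R -> \bar R) :
    mu.-integrable setT f -> (M1 \x M2)%E.-integrable setT f.
  by move=> /integrableP[mf If]; apply/integrableP; split=> //; rewrite -intP.
have prod1 (f : R * R -> R) : mu.-integrable setT (EFin \o (fun z => f (id z))) ->
    (\int[mu]_z (f (id z))%:E = \int[M1]_x \int[M2]_y (f (x, y))%:E)%E.
  move=> If; rewrite intP; apply/esym.
  exact: (integral12_prod_meas1 (integP _ If)).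
have prod2 (f : R * R -> R) : mu.-integrable setT (EFin \o (fun z => f (sw z))) ->
    (\int[mu]_z (f (sw z))%:E = \int[M2]_x \int[M1]_y (f (x, y))%:E)%E.
  move=> If; rewrite intP; apply/esym.
  exact: (integral21_prod_meas1 (integP _ If)).
have mom1 := product_mom_ae (measurable_idRR (R := R)) (idK (R := R))
  (disint1 mu_gamma) prod1.
have mom2 := product_mom_ae (measurable_sw (R := R)) (swK (R := R))
  (disint2 mu_rho) prod2.
move=> f Lf; apply/(NCT_eqP mu_gamma mu_rho Lf Lf) => n1 n2.
have cm g : L2 mu g -> cmeas g by exact: L2_cmeas.
apply: (ae_eq_inner (cm _ Lf) (cm _ Lf)).
- by apply: cm; exact: slice_aux1_L2.
- by apply: cm; exact: slice_aux2_L2.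
- exact: aeW.
(* Statements almost sure for a marginal lift to [mu] along the coordinates; both families then
   become the product of the auxiliary sequences of the two marginals. *)
- apply: filterS2 (ae_distribution mom1) (ae_distribution mom2) => z e1 e2.
  by rewrite /slice_aux1 /slice_aux2 (aux_seq_eq_mom _ _ e1) (aux_seq_eq_mom _ _ e2) mulrC.
Qed.

End implications.

Theorem theorem4p7 (R : realType) (mu : probability (R * R)%type R)
    (gamma rho : R.-pker R ~> R)
    (mu_square : mu (`[0, 1[ `*` `[0, 1[) = 1%E)
    (mu_gamma : disintegration1 mu gamma)
    (mu_rho : disintegration2 mu rho)
    (mu_sing : slice_singular mu gamma rho) :
  [<-> (* 1 *) forall f, L2 mu f -> NCT1 mu gamma f = NCT2 mu rho f;
       (* 2 *) NCT1 mu gamma @` L2 mu = NCT2 mu rho @` L2 mu;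
       (* 3 *) exists2 U, unitary_L2 mu U &
                 forall n1 n2 : nat, {ae mu, forall x,
                   U (slice_aux1 mu gamma n1 n2) x = slice_aux2 mu rho n1 n2 x};
       (* 4 *) product_measure_on_square mu].
Proof.
tfae.
- move=> E; rewrite eqEsubset; split => F [f Lf <-]; exists f.
  + exact: Lf.
  + exact: (esym (E f Lf)).
  + exact: Lf.
  + exact: (E f Lf).
- exact: unitary_of_image_eq.
- exact: product_of_unitary.
- exact: NCT_eq_of_product.
Qed.
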